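(* Let $\alpha,\beta\in\,]-1/2,\infty[$ with $\beta>\alpha$. (i) (Inversion formulas) For all $f\in\Phi_\alpha$ and $g\in\Phi_\beta$, $$\text{(a)}\quad g=S_{\alpha,\beta}\,K_1\,({}^tS_{\alpha,\beta})(g),\qquad \text{(b)}\quad f=({}^tS_{\alpha,\beta})\,K_2\,S_{\alpha,\beta}(f),$$ where (b) is understood to include that $S_{\alpha,\beta}(f)\in\Phi_\beta$, so that $K_2$ may be applied. (ii) (Plancherel formula) For all $f\in\Phi_\beta$, $$\int_{\mathbb{R}}|f(x)|^2|x|^{2\beta+1}\,dx=\int_{\mathbb{R}}\bigl|K_3({}^tS_{\alpha,\beta}(f))(x)\bigr|^2|x|^{2\alpha+1}\,dx.$$
   Context: $\mathcal{E}(\mathbb{R})$ is the space of $C^\infty$ functions on $\mathbb{R}$ and $\mathcal{S}(\mathbb{R})$ the Schwartz space (complex-valued functions). Dunkl kernel: for $\gamma>-1/2$ and $z\in\mathbb{C}$, $E_\gamma(z)=\Im_\gamma(z)+\frac{z}{2(\gamma+1)}\Im_{\gamma+1}(z)$, where $\Im_\gamma(z)=\Gamma(\gamma+1)\sum_{n\ge0}\frac{(z/2)^{2n}}{n!\,\Gamma(n+\gamma+1)}$. Dunkl transform: $\mathcal{F}_\gamma(f)(\lambda)=\int_{\mathbb{R}}E_\gamma(-i\lambda x)f(x)|x|^{2\gamma+1}dx$, $\lambda\in\mathbb{R}$, $f\in\mathcal{S}(\mathbb{R})$. It is known that $\mathcal{F}_\gamma$ is a topological automorphism of $\mathcal{S}(\mathbb{R})$,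 with inverse $\mathcal{F}_\gamma^{-1}(h)(x)=c_\gamma\int_{\mathbb{R}}E_\gamma(i\lambda x)h(\lambda)|\lambda|^{2\gamma+1}d\lambda$, where $c_\gamma=\frac{1}{[2^{\gamma+1}\Gamma(\gamma+1)]^2}$. Lizorkin-type space: $\Phi_\gamma=\{f\in\mathcal{S}(\mathbb{R}):\int_{\mathbb{R}}f(y)\,y^k|y|^{2\gamma+1}dy=0\ \ \forall k\in\mathbb{N}\}$, $\mathbb{N}=\{0,1,2,\dots\}$. Dunkl Sonine transform: with $a_{\alpha,\beta}=\frac{\Gamma(\beta+1)}{\Gamma(\beta-\alpha)\Gamma(\alpha+1)}$, $$S_{\alpha,\beta}(f)(x)=a_{\alpha,\beta}\int_{-1}^1 f(xt)(1-t^2)^{\beta-\alpha-1}(1+t)|t|^{2\alpha+1}dt,\quad f\in\mathcal{E}(\mathbb{R}).$$ Dual Dunkl Sonine transform: $${}^tS_{\alpha,\beta}(f)(x)=a_{\alpha,\beta}\int_{|y|\ge|x|}\operatorname{sgn}(y)(y^2-x^2)^{\beta-\alpha-1}(x+y)f(y)\,dy,\quad f\in\mathcal{S}(\mathbb{R}).$$ Operators: $$K_1(f)=\frac{c_\beta}{c_\alpha}\mathcal{F}_\alpha^{-1}\bigl(|\lambda|^{2(\beta-\alpha)}\mathcal{F}_\alpha(f)\bigr)=\frac{c_\beta}{c_\alpha}(-\Delta_\alpha)^{\beta-\alpha}f,\quad f\in\Phi_\alpha,$$ $$K_2(f)=\frac{c_\beta}{c_\alpha}\mathcal{F}_\beta^{-1}\bigl(|\lambda|^{2(\beta-\alpha)}\mathcal{F}_\beta(f)\bigr)=\frac{c_\beta}{c_\alpha}(-\Delta_\beta)^{\beta-\alpha}f,\quad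 f\in\Phi_\beta,$$ $$K_3(f)=\sqrt{\tfrac{c_\beta}{c_\alpha}}\,\mathcal{F}_\alpha^{-1}\bigl(|\lambda|^{\beta-\alpha}\mathcal{F}_\alpha(f)\bigr)=\sqrt{\tfrac{c_\beta}{c_\alpha}}\,(-\Delta_\alpha)^{(\beta-\alpha)/2}f,\quad f\in\Phi_\alpha.$$ The first expression in each line may be taken as the definition; in the second, $(-\Delta_\gamma)^{\mu}$ denotes the complex power of the Dunkl Laplacian $\Delta_\gamma=\Lambda_\gamma^2$, where $\Lambda_\gamma f(x)=f'(x)+\frac{2\gamma+1}{x}\cdot\frac{f(x)-f(-x)}{2}$, and on $\Phi_\gamma$ it acts by $\mathcal{F}_\gamma((-\Delta_\gamma)^\mu f)(x)=|x|^{2\mu}\mathcal{F}_\gamma(f)(x)$. *)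

(* Defs.v *)
From mathcomp Require Import all_boot all_order all_algebra.
From mathcomp Require Export complex.
From mathcomp Require Export all_classical all_reals all_analysis.
Set Implicit Arguments.
Unset Strict Implicit.
Unset Printing Implicit Defensive.
Import Order.TTheory GRing.Theory Num.Theory.
Import numFieldNormedType.Exports.
Local Open Scope classical_set_scope.
Local Open Scope ring_scope.
Local Open Scope complex_scope.

(* Calculus of R[i]-valued maps is taken componentwise (the topology of R[i]
   is the product one). *)

Definition clim (R : realType) (u : nat -> R[i]) : R[i] :=
  limn (fun n => complex.Re (u n)) +i* limn (fun n => complex.Im (u n)).

Definition cint (R : realType) (D : set R) (f : R -> R[i]) : R[i] :=
  Rintegral (@lebesgue_measure R) D (fun x => complex.Re (f x)) +i*
  Rintegral (@lebesgue_measure R) D (fun x => complex.Im (f x)).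

Definition cderive1n (R : realType) (n : nat) (f : R -> R[i]) (x : R) : R[i] :=
  derive1n n (fun y => complex.Re (f y)) x +i*
  derive1n n (fun y => complex.Im (f y)) x.

Definition smooth (R : realType) (f : R -> R[i]) : Prop :=
  forall (n : nat) (x : R),
    derivable (derive1n n (fun y => complex.Re (f y))) x 1 /\
    derivable (derive1n n (fun y => complex.Im (f y))) x 1.

Definition cabs (R : realType) (z : R[i]) : R := complex.Re `|z|.

Definition schwartz (R : realType) (f : R -> R[i]) : Prop :=
  smooth f /\
  forall m n : nat, exists M : R, forall x : R,
    `|x| ^+ m * cabs (cderive1n n f x) <= M.

(* Euler's integral: meaningful for 0 < x only, which covers every use below. *)
Definition Gamma (R : realType) (x : R) : R :=
  Rintegral (@lebesgue_measure R) `]0, +oo[ (fun t => t `^ (x - 1) * expR (- t)).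

Definition bessel_frakI (R : realType) (gamma : R) (z : R[i]) : R[i] :=
  (Gamma (gamma + 1))%:C *
  clim (fun N => \sum_(0 <= n < N)
    (z / 2) ^+ (2 * n) / (n`!%:R * (Gamma (n%:R + gamma + 1))%:C)).

Definition dunkl_kernel (R : realType) (gamma : R) (z : R[i]) : R[i] :=
  bessel_frakI gamma z +
  z / (2 * (gamma + 1))%:C * bessel_frakI (gamma + 1) z.

Definition dunkl_transform (R : realType) (gamma : R) (f : R -> R[i])
    (lambda : R) : R[i] :=
  cint setT (fun x =>
    dunkl_kernel gamma (- 'i%C * (lambda * x)%:C) * f x *
    (`|x| `^ (2 * gamma + 1))%:C).

Definition dunkl_c (R : realType) (gamma : R) : R :=
  1 / (2 `^ (gamma + 1) * Gamma (gamma + 1)) ^+ 2.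

Definition dunkl_inverse (R : realType) (gamma : R) (h : R -> R[i])
    (x : R) : R[i] :=
  (dunkl_c gamma)%:C *
  cint setT (fun lambda =>
    dunkl_kernel gamma ('i%C * (lambda * x)%:C) * h lambda *
    (`|lambda| `^ (2 * gamma + 1))%:C).

Definition lizorkin (R : realType) (gamma : R) (f : R -> R[i]) : Prop :=
  schwartz f /\
  forall k : nat,
    cint setT (fun y => f y * (y ^+ k)%:C * (`|y| `^ (2 * gamma + 1))%:C) = 0.

Definition sonine_a (R : realType) (alpha beta : R) : R :=
  Gamma (beta + 1) / (Gamma (beta - alpha) * Gamma (alpha + 1)).

(* The singular weights below use 0 `^ a = 0 for a <> 0 (and 0 `^ 0 = 1); this
   only affects integrands on null sets. *)
Definition sonine (R : realType) (alpha beta : R) (f : R -> R[i])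
    (x : R) : R[i] :=
  (sonine_a alpha beta)%:C *
  cint `[-1, 1] (fun t =>
    f (x * t) *
    ((1 - t ^+ 2) `^ (beta - alpha - 1) * (1 + t) *
     `|t| `^ (2 * alpha + 1))%:C).

Definition dual_sonine (R : realType) (alpha beta : R) (f : R -> R[i])
    (x : R) : R[i] :=
  (sonine_a alpha beta)%:C *
  cint [set y : R | `|x| <= `|y|] (fun y =>
    (Num.sg y * (y ^+ 2 - x ^+ 2) `^ (beta - alpha - 1) * (x + y))%:C * f y).

Definition K1 (R : realType) (alpha beta : R) (f : R -> R[i]) (x : R) : R[i] :=
  (dunkl_c beta / dunkl_c alpha)%:C *
  dunkl_inverse alpha (fun lambda =>
    (`|lambda| `^ (2 * (beta - alpha)))%:C * dunkl_transform alpha f lambda) x.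

Definition K2 (R : realType) (alpha beta : R) (f : R -> R[i]) (x : R) : R[i] :=
  (dunkl_c beta / dunkl_c alpha)%:C *
  dunkl_inverse beta (fun lambda =>
    (`|lambda| `^ (2 * (beta - alpha)))%:C * dunkl_transform beta f lambda) x.

Definition K3 (R : realType) (alpha beta : R) (f : R -> R[i]) (x : R) : R[i] :=
  (Num.sqrt (dunkl_c beta / dunkl_c alpha))%:C *
  dunkl_inverse alpha (fun lambda =>
    (`|lambda| `^ (beta - alpha))%:C * dunkl_transform alpha f lambda) x.

(* Main.v *)
From HB Require Import structures.
Require Import Defs.
From mathcomp Require Import all_boot all_order all_algebra.
From mathcomp Require Import ring lra.
From mathcomp Require Import all_classical all_reals all_analysis.
From mathcomp Require Import measurable_realfun.
Set Implicit Arguments.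
Unset Strict Implicit.
Unset Printing Implicit Defensive.
Import Order.TTheory GRing.Theory Num.Theory.
Import numFieldNormedType.Exports.
Local Open Scope classical_set_scope.
Local Open Scope ring_scope.

(** The theorem splits into statements about real even functions.  A Schwartz
    function is e + x o with e and o even Schwartz functions (Hadamard division),
    and a complex one consists of two such pairs.  On e the Dunkl transform of
    index g is the Hankel transform
      H_g phi (l) = \int phi(x) j_g(l x) |x|^(2g+1) dx,
    with j_g the normalised Bessel function, and on x o it is, up to the factor
    - i l / (2g + 2), the Hankel transform of o of index g + 1.  The Sonine
    transform and its dual act on e with the indices (alpha, beta), and on o with
    (alpha + 1, beta + 1) and an additional factor (alpha + 1) / (beta + 1).  These
    factors cancel against the change of the constants c_g from g to g + 1, so both
    parities reduce to the same three identities for even functions: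
    sonine_power_dual, dual_power_sonine and plancherel_power_dual.

    On even functions the Hankel transforms turn every operator into multiplication
    by a power of |l|.  Sonine's
    integral expresses j_beta as an average of j_alpha (sonine_bessel, by termwise
    integration and Euler's Beta integral).  By Fubini's theorem it says that the
    dual transform T intertwines the two Hankel transforms, H_alpha T = H_beta
    (hankel_dual), and that the Sonine transform S satisfies
    S H_alpha h = H_beta (|l|^(-2(beta-alpha)) h) (sonine_hankel).  Since
    c_g H_g H_g = 1 (hankelK), conjugating the power |l|^(2(beta-alpha)) by the
    Hankel transform yields both inversion formulas, and the power
    |l|^(beta-alpha) together with the Plancherel formula of H_g
    (hankel_plancherel) yields the third identity.

    The negative power is legitimate because the Hankel transform of a function all
    of whose moments vanish is flat at 0 and conversely (hankel_flat,
    hankel_lizorkin), and flat functions are stable under multiplication by powers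
    of |l| (flat_schwartz_powR).

    Hankel inversion needs no Fourier theory: H_g H_g commutes with multiplication
    by x^2, which by Hadamard division makes it multiplication by a function; the
    Gaussian shows that this function is constant.

    Smoothness is handled by coinduction.  An even Schwartz function is a rapidly
    decreasing even function f for which f'(x) / x is again of this kind (tower,
    even_schwartz); this derivation turns H_g into a multiple of H_(g+1) and commutes
    with the dual Sonine transform, so that each stability property takes a single
    step. *)

(** * Change of variables for Lebesgue measure on the line *)

Section density.
Variable R : realType.
Local Notation mu := (@lebesgue_measure R).
Variables (phi : measurableTypeR R -> measurableTypeR R) (rho : measurableTypeR R -> R).
Hypothesis mphi : measurable_fun setT phi.
Hypothesis mrho : measurable_fun setT rho.
Hypothesis rho0 : forall x, 0 <= rho x.

Definition density_image (A : set (measurableTypeR R)) : \bar R :=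
  (\int[mu]_(x in phi @^-1` A) (rho x)%:E)%E.

Let mpre (A : set (measurableTypeR R)) : measurable A -> measurable (phi @^-1` A).
Proof. by move=> mA; rewrite -(setTI (_ @^-1` _)); exact: mphi. Qed.

Let dens0 : density_image set0 = 0%E.
Proof. by rewrite /density_image preimage_set0 integral_set0. Qed.

Let dens_ge0 A : (0 <= density_image A)%E.
Proof. by apply: integral_ge0 => x _; rewrite lee_fin. Qed.

Let dens_sigma : semi_sigma_additive density_image.
Proof.
move=> F mF tF mUF; rewrite /density_image preimage_bigcup.
rewrite ge0_integral_bigcup//; last 4 first.
- by move=> k; exact: mpre.
- exact/measurable_EFinP/measurable_funTS.
- by move=> x _; rewrite lee_fin.
- apply/trivIsetP => i j _ _ ij; rewrite -preimage_setI.
  by move/trivIsetP : tF => -> //; rewrite preimage_set0.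
by apply: is_cvg_nneseries => n _ _; exact: dens_ge0.
Qed.

HB.instance Definition _ := isMeasure.Build _ _ _ density_image
  dens0 dens_ge0 dens_sigma.

Hypothesis Hitv : forall a b : R,
  (\int[mu]_(x in phi @^-1` `]a, b]) (rho x)%:E)%E = mu `]a, b].

Import HBNNSimple.

Let densE (A : set (measurableTypeR R)) : measurable A -> mu A = density_image A.
Proof.
move=> mA; apply: (@lebesgue_measure_unique R density_image) => // X [[a b] _ <-] /=.
by rewrite /density_image Hitv.
Qed.

Let mfA (A : set (measurableTypeR R)) : measurable A ->
  measurable_fun setT (fun x => \1_A (phi x) : R).
Proof.
by move=> mA; apply: (@measurableT_comp _ _ _ _ _ _ (\1_A : _ -> R)) => //.
Qed.

(** Lebesgue measure is the only measure with the right values on half-open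
    intervals, so checking the substitution on these intervals is enough; simple
    functions and monotone convergence do the rest. *)
Lemma ge0_change_of_variable (h : measurableTypeR R -> \bar R) :
  measurable_fun setT h -> (forall x, 0 <= h x)%E ->
  (\int[mu]_x h x = \int[mu]_x (h (phi x) * (rho x)%:E))%E.
Proof.
move=> mh h0.
pose f_ := nnsfun_approx measurableT mh.
have f_cvg x : (f_ n x)%:E @[n --> \oo] --> h x.
  by apply: cvg_nnsfun_approx.
have f_nd x : {homo (fun n => f_ n x) : n m / (n <= m)%N >-> n <= m}.
  by move=> m n mn; exact/lefP/nd_nnsfun_approx.
transitivity (limn (fun n => \int[mu]_x (f_ n x)%:E))%E.
  rewrite -monotone_convergence//.
  - by apply: eq_integral => y _; apply/esym/cvg_lim => //; exact: f_cvg.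
  - by move=> n; exact/measurable_EFinP/measurable_funP.
  - by move=> n y _; rewrite lee_fin.
  - by move=> y _ m n mn; rewrite lee_fin; exact: f_nd.
transitivity (limn (fun n => \int[mu]_x ((f_ n (phi x))%:E * (rho x)%:E)))%E; last first.
  rewrite -monotone_convergence//.
  - apply: eq_integral => y _; apply/cvg_lim => //.
    by apply: cvgeZr => //; exact: f_cvg.
  - move=> n; apply: emeasurable_funM; apply/measurable_EFinP => //.
    exact: measurableT_comp.
  - by move=> n y _; rewrite mule_ge0// lee_fin.
  - by move=> y _ m n mn; rewrite -!EFinM lee_fin ler_wpM2r//; exact: f_nd.
congr (limn _); apply/funext => n.
transitivity (\sum_(k \in range (f_ n)) k%:E * mu (f_ n @^-1` [set k]))%E.
  by rewrite integralT_nnsfun sintegralE.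
transitivity (\int[mu]_x (\sum_(k \in range (f_ n))
    (k * \1_(f_ n @^-1` [set k]) (phi x) * rho x)%:E))%E; last first.
  apply: eq_integral => x _; rewrite fsumEFin// -EFinM; congr EFin.
  rewrite -mulr_fsuml//; congr (_ * _); exact/esym/fimfunE.
rewrite ge0_integral_fsum//; last 2 first.
  - move=> k; apply/measurable_EFinP; apply: measurable_funM => //.
    by apply: measurable_funM => //; exact: mfA.
  - move=> k x _; rewrite lee_fin mulr_ge0//.
    by have := nnfun_muleindic_ge0 (f_ n) k (phi x); rewrite -EFinM lee_fin.
apply: eq_fsbigr => k /[!inE] [[x0 _ kE]].
have k0 : 0 <= k by rewrite -kE.
rewrite densE// /density_image.
under [RHS]eq_integral do rewrite -mulrA EFinM.
rewrite ge0_integralZl_EFin//; last 2 first.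
  - by move=> x _; rewrite lee_fin mulr_ge0.
  - by apply/measurable_EFinP/measurable_funM => //; exact: mfA.
congr (_ * _)%E.
rewrite [LHS]integral_mkcond; apply: eq_integral => x _.
rewrite patchE indicE.
have [hx|hx] := pselect ((f_ n @^-1` [set k]) (phi x)).
  by rewrite !mem_set// mul1r.
by rewrite !memNset// mul0r.
Qed.

End density.

(** * Rules of differentiation *)

Section derivative_rules.
Variable R : realType.
Implicit Types (f g : R -> R) (x a b c : R).

Lemma dD f g x a b : is_derive x 1 f a -> is_derive x 1 g b ->
  is_derive x 1 (fun y => f y + g y) (a + b).
Proof. by move=> hf hg; exact: is_deriveD. Qed.

Lemma dN f x a : is_derive x 1 f a -> is_derive x 1 (fun y => - f y) (- a).
Proof. by move=> hf; exact: is_deriveN. Qed.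

Lemma dB f g x a b : is_derive x 1 f a -> is_derive x 1 g b ->
  is_derive x 1 (fun y => f y - g y) (a - b).
Proof. by move=> hf hg; exact: is_deriveB. Qed.

Lemma dM f g x a b : is_derive x 1 f a -> is_derive x 1 g b ->
  is_derive x 1 (fun y => f y * g y) (a * g x + f x * b).
Proof.
move=> hf hg; apply: (is_derive_eq (is_deriveM hf hg)).
by rewrite /GRing.scale/= addrC mulrC.
Qed.

Lemma dcst c x : is_derive x 1 (fun=> c) 0.
Proof. exact: is_derive_cst. Qed.

Lemma dZ c f x a : is_derive x 1 f a -> is_derive x 1 (fun y => c * f y) (c * a).
Proof.
by move=> hf; apply: (is_derive_eq (dM (dcst c x) hf)); rewrite mul0r add0r.
Qed.

Lemma dX f n x a : is_derive x 1 f a ->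
  is_derive x 1 (fun y => f y ^+ n) (n%:R * f x ^+ n.-1 * a).
Proof.
move=> hf; elim: n => [|n ih].
  by rewrite !mul0r; exact: dcst.
have -> : (fun y => f y ^+ n.+1) = (fun y => f y * f y ^+ n).
  by apply/funext => y; rewrite exprS.
apply: (is_derive_eq (dM hf ih)).
case: n {ih} => [|n] /=; first by rewrite expr0; ring.
by rewrite exprS (mulrSr _ n.+1); ring.
Qed.

Lemma did x : is_derive x 1 (fun y => y) 1.
Proof. exact: is_derive_id. Qed.

Lemma dchain f g x a b : is_derive (g x) 1 f a -> is_derive x 1 g b ->
  is_derive x 1 (fun y => f (g y)) (a * b).
Proof. by move=> hf hg; exact: (is_derive1_comp hf hg). Qed.

(** The inner derivative comes first, so that it fixes the decomposition of the
    composite by unification. *)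
Lemma dcompo f g x a b : is_derive x 1 g b -> is_derive (g x) 1 f a ->
  is_derive x 1 (fun y => f (g y)) (a * b).
Proof. by move=> hg hf; exact: dchain. Qed.

Lemma dcont f x a : is_derive x 1 f a -> {for x, continuous f}.
Proof.
by case=> hf _; exact/differentiable_continuous/derivable1_diffP.
Qed.

Lemma dcontT f (f' : R -> R) : (forall x, is_derive x 1 f (f' x)) -> continuous f.
Proof. by move=> hf x; exact: dcont (hf x). Qed.

Lemma deq f x a b : is_derive x 1 f a -> a = b -> is_derive x 1 f b.
Proof. by move=> h <-. Qed.

Lemma dlocal f g x a (e : R) : 0 < e ->
  (forall y, `|y - x| < e -> f y = g y) ->
  is_derive x 1 f a -> is_derive x 1 g a.
Proof.
move=> e0 fg; apply: near_eq_is_derive.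
by exists e => //= y; rewrite /ball_/= distrC => /fg.
Qed.

Lemma duniq f x a b : is_derive x 1 f a -> is_derive x 1 f b -> a = b.
Proof. by case=> _ <- [_ <-]. Qed.

Lemma is_derive_eps f x a :
  (forall e : R, 0 < e -> exists2 d : R, 0 < d &
    forall h, `|h| < d -> `|f (x + h) - f x - a * h| <= e * `|h|) ->
  is_derive x 1 f a.
Proof.
move=> H.
suff : h^-1 *: ((f \o shift x) (h *: 1) - f x) @[h --> 0^'] --> a.
  move=> hc; split; first by apply/cvg_ex; exists a.
  exact: cvg_lim hc.
apply/cvgrPdist_le => /= e e0; have [d d0 hd] := H e e0.
near=> h.
have h0 : h != 0 by near: h; exact: nbhs_dnbhs_neq.
have hh : `|h| < d.
  near: h; apply: nbhs_dnbhs; exists d => //= y /=.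
  by rewrite /ball_/= sub0r normrN.
have := hd h hh.
rewrite /GRing.scale/= mulr1 (addrC h x) => K.
have h1 : 0 < `|h| by rewrite normr_gt0.
rewrite -(ler_pM2r h1) -normrM.
rewrite mulrBl mulrAC mulVf// mul1r -normrN opprB.
exact: K.
Unshelve. all: by end_near. Qed.

(** |x|^s x is the antiderivative of (s + 1)|x|^s on the whole line, including
    the origin; this keeps every integration by parts below free of boundary
    terms at 0. *)
Lemma is_derive_abs_powRx (s x : R) : 0 < s ->
  is_derive x 1 (fun y => `|y| `^ s * y) ((s + 1) * `|x| `^ s).
Proof.
move=> s0; have E (z : R) : 0 < z -> z `^ (s + 1) = z `^ s * z.
  by move=> z0; rewrite powRD ?powRr1 ?ltW// (gt_eqF z0) implybT.
have [x0|x0|->] := ltgtP x 0.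
- apply: (@dlocal (fun y => - (- y) `^ (s + 1)) _ _ _ (- x)).
  + by rewrite oppr_gt0.
  + move=> y /ltr_distlDr; rewrite subrr => y0.
    by rewrite ltr0_norm// E ?oppr_gt0// mulrN opprK.
  + have nx : 0 < - x by rewrite oppr_gt0.
    apply: (deq (dN (dchain (is_derive1_powR (s + 1) nx) (dN (did x))))).
    by rewrite ltr0_norm// addrK mulrN1 opprK.
- apply: (@dlocal (fun y => y `^ (s + 1)) _ _ _ x) => //.
  + move=> y /ltr_distlCBl; rewrite subrr => y0.
    by rewrite gtr0_norm// E.
  + apply: deq; first exact: is_derive1_powR.
    by rewrite gtr0_norm// addrK.
- rewrite normr0 powR0 ?gt_eqF// mulr0; apply: is_derive_eps => e e0.
  exists (e `^ s^-1); first by rewrite powR_gt0.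
  move=> h hd; rewrite add0r mulr0 subr0 mul0r subr0 normrM.
  rewrite ler_wpM2r// ger0_norm ?powR_ge0//.
  have -> : e = (e `^ s^-1) `^ s.
    by rewrite -powRrM mulVf ?gt_eqF// powRr1// ltW.
  by apply: ge0_ler_powR; rewrite ?nnegrE ?powR_ge0// ltW.
Qed.

Lemma continuous_abs_powR (s : R) : 0 < s -> continuous (fun y : R => `|y| `^ s).
Proof.
move=> s0 x; have [->|x0] := eqVneq x 0.
  apply/cvgrPdist_le => /= e e0; near=> y.
  rewrite normr0 powR0 ?gt_eqF// sub0r normrN ger0_norm ?powR_ge0//.
  have -> : e = (e `^ s^-1) `^ s.
    by rewrite -powRrM mulVf ?gt_eqF// powRr1// ltW.
  apply: ge0_ler_powR; rewrite ?nnegrE ?powR_ge0//; first exact: ltW.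
  near: y; exists (e `^ s^-1); first by rewrite /= powR_gt0.
  by move=> y /=; rewrite /ball_/= sub0r normrN => /ltW.
have x1 : 0 < `|x| by rewrite normr_gt0.
apply: (@continuous_comp _ _ _ (fun y : R => `|y|) (fun z => z `^ s)).
  exact: norm_continuous.
exact: dcont (is_derive1_powR s x1).
Unshelve. all: by end_near. Qed.

End derivative_rules.

Section substitution.
Variable R : realType.
Local Notation mu := (@lebesgue_measure R).
Implicit Types (phi rho : R -> R) (h : R -> R).

(** Lebesgue measure is the image under phi of the measure of density rho. *)
Definition subst_rule phi rho :=
  [/\ measurable_fun setT phi, measurable_fun setT rho,
      forall x, 0 <= rho x &
      forall a b : R,
        (\int[mu]_(x in phi @^-1` `]a, b]) (rho x)%:E)%E = mu `]a, b]].

Lemma subst_ge0 phi rho : subst_rule phi rho -> forall h : R -> \bar R,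
  measurable_fun setT h -> (forall x, 0 <= h x)%E ->
  (\int[mu]_x h x = \int[mu]_x (h (phi x) * (rho x)%:E))%E.
Proof. by case=> *; exact: ge0_change_of_variable. Qed.

Lemma subst_measurable phi rho : subst_rule phi rho -> forall h,
  measurable_fun setT h -> measurable_fun setT (fun x => h (phi x) * rho x).
Proof.
case=> mp mr _ _ h mh; apply: measurable_funM => //.
exact: measurableT_comp.
Qed.

Lemma subst_Rint phi rho : subst_rule phi rho -> forall h,
  measurable_fun setT h ->
  \int[mu]_x h x = \int[mu]_x (h (phi x) * rho x).
Proof.
move=> S h mh; have mh' := subst_measurable S mh; have [mp mr r0 _] := S.
have mE : measurable_fun setT (EFin \o h) by exact/measurable_EFinP.
rewrite /Rintegral integralE [in RHS]integralE; congr (fine (_ - _)).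
- rewrite (subst_ge0 S) //; last exact: measurable_funepos.
  apply: eq_integral => x _; rewrite !funeposE.
  by rewrite EFinM maxe_pMl ?lee_fin// mul0e.
- rewrite (subst_ge0 S) //; last exact: measurable_funeneg.
  apply: eq_integral => x _; rewrite !funenegE.
  by rewrite EFinM -mulNe maxe_pMl ?lee_fin// mul0e.
Qed.

Lemma subst_integrable phi rho : subst_rule phi rho -> forall h,
  measurable_fun setT h ->
  mu.-integrable setT (EFin \o h) <->
  mu.-integrable setT (EFin \o (fun x => h (phi x) * rho x)).
Proof.
move=> S h mh; have mh' := subst_measurable S mh; have [mp mr r0 _] := S.
have E : (\int[mu]_x `|(h x)%:E| = \int[mu]_x `|(h (phi x) * rho x)%:E|)%E.
  rewrite (subst_ge0 S) //.
    by apply: eq_integral => x _; rewrite /= normrM (ger0_norm (r0 x)).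
  by do 2 apply: measurableT_comp => //.
split=> /integrableP[_ K]; apply/integrableP; split.
- exact/measurable_EFinP.
- by rewrite -E.
- exact/measurable_EFinP.
- by rewrite [ltLHS]E.
Qed.

Let mu_oc (a b : R) : mu `]a, b] = (if a < b then b - a else 0)%:E.
Proof. by rewrite lebesgue_measure_itv/= lte_fin; case: ifP. Qed.

Let mu_co (a b : R) : mu `[a, b[ = (if a < b then b - a else 0)%:E.
Proof. by rewrite lebesgue_measure_itv/= lte_fin; case: ifP. Qed.

Lemma subst_shift (c : R) : subst_rule (fun x => x + c) (fun=> 1).
Proof.
split => //; first exact: measurable_funD.
move=> a b.
have -> : (fun x => x + c) @^-1` `]a, b] = `]a - c, b - c]%classic.
  by apply/seteqP; split => x /=; rewrite !in_itv/= ltrBlDr lerBrDr.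
rewrite integral_cst// mul1e.
rewrite [LHS]mu_oc [RHS]mu_oc ltrD2r; case: ifP => // _.
by congr EFin; ring.
Qed.

Lemma subst_scale (c : R) : c != 0 -> subst_rule (fun x => c * x) (fun=> `|c|).
Proof.
move=> c0; split => //; first exact: measurable_funM.
move=> a b; have [cn|cp|c00] := ltgtP c 0; last by rewrite c00 eqxx in c0.
  have -> : (fun x => c * x) @^-1` `]a, b] = `[b / c, a / c[%classic.
    apply/seteqP; split => x /=; rewrite !in_itv/= ler_ndivrMr// ltr_ndivlMr//.
      by rewrite (mulrC x) => /andP[-> ->].
    by rewrite (mulrC x) => /andP[-> ->].
  rewrite integral_cst//; transitivity (`|c|%:E * mu `[(b / c)%R, (a / c)%R[)%E => //.
  rewrite mu_co mu_oc ltr_nM2r ?invr_lt0// -EFinM; congr EFin.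
  case: ifP => _; last by rewrite mulr0.
  rewrite ltr0_norm//; field.
  by rewrite lt_eqF.
have -> : (fun x => c * x) @^-1` `]a, b] = `]a / c, b / c]%classic.
  apply/seteqP; split => x /=; rewrite !in_itv/= ler_pdivlMr// ltr_pdivrMr//;
  by rewrite (mulrC x).
rewrite integral_cst//; transitivity (`|c|%:E * mu `](a / c)%R, (b / c)%R])%E => //.
rewrite !mu_oc ltr_pM2r ?invr_gt0// -EFinM; congr EFin.
case: ifP => _; last by rewrite mulr0.
 rewrite gtr0_norm//; field.
by rewrite gt_eqF.
Qed.

Lemma mulr_norm_inj_le (x y : R) : (`|x| * x <= `|y| * y) = (x <= y).
Proof.
have K (u v : R) : u < v -> `|u| * u < `|v| * v.
  move=> uv; have [v0|v0] := leP v 0.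
    rewrite (ltr0_norm (lt_le_trans uv v0)) (ler0_norm v0); nra.
  rewrite (gtr0_norm v0); have [u0|u0] := leP u 0.
    by rewrite ler0_norm//; nra.
  by rewrite gtr0_norm//; nra.
have [xy|xy] := leP x y.
  by move: xy; rewrite le_eqVlt => /predU1P[->|/K/ltW->//]; rewrite lexx.
by apply/negbTE; rewrite -ltNge; exact: K.
Qed.

Lemma mulr_norm_surj (a : R) : exists x, `|x| * x = a.
Proof.
exists (Num.sg a * Num.sqrt `|a|).
rewrite normrM (ger0_norm (sqrtr_ge0 _)) mulrACA -expr2 sqr_sqrtr//.
have [->|a0] := eqVneq a 0; first by rewrite normr0 mulr0.
by rewrite normr_sg a0 mul1r -numEsg.
Qed.

(** The map x |x| is a substitute for x^2 that is a bijection of the line, so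
    the general substitution applies to it without splitting the domain. *)
Lemma subst_square : subst_rule (fun x => `|x| * x) (fun x => 2 * `|x|).
Proof.
have mn : measurable_fun setT (fun x : R => `|x|) by exact: normr_measurable.
split => //.
- exact: measurable_funM.
- exact: measurable_funM.
move=> a b; have [u <-] := mulr_norm_surj a; have [v <-] := mulr_norm_surj b.
have -> : (fun x => `|x| * x) @^-1` `]`|u| * u, `|v| * v] = `]u, v]%classic.
  by apply/seteqP; split => x /=; rewrite !in_itv/= !ltNge !mulr_norm_inj_le.
rewrite mu_oc ltNge mulr_norm_inj_le -ltNge.
case: ifP => uv; last by rewrite set_itv_ge ?integral_set0// bnd_simp uv.
rewrite integral_itv_obnd_cbnd; last first.
  by apply/measurable_EFinP/measurable_funTS; exact: measurable_funM.
have D (x : R) : is_derive x 1 (fun y => `|y| * y) (2 * `|x|).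
  have := is_derive_abs_powRx x (@ltr01 R).
  rewrite powRr1//.
  by under [X in is_derive _ _ X _]funext do rewrite powRr1//.
have cF := dcontT D.
rewrite (@continuous_FTC2 _ _ (fun x => `|x| * x))//.
- apply: continuous_subspaceT => x; apply: cvgM; first exact: cvg_cst.
  exact: norm_continuous.
- split.
  + by move=> x _; case: (D x).
  + by apply: cvg_at_right_filter; exact: cF.
  + by apply: cvg_at_left_filter; exact: cF.
- by move=> x _; rewrite derive1E; case: (D x).
Qed.

End substitution.

(** * Integrals over the line *)

Section integration.
Variable R : realType.
Local Notation mu := (@lebesgue_measure R).
Implicit Types (f g h : R -> R).
Local Notation integ f := (mu.-integrable setT (EFin \o f)).

Lemma integ_measurable f : integ f -> measurable_fun setT f.
Proof. by move=> /(measurable_int mu) /measurable_EFinP. Qed.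

Lemma integ_le f g : measurable_fun setT f -> integ g ->
  (forall x, `|f x| <= g x) -> integ f.
Proof.
move=> mf ig fg; apply: le_integrable ig => //; first exact/measurable_EFinP.
by move=> x _ /=; rewrite lee_fin (le_trans (fg x))// ler_norm.
Qed.

Lemma integD f g : integ f -> integ g -> integ (fun x => f x + g x).
Proof.
move=> hf hg; rewrite (_ : EFin \o _ = (EFin \o f) \+ (EFin \o g))%E//.
exact: integrableD.
Qed.

Lemma integZ (c : R) f : integ f -> integ (fun x => c * f x).
Proof.
move=> hf; rewrite (_ : EFin \o _ = (fun x => c%:E * (EFin \o f) x))%E//.
exact: integrableZl.
Qed.

Lemma integB f g : integ f -> integ g -> integ (fun x => f x - g x).
Proof.
move=> hf hg; rewrite (_ : EFin \o _ = (EFin \o f) \- (EFin \o g))%E//.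
exact: integrableB.
Qed.

Lemma eq_integ f g : (forall x, f x = g x) -> integ f -> integ g.
Proof. by move=> /funext ->. Qed.

Lemma RintD f g : integ f -> integ g ->
  \int[mu]_x (f x + g x) = \int[mu]_x f x + \int[mu]_x g x.
Proof. by move=> hf hg; rewrite RintegralD. Qed.

Lemma RintB f g : integ f -> integ g ->
  \int[mu]_x (f x - g x) = \int[mu]_x f x - \int[mu]_x g x.
Proof. by move=> hf hg; rewrite RintegralB. Qed.

Lemma RintZ (c : R) f : integ f ->
  \int[mu]_x (c * f x) = c * \int[mu]_x f x.
Proof. by move=> hf; rewrite RintegralZl. Qed.

Lemma eq_Rint f g : (forall x, f x = g x) -> \int[mu]_x f x = \int[mu]_x g x.
Proof. by move=> /funext ->. Qed.

Lemma Rint_fin f : integ f -> (\int[mu]_x f x)%:E = (\int[mu]_x (f x)%:E)%E.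
Proof. by move=> hf; rewrite /Rintegral fineK//; exact: integrable_fin_num. Qed.

Lemma Rint_le f g : integ f -> integ g -> (forall x, f x <= g x) ->
  \int[mu]_x f x <= \int[mu]_x g x.
Proof. by move=> hf hg fg; exact: le_Rintegral. Qed.

Lemma norm_Rint_le f g : integ f -> integ g -> (forall x, `|f x| <= g x) ->
  `|\int[mu]_x f x| <= \int[mu]_x g x.
Proof.
move=> hf hg fg; apply: (le_trans (le_normr_Rintegral _ _)) => //.
by apply: le_Rintegral => //; exact: integrable_norm.
Qed.

Lemma Rint_odd f : measurable_fun setT f -> (forall x, f (- x) = - f x) ->
  integ f -> \int[mu]_x f x = 0.
Proof.
move=> mf of_ hf.
have n0 : (-1 : R) != 0 by rewrite oppr_eq0 oner_eq0.
have := subst_Rint (subst_scale n0) mf.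
under [X in _ = X -> _]eq_Rint do
  rewrite normrN normr1 mulr1 mulN1r of_ -mulN1r.
by rewrite RintZ// => h; lra.
Qed.

Lemma integ_inv_oneDsqr : integ (fun x => (1 + x ^+ 2)^-1).
Proof.
have p (x : R) : 0 < 1 + x ^+ 2 by rewrite ltr_pwDl// sqr_ge0.
have c : continuous (fun x : R => (1 + x ^+ 2)^-1).
  move=> x; apply: cvgV; first by rewrite gt_eqF.
  by apply: cvgD; [exact: cvg_cst|exact: exprn_continuous].
apply/integrableP; split.
  by apply/measurable_EFinP; exact: (continuous_measurable_fun c).
under eq_integral do rewrite /= ger0_norm ?invr_ge0 ?ltW//.
rewrite ge0_symfun_integralT//; last 2 first.
- by move=> x; rewrite invr_ge0 ltW.
- by move=> x /=; rewrite sqrrN.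
rewrite (_ : [set x | _] = `[0, +oo[%classic); last first.
  by apply/seteqP; split => x /=; rewrite in_itv/= andbT.
by rewrite integral0y_oneDsqr -EFinM ltry.
Qed.

Lemma Rint_dominated (f_ : nat -> R -> R) f g :
  (forall n, measurable_fun setT (f_ n)) -> measurable_fun setT f ->
  (forall x, f_ n x @[n --> \oo] --> f x) -> integ g ->
  (forall n x, `|f_ n x| <= g x) ->
  \int[mu]_x f_ n x @[n --> \oo] --> \int[mu]_x f x.
Proof.
move=> mf_ mf fc ig fg.
have H1 n : measurable_fun setT (EFin \o f_ n) by exact/measurable_EFinP.
have H2 : measurable_fun setT (EFin \o f) by exact/measurable_EFinP.
have H3 n : integ (f_ n) by exact: integ_le ig _.
have H4 : {ae mu, forall x, [set: R] x -> (EFin \o f_ n) x @[n --> \oo] --> (EFin \o f) x}.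
  by apply: aeW => x _; apply/fine_cvgP; split; [exact: nearW|exact: fc].
have H5 : {ae mu, forall x n, [set: R] x -> (`|(EFin \o f_ n) x| <= (EFin \o g) x)%E}.
  by apply: aeW => x n _; rewrite /= lee_fin.
have [hf _ K] := @dominated_convergence _ _ _ mu setT measurableT
  (fun n => EFin \o f_ n) (EFin \o f) (EFin \o g) H1 H2 H4 ig H5.
have {}K : (\int[mu]_x f_ n x)%:E @[n --> \oo] --> (\int[mu]_x f x)%:E.
  rewrite Rint_fin// (_ : (fun n => _) = (fun n => \int[mu]_x (EFin \o f_ n) x)%E)//.
  by apply/funext => n; rewrite Rint_fin.
by move/fine_cvgP : K => [].
Qed.

(** Integration by parts on the whole line at once: since |x|^s x is differentiable
    at 0, the weights |x|^s call for no boundary term there. *)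
Lemma Rint_derive_eq0 (F f : R -> R) (C : R) :
  (forall x : R, is_derive x 1 F (f x)) -> continuous f -> integ f ->
  (forall x, (1 + `|x|) * `|F x| <= C) -> \int[mu]_x f x = 0.
Proof.
move=> dF cf hf hC; have cF := dcontT dF.
have mf := integ_measurable hf.
pose D (n : nat) : set R := `[- n.+1%:R, n.+1%:R]%classic.
have mD n : measurable (D n) by exact: measurable_itv.
have E n : \int[mu]_x (f \_ (D n)) x = F n.+1%:R - F (- n.+1%:R).
  rewrite -Rintegral_mkcond /Rintegral (@continuous_FTC2 _ f F)//.
  - by rewrite gtrN.
  - exact: continuous_subspaceT.
  - split.
    + by move=> x _; case: (dF x).
    + by apply: cvg_at_right_filter; exact: cF.
    + by apply: cvg_at_left_filter; exact: cF.
  - by move=> x _; rewrite derive1E; case: (dF x).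
have K : F n.+1%:R - F (- n.+1%:R) @[n --> \oo] --> \int[mu]_x f x.
  under eq_fun do rewrite -E.
  apply: (@Rint_dominated _ _ (fun x => `|f x|)) => //.
  - move=> n; apply: (measurable_restrictT f (mD n)).1.
    exact: measurable_funTS.
  - move=> x; apply: cvg_near_cst; exists (Num.truncn `|x|) => //= n /= nx.
    rewrite patchE mem_set//= /D/= in_itv/= -ler_norml.
    by rewrite ltW// (lt_le_trans (truncnS_gt _))// ler_nat.
  - exact: integrable_norm.
  - by move=> n x; rewrite patchE; case: ifP => _ //; rewrite normr0.
have K0 : F n.+1%:R - F (- n.+1%:R) @[n --> \oo] --> (0 : R).
  apply: (@squeeze_cvgr _ _ _ _ (fun n => - (2 * C * n.+1%:R^-1))
    (fun n => 2 * C * n.+1%:R^-1)).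
  - near=> n; rewrite -ler_norml.
    have h (x : R) : `|x| = n.+1%:R -> `|F x| <= C * n.+1%:R^-1.
      move=> xn; rewrite ler_pdivlMr// mulrC; apply: le_trans (hC x).
      by rewrite ler_wpM2r// xn lerDr.
    apply: (le_trans (ler_normB _ _)); rewrite -mulrA mulr_natl mulr2n lerD// h//.
      by rewrite ger0_norm.
    by rewrite normrN ger0_norm.
  - rewrite -[X in _ --> X]oppr0; apply: cvgN; rewrite -[X in _ --> X](mulr0 (2 * C)).
    by apply: cvgMr; exact: cvg_harmonic.
  - rewrite -[X in _ --> X](mulr0 (2 * C)).
    by apply: cvgMr; exact: cvg_harmonic.
exact: (cvg_unique _ K K0).
Unshelve. all: by end_near. Qed.

End integration.

Section fubini.
Variable R : realType.
Local Notation mu := (@lebesgue_measure R).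
Local Notation integ f := (mu.-integrable setT (EFin \o f)).

Lemma Rint_tonelli (f : R -> R -> R) :
  measurable_fun setT (fun z : R * R => f z.1 z.2) ->
  (forall x y, 0 <= f x y) ->
  (\int[mu]_x \int[mu]_y (f x y)%:E = \int[mu]_y \int[mu]_x (f x y)%:E)%E.
Proof.
move=> mf f0.
apply: (@fubini_tonelli _ _ _ _ R mu mu (fun z => (f z.1 z.2)%:E)).
  exact/measurable_EFinP.
by move=> z; rewrite lee_fin.
Qed.

(** The bound by an integrable function of x alone replaces the integrability of
    f on the plane. *)
Lemma Rint_fubini (f : R -> R -> R) (g : R -> R) :
  measurable_fun setT (fun z : R * R => f z.1 z.2) ->
  (forall x, integ (f x)) -> (forall y, integ (fun x => f x y)) ->
  (forall x, \int[mu]_y `|f x y| <= g x) -> integ g ->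
  integ (fun x => \int[mu]_y f x y) /\
  \int[mu]_x \int[mu]_y f x y = \int[mu]_y \int[mu]_x f x y.
Proof.
move=> mf i1 i2 fg ig.
have mF : measurable_fun setT (fun z : R * R => (f z.1 z.2)%:E).
  exact/measurable_EFinP.
have I : (mu \x mu)%E.-integrable setT (fun z : R * R => (f z.1 z.2)%:E).
  apply/integrable12ltyP => //=.
  apply: (@le_lt_trans _ _ (\int[mu]_x (g x)%:E)%E); last first.
    by rewrite -Rint_fin// ltry.
  under eq_integral do rewrite -Rint_fin ?integrable_norm//.
  apply: ge0_le_integral => //.
  - by move=> x _; rewrite lee_fin Rintegral_ge0.
  - have mA : measurable_fun setT (fun z : R * R => (`|f z.1 z.2|)%:E).
      by apply/measurable_EFinP; exact: measurableT_comp.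
    have h := @measurable_fun_fubini_tonelli_F _ _ _ _ _ mu _ mA
      (fun z => normr_ge0 _).
    apply: eq_measurable_fun h => x _.
    by rewrite /fubini_F/= -Rint_fin ?integrable_norm.
  - by apply/measurable_EFinP; exact: integ_measurable.
  - by move=> x _; rewrite lee_fin.
have E1 x : (\int[mu]_y (f x y)%:E = (\int[mu]_y f x y)%:E)%E.
  by rewrite Rint_fin.
have E2 y : (\int[mu]_x (f x y)%:E = (\int[mu]_x f x y)%:E)%E.
  by rewrite Rint_fin.
split.
- apply: eq_integrable (integrable_fubini_F I) => // x _.
  by rewrite /fubini_F E1.
- rewrite /Rintegral; congr fine.
  have := Fubini I => /=.
  under eq_integral do rewrite E1.
  by under [in X in _ = X -> _]eq_integral do rewrite E2.
Qed.

End fubini.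

(** * One-sided powers and the Gamma and Beta integrals *)

Section truncated_power.
Variable R : realType.
Local Notation mu := (@lebesgue_measure R).
Local Notation integ f := (mu.-integrable setT (EFin \o f)).
Implicit Types s u r x t : R.

(** The kernels below are singular powers of quantities that change sign; the
    value 0 off the positive half-line carries the domain of integration. *)
Definition tpow s u : R := if 0 < u then u `^ s else 0.

Lemma tpow_ge0 s u : 0 <= tpow s u.
Proof. by rewrite /tpow; case: ifP => // _; exact: powR_ge0. Qed.

Lemma tpowE s u : 0 < u -> tpow s u = u `^ s.
Proof. by rewrite /tpow => ->. Qed.

Lemma tpow_npos s u : u <= 0 -> tpow s u = 0.
Proof. by rewrite /tpow ltNge => ->. Qed.

Lemma tpowM s r u : 0 < r -> tpow s (r * u) = r `^ s * tpow s u.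
Proof.
move=> r0; rewrite /tpow pmulr_rgt0//; case: ifP => u0; last by rewrite mulr0.
by rewrite powRM// ltW.
Qed.

Lemma tpow_sqr s y : 0 < 2 * s + 1 ->
  tpow s (y ^+ 2) * `|y| = `|y| `^ (2 * s + 1).
Proof.
move=> s0; have [->|y0] := eqVneq y 0.
  by rewrite normr0 powR0 ?mulr0// gt_eqF.
have y1 : 0 < `|y| by rewrite normr_gt0.
rewrite tpowE; last by rewrite exprn_even_gt0.
rewrite -real_normK ?num_real// -powR_mulrn// -powRrM powRD ?powRr1//.
by rewrite (gt_eqF y1) implybT.
Qed.

Lemma measurable_tpow s : measurable_fun setT (tpow s).
Proof.
apply: measurable_fun_ifT => //.
by apply: measurable_fun_ltr => //; exact: measurable_id.
Qed.

(** Integrability of t^s on ]0, 1] for every s > -1: the substitution t = y^2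
    replaces s + 1 by 2 (s + 1), and the integrand is bounded once s >= 0. *)
Lemma integ_tpow01 s : -1 < s -> integ (fun t => tpow s t * tpow 0 (1 - t)).
Proof.
have mh s' : measurable_fun setT (fun t : R => tpow s' t * tpow 0 (1 - t)).
  apply: measurable_funM; first exact: measurable_tpow.
  by apply: (measurableT_comp (measurable_tpow 0)); exact: measurable_funB.
have step s' : integ (fun t => tpow (2 * s' + 1) t * tpow 0 (1 - t)) ->
    integ (fun t => tpow s' t * tpow 0 (1 - t)).
  move=> ih; apply/(subst_integrable (subst_square R)) => //.
  apply: eq_integ (integZ 2 ih) => t.
  have [t0|t0] := leP t 0.
    rewrite (tpow_npos _ t0) (@tpow_npos _ (`|t| * t)) ?mul0r ?mulr0//.
    by rewrite mulr_ge0_le0.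
  rewrite (gtr0_norm t0) -expr2 (tpowE _ t0) (tpowE s' (exprn_gt0 2 t0)).
  have -> : tpow 0 (1 - t ^+ 2) = tpow 0 (1 - t).
    by rewrite /tpow !powRr0 !subr_gt0 expr_lt1// ltW.
  rewrite -(@powR_mulrn _ t 2) ?ltW// -powRrM.
  rewrite powRD; last by rewrite (gt_eqF t0) implybT.
  by rewrite powRr1 ?ltW//; ring.
move=> s1.
(* Each substitution doubles s + 1, so finitely many of them reach s >= 0. *)
have [n hn] : exists n : nat, 1 <= 2 ^+ n * (s + 1).
  have p : 0 < s + 1 by rewrite -ltrBlDr sub0r.
  exists (Num.truncn (s + 1)^-1).+1.
  rewrite -ler_pdivrMr// mul1r ltW// (lt_le_trans (truncnS_gt _))//.
  by rewrite -natrX ler_nat ltnW// ltn_expl.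
elim: n s s1 hn => [|n ih] s s1 hn.
  rewrite expr0 mul1r in hn; have s0 : 0 <= s by lra.
  apply: (@integ_le _ _ (fun t => 2 * (1 + t ^+ 2)^-1)) => //.
    by apply: integZ; exact: integ_inv_oneDsqr.
  move=> t; have p : 0 < 1 + t ^+ 2 by rewrite ltr_pwDl// sqr_ge0.
  rewrite ger0_norm ?mulr_ge0 ?tpow_ge0//.
  have [t0|t0] := leP t 0.
    by rewrite tpow_npos// mul0r mulr_ge0// invr_ge0 ltW.
  have [t1|t1] := leP 1 t.
    by rewrite (@tpow_npos 0) ?subr_le0// mulr0 mulr_ge0// invr_ge0 ltW.
  rewrite !tpowE ?subr_gt0// powRr0 mulr1 ler_pdivlMr//.
  have h1 : t `^ s <= 1.
    have <- : 1 `^ s = 1 by rewrite powR1.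
    by apply: ge0_ler_powR; rewrite ?nnegrE// ltW.
  have h2 : t ^+ 2 <= 1 by rewrite expr_le1// ltW.
  have h3 : 0 <= t `^ s by exact: powR_ge0.
  by nra.
by apply: step; apply: ih; [lra|rewrite exprS in hn; nra].
Qed.

(** The two half-lines contribute equally to the right-hand side; a function of
    the line vanishing off the positive half-line is therefore integrated by the
    substitution v = y^2 over the whole line, the form in which the weights
    |y|^(2g+1) occur. *)
Lemma integ_square (h : R -> R) : measurable_fun setT h -> integ h ->
  (forall v, v <= 0 -> h v = 0) ->
  integ (fun y => h (y ^+ 2) * `|y|) /\
  \int[mu]_v h v = \int[mu]_y (h (y ^+ 2) * `|y|).
Proof.
move=> mh ih h0; have S := subst_square R.
have i1 := (subst_integrable S mh).1 ih.
have e1 := subst_Rint S mh.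
have n0 : (-1 : R) != 0 by rewrite oppr_eq0 oner_eq0.
have m1 := subst_measurable S mh.
have i2 := (subst_integrable (subst_scale n0) m1).1 i1.
have e2 := subst_Rint (subst_scale n0) m1.
have E y : 2^-1 * (h (`|y| * y) * (2 * `|y|) +
    h (`|-1 * y| * (-1 * y)) * (2 * `|-1 * y|) * `|-1|) = h (y ^+ 2) * `|y|.
  rewrite mulN1r !normrN normr1 mulr1.
  have [y0|y0] := leP y 0.
    rewrite (ler0_norm y0) (h0 (- y * y)); last by nra.
    by rewrite mulrNN -expr2 mul0r add0r; field.
  rewrite (gtr0_norm y0) (h0 (y * - y)); last by nra.
  by rewrite -expr2 mul0r addr0; field.
split; first by apply: (eq_integ E); apply: integZ; exact: integD.
rewrite -(eq_Rint E) RintZ; last exact: integD.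
by rewrite RintD// -e2 -e1; field.
Qed.

End truncated_power.

Section gamma_beta.
Variable R : realType.
Local Notation mu := (@lebesgue_measure R).
Local Notation integ f := (mu.-integrable setT (EFin \o f)).
Implicit Types p q s u r x t : R.

Let gam x t := tpow (x - 1) t * expR (- t).

Let measurable_gam x : measurable_fun setT (gam x).
Proof.
apply: measurable_funM; first exact: measurable_tpow.
by apply: (measurableT_comp (@measurable_expR R)); exact: measurable_funN.
Qed.

Let gam_ge0 x t : 0 <= gam x t.
Proof. by rewrite mulr_ge0 ?tpow_ge0 ?expR_ge0. Qed.

Lemma ge0_intZ (c : R) (f : R -> R) : 0 <= c -> measurable_fun setT f ->
  (forall x, 0 <= f x) ->
  (\int[mu]_x (c * f x)%:E = c%:E * \int[mu]_x (f x)%:E)%E.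
Proof.
move=> c0 mf f0; under eq_integral do rewrite EFinM.
apply: ge0_integralZl_EFin => //; first by move=> x _; rewrite lee_fin.
exact/measurable_EFinP.
Qed.

Lemma Gamma_tpow x : Gamma x = \int[mu]_t (tpow (x - 1) t * expR (- t)).
Proof.
rewrite /Gamma Rintegral_mkcond; apply: eq_Rint => t.
rewrite patchE; case: ifPn => t0.
  by move: t0; rewrite inE/= in_itv/= andbT => t0; rewrite tpowE.
rewrite tpow_npos ?mul0r// leNgt; apply: contra t0 => t0.
by rewrite inE/= in_itv/= andbT.
Qed.

(** From the n-th term of the exponential series. *)
Lemma expRN_le n t : 0 <= t -> t ^+ n * expR (- t) <= n`!%:R.
Proof.
move=> t0; rewrite expRN ler_pdivrMr ?expR_gt0//.
case: n => [|n]; first by rewrite expr0 mul1r; have := expR_ge1Dx t; lra.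
have := expR_ge1Dxn n t0; rewrite -ler_pdivrMl ?ltr0n ?fact_gt0//.
by rewrite mulrC; apply: le_trans; rewrite lerDr.
Qed.

Lemma integ_gamma x : 0 < x -> integ (fun t => tpow (x - 1) t * expR (- t)).
Proof.
move=> x0.
pose n := (Num.truncn x).+1.
have xn : x - 1 <= n%:R by rewrite /n; have := truncnS_gt x; lra.
(* C bounds t^n (1 + t^2) e^(-t), the majorant on t >= 1. *)
pose C : R := n`!%:R + (n.+2)`!%:R.
apply: (@integ_le _ _ (fun t => tpow (x - 1) t * tpow 0 (1 - t) +
    C * (1 + t ^+ 2)^-1)).
- exact: measurable_gam.
- apply: integD; first by apply: integ_tpow01; lra.
  by apply: integZ; exact: integ_inv_oneDsqr.
move=> t; rewrite ger0_norm ?gam_ge0//.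
have P : 0 < 1 + t ^+ 2 by rewrite ltr_pwDl// sqr_ge0.
have C0 : 0 <= C * (1 + t ^+ 2)^-1.
  by rewrite mulr_ge0 ?invr_ge0 1?ltW// addr_gt0// ltr0n fact_gt0.
have [t0|t0] := leP t 0; first by rewrite (tpow_npos _ t0) !mul0r add0r.
have T0 := tpow_ge0 (x - 1) t.
have [t1|t1] := ltP t 1.
  rewrite (@tpowE _ 0) ?subr_gt0// powRr0 mulr1.
  have e1 : expR (- t) <= 1 by rewrite expR_le1 oppr_le0 ltW.
  by nra.
rewrite (@tpow_npos _ 0) ?subr_le0// mulr0 add0r tpowE// ler_pdivlMr//.
apply: (@le_trans _ _ (t ^+ n * expR (- t) * (1 + t ^+ 2))).
  apply: ler_wpM2r; first exact: ltW.
  apply: ler_wpM2r; first exact: expR_ge0.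
  rewrite -powR_mulrn; last exact: ltW.
  exact: ler_powR.
have t0' := ltW t0.
rewrite mulrDr mulr1 lerD ?expRN_le//.
by rewrite mulrAC -exprD addn2 expRN_le.
Qed.

(** Any explicit positive minorant on [1, 2] does; there ln t stays in [0, 2]. *)
Lemma Gamma_gt0 x : 0 < x -> 0 < Gamma x.
Proof.
move=> x0; rewrite Gamma_tpow.
pose c := expR (- (2 * `|x - 1| + 2)).
have c0 : 0 < c by exact: expR_gt0.
have m12 : integ (fun t : R => c * \1_(`[1, 2]) t).
  by apply: integZ; apply: integrable_indic_itv.
apply: (@lt_le_trans _ _ (\int[mu]_t (c * \1_(`[1, 2]) t))).
  rewrite RintZ; last exact: integrable_indic_itv.
  rewrite mulr_gt0// /Rintegral integral_indic// setIT.
  have E : mu `[1, 2] = 1%:E.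
    by rewrite lebesgue_measure_itv/= lte_fin ltr1n -EFinB; congr EFin; lra.
  by rewrite [ltRHS](congr1 fine E).
apply: Rint_le => //; first exact: integ_gamma.
move=> t; rewrite indicE; case: (boolP (t \in _)) => [|_]; last first.
  by rewrite mulr0 gam_ge0.
rewrite inE/= in_itv/= => /andP[t1 t2]; have t0 : 0 < t by lra.
rewrite mulr1 tpowE// /powR (gt_eqF t0) -expRD ler_expR.
have l0 : 0 <= ln t by exact: ln_ge0.
have l1 : ln t < t by exact: ln_sublinear.
have a1 := ler_norm (- (x - 1)); have a2 := normr_ge0 (x - 1).
rewrite normrN in a1.
by nra.
Qed.

Lemma Gamma_neq0 x : 0 < x -> Gamma x != 0.
Proof. by move=> x0; rewrite gt_eqF// Gamma_gt0. Qed.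

(** The total mass of the Gaussian for the weight |x|^(2g+1). *)
Definition gauss_mass (g : R) : R := 2 `^ (g + 1) * Gamma (g + 1).

Lemma gauss_mass_gt0 g : - (1 / 2) < g -> 0 < gauss_mass g.
Proof.
by move=> g0; rewrite mulr_gt0 ?powR_gt0// Gamma_gt0//; lra.
Qed.

Lemma integ_gauss g : - (1 / 2) < g ->
  integ (fun x => expR (- (x ^+ 2 / 2)) * `|x| `^ (2 * g + 1)) /\
  \int[mu]_x (expR (- (x ^+ 2 / 2)) * `|x| `^ (2 * g + 1)) = gauss_mass g.
Proof.
move=> g0; have g1 : 0 < g + 1 by lra.
have i0 := integ_gamma g1; have m0 := measurable_gam (g + 1).
pose h v := tpow g v * expR (- (v / 2)).
have n0 : (2^-1 : R) != 0 by rewrite invr_eq0.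
have S := subst_scale n0.
have E v : tpow (g + 1 - 1) (2^-1 * v) * expR (- (2^-1 * v)) * `|2^-1| =
    2 `^ (- (g + 1)) * h v.
  rewrite tpowM ?invr_gt0// addrK /h ger0_norm// (mulrC v).
  have -> : 2^-1 `^ g * tpow g v * expR (- (2^-1 * v)) / 2 =
    (2^-1 `^ g * 2^-1) * (tpow g v * expR (- (2^-1 * v))) :> R by ring.
  congr (_ * _); rewrite -[in X in _ `^ g * X](@powRr1 _ 2^-1)//.
  rewrite -powRD; last by rewrite invr_eq0 pnatr_eq0 implybT.
  by rewrite -powR_inv1// -powRrM mulN1r.
have K : 2 `^ (g + 1) * 2 `^ (- (g + 1)) = 1 :> R.
  by rewrite powRN mulfV// powR_eq0 pnatr_eq0.
have ih : integ h.
  have := integZ (2 `^ (g + 1)) (eq_integ E ((subst_integrable S m0).1 i0)).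
  by apply: eq_integ => v; rewrite mulrA K mul1r.
have eh : \int[mu]_v h v = gauss_mass g.
  rewrite /gauss_mass Gamma_tpow (subst_Rint S m0) (eq_Rint E) RintZ//.
  by rewrite mulrA K mul1r.
have mh := integ_measurable ih.
have h0 v : v <= 0 -> h v = 0 by move=> v0; rewrite /h tpow_npos// mul0r.
have [i2 e2] := integ_square mh ih h0.
have E2 y : h (y ^+ 2) * `|y| = expR (- (y ^+ 2 / 2)) * `|y| `^ (2 * g + 1).
  by rewrite /h mulrAC tpow_sqr 1?mulrC//; lra.
split; first exact: eq_integ E2 i2.
by rewrite -(eq_Rint E2) -e2.
Qed.

Definition beta_weight p q s : R := tpow (p - 1) s * tpow (q - 1) (1 - s).

Lemma measurable_beta_weight p q : measurable_fun setT (beta_weight p q).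
Proof.
apply: measurable_funM; first exact: measurable_tpow.
apply: (measurableT_comp (measurable_tpow (q - 1))).
exact: measurable_funB.
Qed.

Lemma beta_weight_ge0 p q s : 0 <= beta_weight p q s.
Proof. by rewrite mulr_ge0 ?tpow_ge0. Qed.

(** Euler's identity, by writing the product of the two Gamma integrals as a
    double integral over s and r = s + t and rescaling s by r. *)
Lemma integ_beta p q : 0 < p -> 0 < q ->
  integ (beta_weight p q) /\
  Gamma p * Gamma q = Gamma (p + q) * \int[mu]_s beta_weight p q s.
Proof.
move=> p0 q0; have pq0 : 0 < p + q by rewrite addr_gt0.
have G x : 0 < x -> (\int[mu]_t (gam x t)%:E = (Gamma x)%:E)%E.
  by move=> x0; rewrite Gamma_tpow Rint_fin//; exact: integ_gamma.
pose f s r := tpow (p - 1) s * tpow (q - 1) (r - s) * expR (- r).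
have f0 s r : 0 <= f s r by rewrite !mulr_ge0 ?tpow_ge0 ?expR_ge0.
have mf : measurable_fun setT (fun z : R * R => f z.1 z.2).
  apply: measurable_funM; first apply: measurable_funM.
  - exact: (measurableT_comp (measurable_tpow (p - 1))).
  - by apply: (measurableT_comp (measurable_tpow (q - 1))); exact: measurable_funB.
  - by apply: (measurableT_comp (@measurable_expR R)); exact: measurable_funN.
have L : (\int[mu]_s \int[mu]_r (f s r)%:E = (Gamma p * Gamma q)%:E)%E.
  transitivity (\int[mu]_s (Gamma q * gam p s)%:E)%E; last first.
    by rewrite ge0_intZ ?ltW ?Gamma_gt0// G// -EFinM mulrC.
  apply: eq_integral => s _.
  have mfs : measurable_fun setT (fun r => (f s r)%:E).
    apply/measurable_EFinP; apply: measurable_funM.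
      apply: measurable_funM => //.
      apply: (measurableT_comp (measurable_tpow (q - 1))).
      exact: measurable_funB.
    by apply: (measurableT_comp (@measurable_expR R)); exact: measurable_funN.
  rewrite (subst_ge0 (subst_shift s) mfs); last by move=> r; rewrite lee_fin.
  rewrite mulrC EFinM -(G q q0) -ge0_intZ//.
  apply: eq_integral => r _; rewrite mule1; congr EFin.
  rewrite /f /gam addrK (_ : - (r + s) = - s + - r); last by ring.
  by rewrite expRD; ring.
have B : (\int[mu]_r \int[mu]_s (f s r)%:E =
    (Gamma (p + q))%:E * \int[mu]_s (beta_weight p q s)%:E)%E.
  rewrite -(G _ pq0) muleC -ge0_integralZl//; last 3 first.
  - by apply/measurable_EFinP; exact: measurable_gam.
  - by move=> x _; rewrite lee_fin gam_ge0.
  - by apply: integral_ge0 => s _; rewrite lee_fin beta_weight_ge0.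
  apply: eq_integral => r _.
  have [r0|r0] := leP r 0.
    rewrite /gam tpow_npos// mul0r mule0 integral0_eq// => s _.
    rewrite /f; have [s0|s0] := leP s 0; first by rewrite tpow_npos// !mul0r.
    by rewrite (@tpow_npos _ _ (r - s)) ?mulr0 ?mul0r//; lra.
  have rn0 : r != 0 by rewrite gt_eqF.
  have mfr : measurable_fun setT (fun s => (f s r)%:E).
    apply/measurable_EFinP; apply: measurable_funM => //.
    apply: measurable_funM; first exact: measurable_tpow.
    apply: (measurableT_comp (measurable_tpow (q - 1))).
    exact: measurable_funB.
  rewrite (subst_ge0 (subst_scale rn0) mfr); last by move=> s; rewrite lee_fin.
  rewrite muleC -ge0_intZ//; last 2 first.
  - exact: measurable_beta_weight.
  - by move=> s; exact: beta_weight_ge0.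
  apply: eq_integral => s _; rewrite -!EFinM; congr EFin.
  rewrite /f /gam /beta_weight (gtr0_norm r0) tpowM//.
  have -> : r - r * s = r * (1 - s) by ring.
  rewrite tpowM// (tpowE _ r0).
  have -> : p + q - 1 = (p - 1) + (q - 1) + 1 by ring.
  rewrite !powRD ?rn0 ?implybT// powRr1 ?ltW//.
  by ring.
have T := Rint_tonelli mf f0.
rewrite L B in T.
have GG : 0 < Gamma (p + q) by exact: Gamma_gt0.
have I0 : (0 <= \int[mu]_s (beta_weight p q s)%:E)%E.
  by apply: integral_ge0 => s _; rewrite lee_fin beta_weight_ge0.
have Ify : (\int[mu]_s (beta_weight p q s)%:E < +oo)%E.
  rewrite ltey; apply/eqP => Iy; move: T; rewrite Iy gt0_muley ?lte_fin//.
have ib : integ (beta_weight p q).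
  apply/integrableP; split.
    by apply/measurable_EFinP; exact: measurable_beta_weight.
  under eq_integral do rewrite /= ger0_norm ?beta_weight_ge0//.
  exact: Ify.
split => //.
by move: T; rewrite -Rint_fin// -EFinM => -[].
Qed.

End gamma_beta.

(** * Growth classes *)

Section under_integral.
Variable R : realType.
Local Notation mu := (@lebesgue_measure R).
Local Notation integ f := (mu.-integrable setT (EFin \o f)).

(** Differentiation under the integral sign, with a bound near the point only. *)
Lemma is_derive_Rint (f f' : R -> R -> R) (a : R) (G : R -> R) :
  (forall x, integ (f x)) ->
  (forall x y : R, is_derive x 1 (fun z => f z y) (f' x y)) ->
  integ G ->
  (forall x y, `|x - a| < 1 -> `|f' x y| <= G y) ->
  is_derive a 1 (fun x => \int[mu]_y f x y) (\int[mu]_y f' a y).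
Proof.
move=> fi fd Gi fG.
have Ia : `]a - 1, a + 1[%classic a by rewrite /= in_itv/= ltrBlDr ltrDl ltr01 andbT.
have G0 y : 0 <= G y by rewrite (le_trans (normr_ge0 _) (fG a y _))// subrr normr0.
have P x y : partial1of2 f x y = f' x y.
  by rewrite partial1of2E; case: (fd x y).
have d1 : forall x y, `]a - 1, a + 1[%classic x -> [set: R] y ->
    derivable (f^~ y) x 1.
  by move=> x y _ _; case: (fd x y).
have fi' : forall x, `]a - 1, a + 1[%classic x -> integ (f x) by [].
have bd : forall x y, `]a - 1, a + 1[%classic x -> [set: R] y ->
    `|partial1of2 f x y| <= G y.
  move=> x y; rewrite /= in_itv/= => /andP[h1 h2] _; rewrite P; apply: fG.
  by rewrite ltr_norml; apply/andP; split; lra.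
split.
  exact: (@derivable_under_integral _ _ _ mu f setT measurableT a _ _ Ia fi' d1 G).
rewrite -derive1E.
rewrite (@differentiation_under_integral _ _ _ mu f setT measurableT a _ _ Ia fi' d1 G)//.
by apply: eq_Rintegral => y _; rewrite P.
Qed.

End under_integral.

Section growth.
Variable R : realType.
Local Notation mu := (@lebesgue_measure R).
Local Notation integ f := (mu.-integrable setT (EFin \o f)).
Implicit Types (f g h : R -> R) (x y s : R).

Definition rapid f := forall n : nat, exists M, forall x, (1 + `|x|) ^+ n * `|f x| <= M.

Definition tempered f := exists n : nat, exists M, forall x, `|f x| <= M * (1 + `|x|) ^+ n.

Definition flat_rapid f :=
  forall k n : nat, exists M, forall x, (1 + `|x|) ^+ n * `|f x| <= M * `|x| ^+ k.

Let p1 x : 0 < 1 + `|x|. Proof. by rewrite ltr_pwDl. Qed.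
Let pn x n : 0 < (1 + `|x|) ^+ n. Proof. by rewrite exprn_gt0. Qed.
Let le1 x : 1 <= 1 + `|x|. Proof. by rewrite lerDl. Qed.

Lemma eq_rapid f g : (forall x, f x = g x) -> rapid f -> rapid g.
Proof. by move=> /funext ->. Qed.

Lemma rapidD f g : rapid f -> rapid g -> rapid (fun x => f x + g x).
Proof.
move=> hf hg n; have [M hM] := hf n; have [N hN] := hg n; exists (M + N) => x.
by apply: (le_trans _ (lerD (hM x) (hN x))); rewrite -mulrDr ler_wpM2l ?ler_normD.
Qed.

Lemma rapidM f g : rapid f -> tempered g -> rapid (fun x => f x * g x).
Proof.
move=> hf [m [N hN]] n; have [M hM] := hf (n + m)%N; exists (M * N) => x.
have N0 : 0 <= N.
  have := le_trans (normr_ge0 _) (hN 0).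
  by rewrite normr0 addr0 expr1n mulr1.
rewrite normrM mulrA.
apply: (@le_trans _ _ ((1 + `|x|) ^+ n * `|f x| * (N * (1 + `|x|) ^+ m))).
  by rewrite ler_wpM2l// mulr_ge0// ltW.
rewrite (_ : _ * _ = ((1 + `|x|) ^+ (n + m) * `|f x|) * N); last first.
  by rewrite exprD; ring.
by rewrite ler_wpM2r.
Qed.

Lemma tempered_cst c : tempered (fun=> c).
Proof. by exists 0%N, `|c| => x; rewrite expr0 mulr1. Qed.

Lemma tempered_bounded f M : (forall x, `|f x| <= M) -> tempered f.
Proof. by move=> h; exists 0%N, M => x; rewrite expr0 mulr1. Qed.

Lemma tempered_id : tempered id.
Proof. by exists 1%N, 1 => x; rewrite expr1 mul1r lerDr. Qed.

Lemma temperedM f g : tempered f -> tempered g -> tempered (fun x => f x * g x).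
Proof.
move=> [n [M hM]] [m [N hN]]; exists (n + m)%N, (M * N) => x.
by rewrite normrM exprD mulrACA ler_pM.
Qed.

Lemma tempered_powR s : 0 <= s -> tempered (fun x => `|x| `^ s).
Proof.
move=> s0; exists (Num.truncn s).+1, 1 => x; rewrite mul1r ger0_norm ?powR_ge0//.
apply: (@le_trans _ _ ((1 + `|x|) `^ s)).
  by apply: ge0_ler_powR => //; rewrite ?nnegrE ?lerDr//; exact: ltW.
rewrite -powR_mulrn; last exact: ltW.
by apply: ler_powR => //; exact/ltW/truncnS_gt.
Qed.

Lemma rapidZ c f : rapid f -> rapid (fun x => c * f x).
Proof.
move=> hf; apply: eq_rapid (rapidM hf (tempered_cst c)) => x.
by rewrite mulrC.
Qed.

Lemma rapid_integ f : measurable_fun setT f -> rapid f -> integ f.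
Proof.
move=> mf /(_ 2%N)[M hM].
apply: (@integ_le _ _ (fun x => M * (1 + x ^+ 2)^-1)) => //.
  by apply: integZ; exact: integ_inv_oneDsqr.
move=> x; have P : 0 < 1 + x ^+ 2 by rewrite ltr_pwDl// sqr_ge0.
rewrite ler_pdivlMr// mulrC; apply: le_trans (hM x).
rewrite ler_wpM2r// -(real_normK (num_real x)).
by have := normr_ge0 x; nra.
Qed.

Lemma rapid_bounded f : rapid f -> exists M, forall x, `|f x| <= M.
Proof.
by move=> /(_ 0%N)[M hM]; exists M => x; have := hM x; rewrite expr0 mul1r.
Qed.

Lemma flat_rapid_rapid f : flat_rapid f -> rapid f.
Proof.
by move=> hf n; have [M hM] := hf 0%N n; exists M => x; have := hM x; rewrite expr0 mulr1.
Qed.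

Lemma flat_rapid0 f : flat_rapid f -> f 0 = 0.
Proof.
move=> /(_ 1%N 0%N)[M /(_ 0)]; rewrite expr0 mul1r normr0 expr1 mulr0.
by rewrite normr_le0 => /eqP.
Qed.

Lemma flat_rapidD f g : flat_rapid f -> flat_rapid g -> flat_rapid (fun x => f x + g x).
Proof.
move=> hf hg k n; have [M hM] := hf k n; have [N hN] := hg k n; exists (M + N) => x.
rewrite mulrDl; apply: (le_trans _ (lerD (hM x) (hN x))).
by rewrite -mulrDr ler_wpM2l ?ler_normD// ltW.
Qed.

Lemma flat_rapidM f g : flat_rapid f -> tempered g -> flat_rapid (fun x => f x * g x).
Proof.
move=> hf [m [N hN]] k n; have [M hM] := hf k (n + m)%N; exists (M * N) => x.
have N0 : 0 <= N.
  have := le_trans (normr_ge0 _) (hN 0).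
  by rewrite normr0 addr0 expr1n mulr1.
rewrite normrM mulrA.
apply: (@le_trans _ _ ((1 + `|x|) ^+ n * `|f x| * (N * (1 + `|x|) ^+ m))).
  by rewrite ler_wpM2l// mulr_ge0// ltW.
rewrite (_ : _ * _ = ((1 + `|x|) ^+ (n + m) * `|f x|) * N); last first.
  by rewrite exprD; ring.
by rewrite (mulrAC M) ler_wpM2r.
Qed.

(** Vanishing to infinite order at 0 absorbs any power of |x|, also the
    negative ones. *)
Lemma flat_rapid_powR s f : flat_rapid f -> flat_rapid (fun x => `|x| `^ s * f x).
Proof.
move=> hf k n; pose m := (Num.truncn `|s|).+1.
(* As m >= |s|, the product |x|^s |x|^m has a nonnegative exponent. *)
have sm : `|s| <= m%:R by exact/ltW/truncnS_gt.
have [M hM] := hf (k + m)%N (n + m + m)%N; exists M => x.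
have [->|x0] := eqVneq x 0.
  have h := hM 0; rewrite (flat_rapid0 hf) mulr0 !normr0 mulr0.
  rewrite (flat_rapid0 hf) normr0 mulr0 in h.
  have [->|k0] := eqVneq k 0%N; last by rewrite expr0n (negbTE k0) mulr0.
  rewrite expr0 mulr1; have := hM 1; rewrite normr1 expr1n mulr1.
  by apply: le_trans; rewrite mulr_ge0// exprn_ge0.
have x1 : 0 < `|x| by rewrite normr_gt0.
rewrite -(@ler_pM2r _ (`|x| ^+ m)) ?exprn_gt0// -(mulrA M) -exprD.
apply: le_trans (hM x); rewrite normrM (ger0_norm (powR_ge0 _ _)).
have -> : (1 + `|x|) ^+ n * (`|x| `^ s * `|f x|) * `|x| ^+ m =
  (1 + `|x|) ^+ n * (`|x| `^ s * `|x| ^+ m) * `|f x| by ring.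
rewrite ler_wpM2r// -addnA exprD; apply: ler_wpM2l; first exact: ltW.
rewrite -powR_mulrn// -powRD; last by rewrite (gt_eqF x1) implybT.
have := ler_norm (- s); rewrite normrN => s1; have s2 := ler_norm s.
apply: (@le_trans _ _ ((1 + `|x|) `^ (s + m%:R))).
  by apply: ge0_ler_powR; rewrite ?nnegrE ?lerDr//; lra.
rewrite -powR_mulrn; last exact: ltW.
by apply: ler_powR => //; rewrite natrD; lra.
Qed.

End growth.

(** * Even, Schwartz and flat functions *)

Section towers.
Variable R : realType.
Implicit Types (f g h e o : R -> R) (x y s c : R).

(** The largest class of functions satisfying P that is stable under the
    derivation f |-> f' / m. *)
Definition tower (m : R -> R) (P : (R -> R) -> Prop) f :=
  exists C : (R -> R) -> Prop, C f /\ forall h, C h ->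
    P h /\ exists2 g, C g & forall x, is_derive x 1 h (m x * g x).

Lemma tower_unfold m P f : tower m P f ->
  P f /\ exists2 g, tower m P g & forall x, is_derive x 1 f (m x * g x).
Proof.
move=> [C [Cf HC]]; have [Pf [g Cg fg]] := HC f Cf; split => //.
by exists g => //; exists C.
Qed.

(** Coinduction: a class closed under the derivation whose members all satisfy P
    consists of towers.  Smoothness of a transform is proved below by exhibiting
    such a class, stable under differentiation under the integral sign. *)
Lemma tower_coind m P (C : (R -> R) -> Prop) :
  (forall h, C h -> P h /\ exists2 g, C g & forall x, is_derive x 1 h (m x * g x)) ->
  forall f, C f -> tower m P f.
Proof. by move=> HC f Cf; exists C. Qed.

Lemma tower_sub m P Q : (forall h, P h -> Q h) ->
  forall f, tower m P f -> tower m Q f.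
Proof.
move=> PQ f [C [Cf HC]]; exists C; split => // h /HC[Ph [g Cg hg]].
by split; [exact: PQ|exists g].
Qed.

Lemma tower_continuous m P f : tower m P f -> continuous f.
Proof. by move=> /tower_unfold[_ [g _ fg]]; exact: dcontT fg. Qed.

Lemma eq_tower m P f g : (forall x, f x = g x) -> tower m P f -> tower m P g.
Proof. by move=> /funext ->. Qed.

Definition even_fun f := forall x, f (- x) = f x.

(** Even Schwartz functions are treated as smooth functions of x^2, hence the
    derivation f' / x in place of f'. *)
Definition smoothR := tower (fun=> 1) (fun=> True).
Definition schwartzR := tower (fun=> 1) (@rapid R).
Definition even_schwartz := tower id (fun f => even_fun f /\ rapid f).
Definition flat_schwartz := tower id (fun f => even_fun f /\ flat_rapid f).

Lemma schwartzR_smooth f : schwartzR f -> smoothR f.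
Proof. exact: tower_sub. Qed.

Lemma flat_even_schwartz f : flat_schwartz f -> even_schwartz f.
Proof. by apply: tower_sub => h [? ?]; split => //; exact: flat_rapid_rapid. Qed.

Lemma schwartzR_rapid f : schwartzR f -> rapid f.
Proof. by move=> /tower_unfold[]. Qed.

Lemma even_schwartz_rapid f : even_schwartz f -> rapid f.
Proof. by move=> /tower_unfold[[]]. Qed.

Lemma even_schwartz_even f : even_schwartz f -> even_fun f.
Proof. by move=> /tower_unfold[[]]. Qed.

Lemma even_schwartz_measurable f : even_schwartz f -> measurable_fun setT f.
Proof. by move=> /tower_continuous; exact: continuous_measurable_fun. Qed.

Lemma flat_schwartz_rapid f : flat_schwartz f -> flat_rapid f.
Proof. by move=> /tower_unfold[[]]. Qed.

Lemma tower_lin m P :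
  (forall a b f g, P f -> P g -> P (fun x => a * f x + b * g x)) ->
  forall a b f g, tower m P f -> tower m P g ->
  tower m P (fun x => a * f x + b * g x).
Proof.
move=> HP a b f g hf hg.
apply: (@tower_coind m P (fun h => exists a b (f g : R -> R),
  [/\ tower m P f, tower m P g & h = fun x => a * f x + b * g x])); last first.
  by exists a, b, f, g.
move=> _ {a b f g hf hg} [a [b [f [g [hf hg ->]]]]].
have [Pf [f' hf' df]] := tower_unfold hf.
have [Pg [g' hg' dg]] := tower_unfold hg.
split; first exact: HP.
exists (fun x => a * f' x + b * g' x); first by exists a, b, f', g'.
move=> x; apply: deq (dD (dZ a (df x)) (dZ b (dg x))) _.
by ring.
Qed.

(** The derivation sends x^2 f to 2 f + x^2 Df, so the class to use consists of
    the sums x^2 f + g. *)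
Lemma tower_sqr P :
  (forall a b f g, P f -> P g -> P (fun x => a * f x + b * g x)) ->
  (forall f, P f -> P (fun x => x ^+ 2 * f x)) ->
  forall f, tower id P f -> tower id P (fun x => x ^+ 2 * f x).
Proof.
move=> HP HS f hf.
apply: (@tower_coind id P (fun h => exists f g : R -> R,
  [/\ tower id P f, tower id P g & h = fun x => 1 * (x ^+ 2 * f x) + 1 * g x])).
  move=> _ {f hf} [f [g [hf hg ->]]].
  have [Pf [f' hf' df]] := tower_unfold hf.
  have [Pg [g' hg' dg]] := tower_unfold hg.
  split; first by apply: HP => //; exact: HS.
  exists (fun x => 1 * (x ^+ 2 * f' x) + 1 * (2 * f x + 1 * g' x)).
    exists f', (fun x => 2 * f x + 1 * g' x); split => //.
    exact: tower_lin.
  move=> x; apply: (deq (dD (dZ 1 (dM (dX 2 (did x)) (df x))) (dZ 1 (dg x)))).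
  by rewrite /= expr1; ring.
exists f, (fun x => 0 * f x + 0 * f x); split => //; first exact: tower_lin.
by apply/funext => x; ring.
Qed.

Let evP f := even_fun f /\ rapid f.
Let flP f := even_fun f /\ flat_rapid f.

Let tempered_sqr : tempered (fun x : R => x ^+ 2).
Proof. exact: temperedM (@tempered_id R) (@tempered_id R). Qed.

Let rapid_lin a b f g : rapid f -> rapid g -> rapid (fun x => a * f x + b * g x).
Proof. by move=> hf hg; apply: rapidD; exact: rapidZ. Qed.

Let ev_lin a b f g : evP f -> evP g -> evP (fun x => a * f x + b * g x).
Proof.
move=> [ef rf] [eg rg]; split; last exact: rapid_lin.
by move=> x; rewrite ef eg.
Qed.

Let ev_sqr f : evP f -> evP (fun x => x ^+ 2 * f x).
Proof.
move=> [ef rf]; split; first by move=> x; rewrite ef sqrrN.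
by apply: eq_rapid (rapidM rf tempered_sqr) => x; rewrite mulrC.
Qed.

Let fl_lin a b f g : flP f -> flP g -> flP (fun x => a * f x + b * g x).
Proof.
move=> [ef rf] [eg rg]; split; first by move=> x; rewrite ef eg.
have Z c h : flat_rapid h -> flat_rapid (fun x => c * h x).
  move=> hh; have := flat_rapidM hh (tempered_cst c).
  by under eq_fun do rewrite mulrC.
by apply: flat_rapidD; exact: Z.
Qed.

Let fl_sqr f : flP f -> flP (fun x => x ^+ 2 * f x).
Proof.
move=> [ef rf]; split; first by move=> x; rewrite ef sqrrN.
have := flat_rapidM rf tempered_sqr.
by under eq_fun do rewrite mulrC.
Qed.

Lemma even_schwartz_lin a b f g : even_schwartz f -> even_schwartz g ->
  even_schwartz (fun x => a * f x + b * g x).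
Proof. exact: tower_lin. Qed.

Lemma even_schwartzZ c f : even_schwartz f -> even_schwartz (fun x => c * f x).
Proof.
move=> hf; apply: eq_tower (even_schwartz_lin c 0 hf hf) => x.
by rewrite mul0r addr0.
Qed.

Lemma even_schwartz_sqr f : even_schwartz f ->
  even_schwartz (fun x => x ^+ 2 * f x).
Proof. exact: tower_sqr. Qed.

Lemma flat_schwartzZ c f : flat_schwartz f -> flat_schwartz (fun x => c * f x).
Proof.
move=> hf; apply: eq_tower (tower_lin fl_lin c 0 hf hf) => x.
by rewrite mul0r addr0.
Qed.

Lemma schwartzR_lin a b f g : schwartzR f -> schwartzR g ->
  schwartzR (fun x => a * f x + b * g x).
Proof. exact: tower_lin. Qed.

(** The class of e + x o, e and o even Schwartz, is stable under
    differentiation. *)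
Lemma schwartzR_even_odd e o : even_schwartz e -> even_schwartz o ->
  schwartzR (fun x => e x + x * o x).
Proof.
move=> he ho.
apply: (@tower_coind (fun=> 1) (@rapid R) (fun h => exists e o : R -> R,
  [/\ even_schwartz e, even_schwartz o & h = fun x => e x + x * o x])); last first.
  by exists e, o.
move=> _ {e o he ho} [e [ o [he ho ->]]].
have [[_ re] [e' he' de]] := tower_unfold he.
have [[_ ro] [ o' ho' d_o]] := tower_unfold ho.
split.
  apply: rapidD => //.
  by apply: eq_rapid (rapidM ro (@tempered_id R)) => x; rewrite mulrC.
exists (fun x => (1 * o x + 1 * (x ^+ 2 * o' x)) + x * e' x).
  exists (fun x => 1 * o x + 1 * (x ^+ 2 * o' x)), e'; split => //.
  by apply: even_schwartz_lin => //; exact: even_schwartz_sqr.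
move=> x; apply: deq (dD (de x) (dM (did x) (d_o x))) _.
by rewrite /=; ring.
Qed.

Lemma even_schwartz_schwartzR e : even_schwartz e -> schwartzR e.
Proof.
move=> he; apply: eq_tower (schwartzR_even_odd he (even_schwartzZ 0 he)) => x.
by rewrite mul0r mulr0 addr0.
Qed.

Lemma is_derive_abs_powR s x : x != 0 ->
  is_derive x 1 (fun y => `|y| `^ s) (s * `|x| `^ (s - 2) * x).
Proof.
move=> x0; have x1 : 0 < `|x| by rewrite normr_gt0.
have E (y : R) : 0 < y -> y `^ (s - 1) = y `^ (s - 2) * y.
  move=> y0; rewrite -{3}(powRr1 (ltW y0)) -powRD; last by rewrite (gt_eqF y0) implybT.
  by congr (_ `^ _); ring.
have [xn|xp|xx] := ltgtP x 0; last by rewrite xx eqxx in x0.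
- have nx : 0 < - x by rewrite oppr_gt0.
  apply: (@dlocal _ (fun y => (- y) `^ s) _ _ _ (- x)) => //.
    by move=> y /ltr_distlDr; rewrite subrr => y0; rewrite ltr0_norm.
  apply: (deq (@dchain _ (fun z => z `^ s) (fun y => - y) x _ _
    (is_derive1_powR s nx) (dN (did x)))).
  by rewrite ltr0_norm// E//; ring.
- apply: (@dlocal _ (fun y => y `^ s) _ _ _ x) => //.
    by move=> y /ltr_distlCBl; rewrite subrr => y0; rewrite gtr0_norm.
  apply: (deq (is_derive1_powR s xp)).
  by rewrite gtr0_norm// E// mulrA.
Qed.

(** Away from 0 the derivation sends |x|^s f to |x|^(s-2) (s f + x^2 Df), again of
    the same form; at 0 flatness makes every derivative vanish. *)
Lemma flat_schwartz_powR s f : flat_schwartz f ->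
  flat_schwartz (fun x => `|x| `^ s * f x).
Proof.
move=> hf; apply: (@tower_coind id _ (fun h => exists s f,
  flat_schwartz f /\ h = fun x => `|x| `^ s * f x)); last by exists s, f.
move=> _ {s f hf} [s [f [hf ->]]].
have [[ef rf] [f' hf' df]] := tower_unfold hf.
have rp := flat_rapid_powR s rf.
split; first by split=> [x|//]; rewrite normrN ef.
exists (fun x => `|x| `^ (s - 2) * (s * f x + 1 * (x ^+ 2 * f' x))).
  exists (s - 2), (fun x => s * f x + 1 * (x ^+ 2 * f' x)); split => //.
  by apply: (tower_lin fl_lin) => //; exact: (tower_sqr fl_lin fl_sqr).
move=> x; have [->|x0] := eqVneq x 0.
  rewrite /= mul0r; apply: is_derive_eps => e e0.
  have [M hM] := rp 2%N 0%N.
  have M1 : 0 < `|M| + 1 by rewrite ltr_wpDl.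
  exists (e / (`|M| + 1)); first by rewrite divr_gt0.
  move=> h; rewrite ltr_pdivlMr// => hh.
  rewrite add0r (flat_rapid0 rf) mulr0 subr0 mul0r subr0.
  have := hM h; rewrite expr0 mul1r => K; apply: (le_trans K).
  rewrite expr2 mulrA ler_wpM2r//.
  have := ler_norm M; have := normr_ge0 h; nra.
apply: deq (dM (is_derive_abs_powR s x0) (df x)) _ => /=.
have -> : `|x| `^ s = `|x| `^ (s - 2) * x ^+ 2.
  rewrite -real_normK ?num_real// -powR_mulrn// -powRD; last first.
    by rewrite normr_eq0 x0 implybT.
  by congr (_ `^ _); ring.
by ring.
Qed.

Lemma schwartzR_reflect f : schwartzR f -> schwartzR (fun x => f (- x)).
Proof.
move=> hf; apply: (@tower_coind (fun=> 1) _ (fun h => exists c f,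
  schwartzR f /\ h = fun x => c * f (- x))); last first.
  by exists 1, f; split => //; apply/funext => x; rewrite mul1r.
move=> _ {f hf} [c [f [hf ->]]].
have [rf [f' hf' df]] := tower_unfold hf.
split.
  by apply: rapidZ => n; have [M hM] := rf n; exists M => x; rewrite -normrN.
exists (fun x => (- c) * f' (- x)); first by exists (- c), f'.
move=> x; apply: deq (dZ c (@dchain _ f (fun y => - y) x _ _ (df (- x)) (dN (did x)))) _.
by rewrite /=; ring.
Qed.

End towers.

(** * Hadamard division *)

Section division.
Variable R : realType.
Local Notation mu := (@lebesgue_measure R).
Local Notation integ f := (mu.-integrable setT (EFin \o f)).
Implicit Types (f g h e o : R -> R) (x y s c a : R).

Let cut (t : R) := tpow 0 t * tpow 0 (1 - t).

Let measurable_cut : measurable_fun setT cut.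
Proof.
apply: measurable_funM; first exact: measurable_tpow.
by apply: (measurableT_comp (measurable_tpow 0)); exact: measurable_funB.
Qed.

Let cutE t : cut t = if 0 < t < 1 then 1 else 0.
Proof.
rewrite /cut /tpow !powRr0 subr_gt0.
by case: (0 < t); case: (t < 1); rewrite ?mul1r ?mul0r.
Qed.

Let integ_cut : integ cut.
Proof. by apply: integ_tpow01; rewrite ltrN10. Qed.

Let mean a n h x := \int[mu]_t (cut t * t ^+ n * h (a + t * (x - a))).

Let measurable_affine a x : measurable_fun setT (fun t : R => a + t * (x - a)).
Proof. by apply: measurable_funD => //; exact: measurable_funM. Qed.

Let mean_kernel a n h x : continuous h -> (exists M : R, forall x, `|h x| <= M) ->
  integ (fun t => cut t * t ^+ n * h (a + t * (x - a))).
Proof.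
move=> ch [M hM].
apply: (@integ_le _ _ (fun t => M * cut t)).
- apply: measurable_funM.
    by apply: measurable_funM => //; exact: exprn_measurable.
  apply: (measurableT_comp (continuous_measurable_fun ch)).
  exact: measurable_affine.
- exact: integZ.
move=> t; rewrite cutE !normrM.
case: ifP => [/andP[t0 t1]|_]; last by rewrite normr0 !mul0r mulr0.
rewrite normr1 mul1r mulr1 normrX gtr0_norm// -[leRHS]mul1r ler_pM//.
  by rewrite exprn_ge0// ltW.
by rewrite exprn_ile1// ltW.
Qed.

Let is_derive_mean a n h h' x : continuous h' ->
  (forall x, is_derive x 1 h (h' x)) ->
  (exists M : R, forall x, `|h x| <= M) -> (exists M : R, forall x, `|h' x| <= M) ->
  is_derive x 1 (mean a n h) (mean a n.+1 h' x).
Proof.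
move=> ch' dh bh [M hM].
pose f' z t := cut t * t ^+ n.+1 * h' (a + t * (z - a)).
apply: (@is_derive_Rint _ _ f' _ (fun t => M * cut t)).
- by move=> z; apply: mean_kernel => //; exact: dcontT dh.
- move=> z t.
  have d1 : is_derive z 1 (fun z => a + t * (z - a)) t.
    apply: deq (dD (dcst a z) (dZ t (dB (did z) (dcst a z)))) _.
    by rewrite subr0 mulr1 add0r.
  apply: deq (dZ (cut t * t ^+ n) (dcompo d1 (dh (a + t * (z - a))))) _.
  by rewrite /f' exprS; ring.
- exact: integZ.
move=> z t _; rewrite /f' cutE !normrM.
case: ifP => [/andP[t0 t1]|_]; last by rewrite normr0 !mul0r mulr0.
rewrite normr1 mul1r mulr1 normrX gtr0_norm// -[leRHS]mul1r ler_pM//.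
  by rewrite exprn_ge0// ltW.
by rewrite exprn_ile1// ltW.
Qed.

Let smooth_mean a n h : schwartzR h -> smoothR (mean a n h).
Proof.
move=> hh; apply: (@tower_coind _ (fun=> 1) _ (fun g => exists n h,
  schwartzR h /\ g = mean a n h)); last by exists n, h.
move=> _ {n h hh} [n [h [hh ->]]]; split => //.
have [rh [h' hh' dh]] := tower_unfold hh.
exists (mean a n.+1 h'); first by exists n.+1, h'.
move=> x; rewrite mul1r; apply: is_derive_mean => //.
- exact: tower_continuous hh'.
- by move=> z; have := dh z; rewrite mul1r.
- exact: rapid_bounded.
- exact/rapid_bounded/schwartzR_rapid.
Qed.

Let mean_div a f f' x : schwartzR f' -> (forall x, is_derive x 1 f (f' x)) ->
  (x - a) * mean a 0 f' x = f x - f a.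
Proof.
move=> hf' df; have cf' := tower_continuous hf'.
have bf' : exists M : R, forall x, `|f' x| <= M.
  exact/rapid_bounded/schwartzR_rapid.
rewrite /mean -RintZ; last exact: mean_kernel.
pose F t := f (a + t * (x - a)).
have dF (t : R) : is_derive t 1 F ((x - a) * f' (a + t * (x - a))).
  have d1 : is_derive t 1 (fun t => a + t * (x - a)) (x - a).
    apply: deq (dD (dcst a t) (dM (did t) (dcst (x - a) t))) _.
    by rewrite mulr0 mul1r addr0 add0r.
  by apply: deq (dcompo d1 (df (a + t * (x - a)))) _; rewrite mulrC.
have cF := dcontT dF.
have cG : continuous (fun t : R => (x - a) * f' (a + t * (x - a))).
  move=> t; apply: cvgM; first exact: cvg_cst.
  apply: (@continuous_comp _ _ _ (fun t : R => a + t * (x - a)) f'); last exact: cf'.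
  apply: cvgD; first exact: cvg_cst.
  by apply: cvgM; [exact: cvg_id|exact: cvg_cst].
transitivity (\int[mu]_(t in `]0, 1[) ((x - a) * f' (a + t * (x - a)))).
  rewrite [RHS]Rintegral_mkcond; apply: eq_Rint => t.
  rewrite patchE expr0 mulr1 cutE; case: ifPn => [t01|t01].
    by rewrite mem_set ?mul1r//= in_itv.
  by rewrite memNset ?mul0r ?mulr0//= in_itv/=; exact/negP.
have mG := continuous_measurable_fun cG.
transitivity (\int[mu]_(t in `[0, 1]) ((x - a) * f' (a + t * (x - a)))).
  rewrite /Rintegral; congr fine; apply/esym.
  apply: (@integral_itv_bndoo _ 0 1 _ true false).
  by apply/measurable_EFinP; exact: measurable_funTS.
rewrite /Rintegral (@continuous_FTC2 _ _ F)//.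
- by rewrite /F/= mul1r mul0r addr0 subrKC.
- exact: continuous_subspaceT.
- split.
  + by move=> t _; case: (dF t).
  + by apply: cvg_at_right_filter; exact: cF.
  + by apply: cvg_at_left_filter; exact: cF.
- by move=> t _; rewrite derive1E; case: (dF t).
Qed.

Let rapid_div a h : continuous h -> rapid (fun x => (x - a) * h x) -> rapid h.
Proof.
move=> ch hr n; have [M hM] := hr n.
have [c _ hc] := @EVT_max R (fun x => `|h x|) (a - 1) (a + 1) ltac:(lra)
  (continuous_subspaceT (fun x => cvg_comp _ _ (ch x) (@norm_continuous _ _ (h x)))).
exists (`|M| + (2 + `|a|) ^+ n * `|h c|) => x.
have [x1|x1] := leP 1 `|x - a|.
  apply: (@le_trans _ _ M); last first.
    by rewrite (le_trans (ler_norm M))// lerDl mulr_ge0// exprn_ge0// addr_ge0.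
  apply: le_trans (hM x); rewrite normrM ler_wpM2l ?exprn_ge0 ?addr_ge0//.
  by rewrite ler_peMl.
apply: (@le_trans _ _ ((2 + `|a|) ^+ n * `|h c|)); last by rewrite lerDr.
have xa : `|x| <= 1 + `|a|.
  by have := ler_normD (x - a) a; rewrite subrK; lra.
apply: ler_pM => //; rewrite ?exprn_ge0 ?addr_ge0//.
  by rewrite lerXn2r ?nnegrE ?addr_ge0//; lra.
by apply: hc; rewrite in_itv/=; move: x1; rewrite ltr_norml => /andP[? ?]; lra.
Qed.

(** Hadamard's lemma for Schwartz functions: the quotient is the average of f'
    along the segment from a to x, which gives smoothness, and the derivatives
    h_n of the quotient satisfy (x - a) h_n = f_n - n h_(n-1), which gives their
    decay. *)
Lemma schwartzR_div a f : schwartzR f -> f a = 0 ->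
  exists2 g, schwartzR g & forall x, f x = (x - a) * g x.
Proof.
move=> hf fa; have [rf [f' hf' df]] := tower_unfold hf.
have df1 (x : R) : is_derive x 1 f (f' x) by have := df x; rewrite mul1r.
exists (mean a 0 f'); last by move=> x; rewrite mean_div// fa subr0.
apply: (@tower_coind _ (fun=> 1) _ (fun h => smoothR h /\
  exists f U : R -> R, exists c, [/\ schwartzR f, rapid U,
    forall x, is_derive x 1 U (c * h x) & forall x, (x - a) * h x = f x - U x])).
  move=> h [hh [p [U [c [hp rU dU pE]]]]].
  have [_ [h' hh' dh]] := tower_unfold hh.
  have [rp [p' hp' dp]] := tower_unfold hp.
  have ch := tower_continuous hh.
  have rh : rapid h.
    apply: (rapid_div (a := a)) => //.
    have := rapidD rp (rapidZ (-1) rU).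
    by apply: eq_rapid => x; rewrite pE mulN1r.
  split => //; exists h' => //; split => //.
  exists p', (fun x => (c + 1) * h x), (c + 1); split => //.
  - exact: rapidZ.
  - by move=> x; apply: dZ; have := dh x; rewrite mul1r.
  - move=> x.
    have d1 := dM (dB (did x) (dcst a x)) (dh x).
    have d2 := dB (dp x) (dU x).
    rewrite -(funext pE) in d2.
    have := duniq d1 d2; rewrite !mul1r subr0 => K.
    by move: K; lra.
split; first exact: smooth_mean.
exists f, (fun=> 0), 0; split => //.
- by move=> n; exists 0 => x; rewrite normr0 mulr0.
- by move=> x; rewrite mul0r; exact: dcst.
- by move=> x; rewrite subr0 mean_div// fa subr0.
Qed.

(** The derivative of an even function is odd, hence vanishes at 0 and is
    divisible by x with an even quotient. *)
Lemma even_schwartzP f : schwartzR f -> even_fun f -> even_schwartz f.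
Proof.
move=> hf ef; apply: (@tower_coind _ id _ (fun f => schwartzR f /\ even_fun f)) => //.
move=> {hf ef}f [hf ef]; have [rf [f' hf' df]] := tower_unfold hf.
have of' x : f' (- x) = - f' x.
  have d1 := dcompo (dN (did x)) (df (- x)).
  rewrite (funext ef) in d1.
  by have := duniq (df x) d1; rewrite !mul1r mulrN1 => ->; rewrite opprK.
have f'0 : f' 0 = 0 by have := of' 0; rewrite oppr0; lra.
have [g hg gE] := schwartzR_div hf' f'0.
split => //; exists g; last by move=> x; have := df x; rewrite mul1r gE subr0.
split => // x; have [->|x0] := eqVneq x 0; first by rewrite oppr0.
have := of' x; rewrite !gE !subr0 mulNr => /oppr_inj.
by apply: mulfI.
Qed.

(** The odd part vanishes at 0, hence is divisible by x. *)
Lemma schwartzR_decomp f : schwartzR f ->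
  exists e o, [/\ even_schwartz e, even_schwartz o & forall x, f x = e x + x * o x].
Proof.
move=> hf; have hr := schwartzR_reflect hf.
pose e x := 2^-1 * f x + 2^-1 * f (- x).
pose d x := 2^-1 * f x + (- 2^-1) * f (- x).
have he : even_schwartz e.
  apply: even_schwartzP; first exact: schwartzR_lin.
  by move=> x; rewrite /e opprK addrC.
have hd : schwartzR d by exact: schwartzR_lin.
have d0 : d 0 = 0 by rewrite /d oppr0; lra.
have od x : d (- x) = - d x by rewrite /d opprK; lra.
have [g hg gE] := schwartzR_div hd d0.
have eg : even_fun g.
  move=> x; have [->|x0] := eqVneq x 0; first by rewrite oppr0.
  have := od x; rewrite !gE !subr0 mulNr => /oppr_inj.
  by apply: mulfI.
exists e, g; split => //; first exact: even_schwartzP.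
by move=> x; have := gE x; rewrite subr0 => <-; rewrite /e /d; lra.
Qed.

(** Both a and -a are zeros of an even function that vanishes at a; averaging the
    quotient with its reflection makes it even. *)
Lemma even_schwartz_div a f : a != 0 -> even_schwartz f -> f a = 0 ->
  exists2 g, even_schwartz g & forall x, f x = (x ^+ 2 - a ^+ 2) * g x.
Proof.
move=> a0 hf fa; have ef := even_schwartz_even hf.
have [g1 hg1 g1E] := schwartzR_div (even_schwartz_schwartzR hf) fa.
have g1a : g1 (- a) = 0.
  have := g1E (- a); rewrite ef fa => /esym/eqP.
  by rewrite mulf_eq0 -opprD oppr_eq0 -mulr2n mulrn_eq0 (negbTE a0) => /eqP.
have [g hg gE] := schwartzR_div hg1 g1a.
have fE x : f x = (x ^+ 2 - a ^+ 2) * g x.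
  by rewrite g1E gE; ring.
exists (fun x => 2^-1 * g x + 2^-1 * g (- x)).
  apply: even_schwartzP; first by apply: schwartzR_lin => //; exact: schwartzR_reflect.
  by move=> x; rewrite opprK addrC.
move=> x; have := fE x; have := fE (- x); rewrite ef sqrrN; lra.
Qed.

Definition gaussian x : R := expR (- (x ^+ 2 / 2)).

Lemma is_derive_gaussian x : is_derive x 1 gaussian (x * (- gaussian x)).
Proof.
have d1 : is_derive x 1 (fun x => - (x ^+ 2 / 2)) (- x).
  apply: deq (dN (dM (dX 2 (did x)) (dcst 2^-1 x))) _.
  by rewrite /= expr1; field.
apply: deq (dcompo d1 (is_derive_expR (- (x ^+ 2 / 2)))) _.
by rewrite /gaussian; ring.
Qed.

Lemma even_schwartz_gaussian : even_schwartz gaussian.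
Proof.
apply: (@tower_coind _ id _ (fun h => exists c, h = fun x => c * gaussian x)); last first.
  by exists 1; apply/funext => x; rewrite mul1r.
move=> _ [c ->]; split.
  split; first by move=> x; rewrite /gaussian sqrrN.
  apply: rapidZ => n; exists (n`!%:R * expR (3 / 2)) => x.
  rewrite (ger0_norm (expR_ge0 _)).
  have p : 0 <= 1 + `|x| by rewrite addr_ge0.
  have K : (1 + `|x|) ^+ n <= n`!%:R * expR (1 + `|x|).
    by rewrite -ler_pdivrMr ?expR_gt0// -expRN expRN_le.
  apply: (@le_trans _ _ (n`!%:R * expR (1 + `|x|) * expR (- (x ^+ 2 / 2)))).
    by rewrite ler_wpM2r// expR_ge0.
  rewrite -mulrA -expRD ler_wpM2l// ler_expR -(real_normK (num_real x)).
  by have := sqr_ge0 (`|x| - 1); nra.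
exists (fun x => (- c) * gaussian x); first by exists (- c).
move=> x; apply: deq (dZ c (is_derive_gaussian x)) _.
by rewrite /=; ring.
Qed.

End division.

(** * Normalised Bessel functions *)

Section bessel.
Variable R : realType.
Local Notation mu := (@lebesgue_measure R).
Local Notation integ f := (mu.-integrable setT (EFin \o f)).
Implicit Types (g u x : R) (n : nat).

(** Integration by parts against the Gaussian; it gives the functional equation
    of Gamma. *)
Lemma gauss_massS g : - (1 / 2) < g ->
  gauss_mass (g + 1) = (2 * g + 2) * gauss_mass g.
Proof.
move=> g0; have g1 : - (1 / 2) < g + 1 by lra.
have s0 : 0 < 2 * g + 1 by lra.
have [i0 <-] := integ_gauss g0; have [i1 <-] := integ_gauss g1.
pose w x := `|x| `^ (2 * g + 1) : R.
pose f x := (2 * g + 2) * (gaussian x * w x) -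
  gaussian x * `|x| `^ (2 * (g + 1) + 1).
have E x : `|x| `^ (2 * (g + 1) + 1) = x ^+ 2 * w x.
  rewrite /w -real_normK ?num_real// -powR_mulrn//.
  rewrite -powRD; last by rewrite gt_eqF ?implyFb//; lra.
  by congr (_ `^ _); ring.
have dF x : is_derive x 1 (fun y => gaussian y * (w y * y)) (f x).
  apply: deq (dM (is_derive_gaussian x) (is_derive_abs_powRx x s0)) _.
  by rewrite /f E /w; ring.
have cG := dcontT (@is_derive_gaussian R).
have cw : continuous w by exact: continuous_abs_powR.
have cf : continuous f.
  rewrite /f; under eq_fun do rewrite E.
  move=> x; apply: cvgB.
    apply: cvgM; first exact: cvg_cst.
    by apply: cvgM; [exact: cG|exact: cw].
  apply: cvgM; first exact: cG.
  by apply: cvgM; [exact: exprn_continuous|exact: cw].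
have ifn : integ f by apply: integB => //; exact: integZ.
have rF : rapid (fun y => gaussian y * (w y * y)).
  apply: rapidM.
    exact: (even_schwartz_rapid (even_schwartz_gaussian R)).
  by apply: temperedM; [exact/tempered_powR/ltW|exact: tempered_id].
have [C hC] := rF 1%N.
have := Rint_derive_eq0 dF cf ifn hC.
by rewrite /f RintB ?RintZ//; [move=> /eqP; rewrite subr_eq0 => /eqP <-|exact: integZ].
Qed.

Lemma GammaS g : - (1 / 2) < g -> Gamma (g + 1 + 1) = (g + 1) * Gamma (g + 1).
Proof.
move=> g0; have := gauss_massS g0; rewrite /gauss_mass.
rewrite (@powRD _ 2 (g + 1) 1) ?pnatr_eq0 ?implybT// powRr1// => K.
have p : 2 `^ (g + 1) != 0 :> R by rewrite powR_eq0 pnatr_eq0.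
apply: (mulfI p); apply: (mulfI (_ : 2 != 0 :> R)); first by rewrite pnatr_eq0.
by move: K; rewrite !mulrA; lra.
Qed.

(** Coefficients of the normalised Bessel function of order g as a power series
    in x^2. *)
Definition bessel_coeff g n : R :=
  (- 4^-1) ^+ n / (n`!%:R * \prod_(k < n) (g + 1 + k%:R)).

Lemma bessel_coeff_Gamma g n : - (1 / 2) < g ->
  bessel_coeff g n = Gamma (g + 1) * ((- 4^-1) ^+ n / (n`!%:R * Gamma (n%:R + g + 1))).
Proof.
move=> g0.
have E : Gamma (n%:R + g + 1) = Gamma (g + 1) * \prod_(k < n) (g + 1 + k%:R).
  elim: n => [|n ih]; first by rewrite big_ord0 mulr1 add0r.
  rewrite big_ord_recr/= mulrA -ih -natr1.
  have -> : n%:R + 1 + g + 1 = (n%:R + g) + 1 + 1 by ring.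
  rewrite GammaS; first by rewrite mulrC; congr (_ * _); ring.
  by have := ler0n R n; lra.
rewrite E /bessel_coeff; have p : Gamma (g + 1) != 0.
  by apply: Gamma_neq0; lra.
have q : \prod_(k < n) (g + 1 + k%:R) != 0.
  apply/prodf_neq0 => k _; rewrite gt_eqF//.
  by have := ler0n R k; lra.
by field; rewrite p q pnatr_eq0 -lt0n fact_gt0.
Qed.

Let coeff_le g n : - (1 / 2) < g -> `|bessel_coeff g n| <= (n`!%:R)^-1.
Proof.
move=> g0; rewrite /bessel_coeff invfM mulrCA normrM ger0_norm ?invr_ge0//.
rewrite ler_piMr ?invr_ge0//.
elim: n => [|n ih]; first by rewrite expr0 big_ord0 invr1 mulr1 normr1.
rewrite exprS big_ord_recr/= invfM.
have n0 := ler0n R n.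
have p : 0 < g + 1 + n%:R by lra.
rewrite (_ : _ * _ * _ = ((- 4^-1) ^+ n / \prod_(k < n) (g + 1 + k%:R)) *
  (- 4^-1 / (g + 1 + n%:R))); last by ring.
rewrite normrM mulr_ile1//.
rewrite normrM normrN !gtr0_norm ?invr_gt0//.
by rewrite ler_pdivrMr// mul1r; lra.
Qed.

Let cvg_exp u : cvgn (series (fun n => (n`!%:R)^-1 * u ^+ n)).
Proof.
have := @is_cvg_series_exp_coeff R u.
by congr (cvgn (series _)); apply/funext => n; rewrite /exp_coeff/= mulrC.
Qed.

(** For g > -1/2 the coefficients are bounded by those of the exponential. *)
Lemma bessel_partial_le g u N : - (1 / 2) < g ->
  `|pseries (bessel_coeff g) u N| <= expR `|u|.
Proof.
move=> g0; rewrite /pseries /series/=.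
apply: le_trans (ler_norm_sum _ _ _) _.
apply: (@le_trans _ _ (\sum_(0 <= i < N) exp_coeff `|u| i)).
  apply: ler_sum => i _; rewrite normrM normrX /exp_coeff mulrC.
  by rewrite ler_wpM2l ?exprn_ge0// coeff_le.
rewrite /expR; apply: nondecreasing_cvgn_le.
  apply/nondecreasing_seqP => n; rewrite /series/= big_nat_recr//= lerDl.
  by rewrite /exp_coeff/= divr_ge0// exprn_ge0.
exact: is_cvg_series_exp_coeff.
Qed.

Lemma is_cvg_bessel g u : - (1 / 2) < g -> cvgn (pseries (bessel_coeff g) u).
Proof.
move=> g0; apply: normed_cvg; rewrite /normed_series_of/=.
apply: (@series_le_cvg _ _ (fun n => (n`!%:R)^-1 * `|u| ^+ n)); last exact: cvg_exp.
- by move=> n; exact: normr_ge0.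
- by move=> n; rewrite mulr_ge0 ?invr_ge0// exprn_ge0.
- move=> n; rewrite normrM normrX ler_wpM2r ?exprn_ge0//.
  exact: coeff_le.
Qed.

(** The normalised Bessel function as a function of the square of its argument. *)
Definition bessel_sqr g u := limn (pseries (bessel_coeff g) u).

Let bessel_diffs g : - (1 / 2) < g -> pseries_diffs (bessel_coeff g) =
  (fun n => - (4 * (g + 1))^-1 * bessel_coeff (g + 1) n).
Proof.
move=> g0; apply/funext => n; rewrite /pseries_diffs /bessel_coeff.
rewrite big_ord_recl/= factS natrM exprS addr0.
have E : \prod_(i < n) (g + 1 + (bump 0 i)%:R) = \prod_(k < n) (g + 1 + 1 + k%:R).
  by apply: eq_bigr => k _; rewrite /bump/= natrD addrA.
rewrite E.
have q : \prod_(k < n) (g + 1 + 1 + k%:R) != 0.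
  apply/prodf_neq0 => k _; rewrite gt_eqF//.
  by have := ler0n R k; lra.
have p : g + 1 != 0 by rewrite gt_eqF//; lra.
have s : n.+1%:R != 0 :> R by rewrite pnatr_eq0.
have f : n`!%:R != 0 :> R by rewrite pnatr_eq0 -lt0n fact_gt0.
move: s f q; generalize (n.+1%:R : R) (n`!%:R : R); move=> s f s0 f0 q.
by field; rewrite p q s0 f0.
Qed.

Let pseriesZ c (f : nat -> R) u : pseries (fun n => c * f n) u = c *: pseries f u.
Proof.
apply/funext => N; rewrite /pseries /series/=.
transitivity (c * \sum_(0 <= k < N) f k * u ^+ k) => //.
by rewrite mulr_sumr; apply: eq_bigr => i _; rewrite mulrA.
Qed.

Let cvg_diffs g u : - (1 / 2) < g ->
  cvgn (pseries (pseries_diffs (bessel_coeff g)) u).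
Proof.
move=> g0; rewrite bessel_diffs// pseriesZ.
by apply: is_cvgZr; apply: is_cvg_bessel; lra.
Qed.

Let lim_diffs g u : - (1 / 2) < g ->
  limn (pseries (pseries_diffs (bessel_coeff g)) u) =
  - (4 * (g + 1))^-1 * bessel_sqr (g + 1) u.
Proof.
move=> g0; rewrite bessel_diffs// pseriesZ limZr//.
by apply: is_cvg_bessel; lra.
Qed.

Lemma is_derive_bessel_sqr g u : - (1 / 2) < g ->
  is_derive u 1 (bessel_sqr g) (- (4 * (g + 1))^-1 * bessel_sqr (g + 1) u).
Proof.
move=> g0; have g1 : - (1 / 2) < g + 1 by lra.
rewrite -lim_diffs//.
apply: (@pseries_snd_diffs _ (bessel_coeff g) (`|u| + 1)).
- exact: is_cvg_bessel.
- exact: cvg_diffs.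
- rewrite [pseries_diffs (bessel_coeff g)]bessel_diffs//.
  rewrite (_ : pseries_diffs _ = fun n => - (4 * (g + 1))^-1 *
    pseries_diffs (bessel_coeff (g + 1)) n); last first.
    by apply/funext => n; rewrite /pseries_diffs; ring.
  by rewrite pseriesZ; apply: is_cvgZr; exact: cvg_diffs.
- by rewrite [ltRHS]ger0_norm ?ltrDl// addr_ge0.
Qed.

(** Comparison of coefficients; the right-hand side is the derivative of
    the function of index g + 1, up to the factor u / (g + 1). *)
Lemma bessel_sqr_rec g u : - (1 / 2) < g ->
  bessel_sqr g u - bessel_sqr (g + 1) u =
  - u / (4 * (g + 1) * (g + 2)) * bessel_sqr (g + 2) u.
Proof.
move=> g0; have g1 : - (1 / 2) < g + 1 by lra.
have p : g + 1 != 0 by rewrite gt_eqF//; lra.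
have p2 : g + 2 != 0 by rewrite gt_eqF//; lra.
have E N : (g + 1) * (pseries (bessel_coeff g) u N.+1 -
    pseries (bessel_coeff (g + 1)) u N.+1) =
    u * pseries (pseries_diffs (bessel_coeff (g + 1))) u N.
  rewrite /pseries /series/= -sumrB big_nat_recl//= /bessel_coeff.
  rewrite !big_ord0 subrr add0r mulr_sumr [RHS]mulr_sumr.
  apply: eq_bigr => n _; rewrite /pseries_diffs/=.
  rewrite big_ord_recl/= addr0 [\prod_(k < n.+1) (g + 1 + 1 + _)]big_ord_recr/=.
  have -> : \prod_(i < n) (g + 1 + (bump 0 i)%:R) = \prod_(k < n) (g + 1 + 1 + k%:R).
    by apply: eq_bigr => k _; rewrite /bump/= natrD addrA.
  have q : \prod_(k < n) (g + 1 + 1 + k%:R) != 0.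
    apply/prodf_neq0 => k _; rewrite gt_eqF//.
    by have := ler0n R k; lra.
  have q2 : g + 1 + 1 + n%:R != 0 by rewrite gt_eqF//; have := ler0n R n; lra.
  rewrite factS natrM !exprS.
  have s : n.+1%:R != 0 :> R by rewrite pnatr_eq0.
  have sE : n.+1%:R = n%:R + 1 :> R by rewrite natr1.
  have f : n`!%:R != 0 :> R by rewrite pnatr_eq0 -lt0n fact_gt0.
  move: s sE f q q2.
  generalize (n.+1%:R : R) (n`!%:R : R) (n%:R : R) => s f m s0 sE f0 q q2.
  rewrite sE in s0 *.
  by field; rewrite p q q2 f0 s0.
have c1 := @is_cvg_bessel g u g0; have c2 := @is_cvg_bessel _ u g1.
have c3 := @cvg_diffs _ u g1.
have L : (g + 1) * (bessel_sqr g u - bessel_sqr (g + 1) u) =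
    u * (- (4 * (g + 1 + 1))^-1 * bessel_sqr (g + 1 + 1) u).
  rewrite -lim_diffs//.
  have K1 : (g + 1) * (pseries (bessel_coeff g) u N.+1 -
    pseries (bessel_coeff (g + 1)) u N.+1) @[N --> \oo] -->
    (g + 1) * (bessel_sqr g u - bessel_sqr (g + 1) u).
    apply: cvgMr; apply: cvgB.
      by rewrite (cvg_shiftS (pseries (bessel_coeff g) u)).
    by rewrite (cvg_shiftS (pseries (bessel_coeff (g + 1)) u)).
  have K2 : (g + 1) * (pseries (bessel_coeff g) u N.+1 -
    pseries (bessel_coeff (g + 1)) u N.+1) @[N --> \oo] -->
    u * limn (pseries (pseries_diffs (bessel_coeff (g + 1))) u).
    under eq_fun do rewrite E.
    exact: cvgMr.
  exact: (cvg_unique _ K1 K2).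
apply: (mulfI p); rewrite L -[g + 1 + 1]addrA.
have -> : g + (1 + 1) = g + 2 by ring.
by field; rewrite p p2.
Qed.

(** The normalised Bessel function j_g, even and entire, j_g(0) = 1. *)
Definition bessel g x := bessel_sqr g (x ^+ 2).

Lemma bessel0 g : bessel g 0 = 1.
Proof.
rewrite /bessel /bessel_sqr expr0n/=; apply/lim_near_cst => //.
exists 1%N => //= n n0; rewrite /pseries /series/=.
case: n n0 => // n _; rewrite big_nat_recl//= expr0 mulr1 big1.
  by rewrite /bessel_coeff expr0 big_ord0 mulr1 invr1 mul1r addr0.
by move=> i _; rewrite expr0n/= mulr0.
Qed.

Lemma bessel_even g x : bessel g (- x) = bessel g x.
Proof. by rewrite /bessel sqrrN. Qed.

Lemma is_derive_bessel g x : - (1 / 2) < g ->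
  is_derive x 1 (bessel g) (- (2 * g + 2)^-1 * x * bessel (g + 1) x).
Proof.
move=> g0; have p : g + 1 != 0 by rewrite gt_eqF//; lra.
have p2 : 2 * g + 2 != 0 by rewrite gt_eqF//; lra.
apply: deq (dcompo (dX 2 (did x)) (is_derive_bessel_sqr (x ^+ 2) g0)) _.
by rewrite /bessel/= expr1; field; rewrite p p2.
Qed.

(** This three-term relation is Bessel's equation with the derivatives written
    as functions of the next indices. *)
Lemma bessel_rec g x : - (1 / 2) < g ->
  bessel g x - bessel (g + 1) x =
  - x ^+ 2 / ((2 * g + 2) * (2 * g + 4)) * bessel (g + 2) x.
Proof.
move=> g0; rewrite /bessel bessel_sqr_rec//.
by congr (_ * _); field; rewrite !gt_eqF//; lra.
Qed.

Lemma continuous_bessel g : - (1 / 2) < g -> continuous (bessel g).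
Proof.
by move=> g0; apply: dcontT => x; exact: is_derive_bessel.
Qed.

(** The energy j^2 + j'^2 is nonincreasing on the half-line, by Bessel's
    equation j'' + (2g+1)/x j' + j = 0. *)
Lemma bessel_le1 g x : - (1 / 2) < g -> `|bessel g x| <= 1.
Proof.
move=> g0; have g1 : - (1 / 2) < g + 1 by lra.
pose c : R := (2 * g + 2)^-1.
have c0 : 0 < c by rewrite invr_gt0; lra.
have cE : c * (2 * g + 2) = 1 by rewrite mulVf// gt_eqF//; lra.
pose k (x : R) : R := - c * x * bessel (g + 1) x.
pose E x := bessel g x ^+ 2 + k x ^+ 2.
have dk (z : R) : is_derive z 1 k (- bessel g z + c * (2 * g + 1) * bessel (g + 1) z).
  have := dM (dZ (- c) (did z)) (is_derive_bessel z g1).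
  move=> /deq; apply.
  have := bessel_rec z g0; rewrite (_ : g + 1 + 1 = g + 2); last by ring.
  set A := bessel g z; set B := bessel (g + 1) z; set D := bessel (g + 2) z.
  move=> K; have -> : A = B + - z ^+ 2 / ((2 * g + 2) * (2 * g + 4)) * D.
    by rewrite -K; ring.
  rewrite /c; field; rewrite !gt_eqF//; lra.
have dE (z : R) : is_derive z 1 E (- (2 * (2 * g + 1) * c ^+ 2) * z * bessel (g + 1) z ^+ 2).
  apply: deq (dD (dX 2 (is_derive_bessel z g0)) (dX 2 (dk z))) _.
  by rewrite /= !expr1 /k -/c; ring.
wlog x0 : x / 0 <= x.
  move=> H; have [/H//|xn] := leP 0 x.
  by rewrite -bessel_even; apply: H; lra.
have cE' := dcontT dE.
have : E x <= E 0.
  apply: (@ler0_derive1_nincry _ E 0) => //.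
  - move=> y; rewrite in_itv/= andbT => y0.
    rewrite derive1E; case: (dE y) => _ ->.
    have := sqr_ge0 (bessel (g + 1) y); have := sqr_ge0 c => h1 h2.
    rewrite !mulNr oppr_le0; apply: mulr_ge0 => //.
    by apply: mulr_ge0; [apply: mulr_ge0 => //; lra|exact: ltW].
  - exact: continuous_subspaceT.
rewrite /E bessel0 /k mulr0 mul0r expr0n/= addr0 expr1n => K.
have : bessel g x ^+ 2 <= 1 by have := sqr_ge0 (k x); rewrite /k; lra.
by rewrite -(real_normK (num_real (bessel g x))) expr_le1.
Qed.

End bessel.

(** * The Hankel transform *)

Section hankel.
Variable R : realType.
Local Notation mu := (@lebesgue_measure R).
Local Notation integ f := (mu.-integrable setT (EFin \o f)).
Implicit Types (g u x l a b : R) (f phi psi chi : R -> R) (n : nat).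

Definition weight g x : R := `|x| `^ (2 * g + 1).

Lemma weight_ge0 g x : 0 <= weight g x.
Proof. exact: powR_ge0. Qed.

Lemma weightS g x : - (1 / 2) < g -> weight (g + 1) x = x ^+ 2 * weight g x.
Proof.
move=> g0; rewrite /weight -real_normK ?num_real// -powR_mulrn//.
rewrite -powRD; last by rewrite gt_eqF ?implyFb//; lra.
by congr (_ `^ _); ring.
Qed.

Lemma weight_even g x : weight g (- x) = weight g x.
Proof. by rewrite /weight normrN. Qed.

Lemma continuous_weight g : - (1 / 2) < g -> continuous (weight g).
Proof. by move=> g0; apply: continuous_abs_powR; lra. Qed.

Lemma measurable_weight g : measurable_fun setT (weight g).
Proof.
apply: (measurableT_comp (measurable_powR _)).
exact: normr_measurable.
Qed.

Lemma tempered_weight g : - (1 / 2) < g -> tempered (weight g).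
Proof. by move=> g0; apply: tempered_powR; lra. Qed.

(** The Dunkl transform of an even function; that of x phi is the same integral at
    index g + 1, up to the factor - i l / (2g + 2). *)
Definition hankel g phi l := \int[mu]_x (phi x * bessel g (l * x) * weight g x).

Let continuous_bes d l : - (1 / 2) < d -> continuous (fun x => bessel d (l * x)).
Proof.
move=> d0 x; apply: (@continuous_comp _ _ _ (fun x : R => l * x) (bessel d)).
  by apply: cvgM; [exact: cvg_cst|exact: cvg_id].
exact: continuous_bessel.
Qed.

Lemma integ_bessel g d l phi : - (1 / 2) < g -> - (1 / 2) < d ->
  measurable_fun setT phi -> rapid phi ->
  integ (fun x => phi x * bessel d (l * x) * weight g x).
Proof.
move=> g0 d0 mp rp; apply: rapid_integ.
  apply: measurable_funM; last exact: measurable_weight.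
  apply: measurable_funM => //; apply: continuous_measurable_fun.
  exact: continuous_bes.
apply: rapidM; last exact: tempered_weight.
apply: rapidM => //; apply: (@tempered_bounded _ _ 1) => x.
exact: bessel_le1.
Qed.

Lemma integ_hankel g l phi : - (1 / 2) < g -> even_schwartz phi ->
  integ (fun x => phi x * bessel g (l * x) * weight g x).
Proof.
move=> g0 hp; apply: integ_bessel => //; first exact: even_schwartz_measurable.
exact: even_schwartz_rapid.
Qed.

Lemma integ_weight g phi : - (1 / 2) < g -> measurable_fun setT phi ->
  rapid phi -> integ (fun x => phi x * weight g x).
Proof.
move=> g0 mp rp; apply: rapid_integ.
  by apply: measurable_funM => //; exact: measurable_weight.
by apply: rapidM => //; exact: tempered_weight.
Qed.

Lemma hankel_bounded g phi : - (1 / 2) < g -> even_schwartz phi ->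
  exists M : R, forall l, `|hankel g phi l| <= M.
Proof.
move=> g0 hp; have mp := even_schwartz_measurable hp.
have rp := even_schwartz_rapid hp.
have ip := integ_weight g0 mp rp.
exists (\int[mu]_x `|phi x * weight g x|) => l.
apply: norm_Rint_le; [exact: integ_hankel|exact: integrable_norm|].
move=> x; rewrite !normrM -mulrA ler_wpM2l// ler_piMl//.
exact: bessel_le1.
Qed.

Lemma hankel_even g phi l : hankel g phi (- l) = hankel g phi l.
Proof. by apply: eq_Rint => x; rewrite mulNr bessel_even. Qed.

Lemma hankel_lin g a b phi psi l : - (1 / 2) < g -> even_schwartz phi ->
  even_schwartz psi ->
  hankel g (fun x => a * phi x + b * psi x) l = a * hankel g phi l + b * hankel g psi l.
Proof.
move=> g0 hp hq; rewrite /hankel -!RintZ; try exact: integ_hankel.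
rewrite -RintD; try by apply: integZ; exact: integ_hankel.
by apply: eq_Rint => x; ring.
Qed.

Lemma hankelZ g a phi l : - (1 / 2) < g -> even_schwartz phi ->
  hankel g (fun x => a * phi x) l = a * hankel g phi l.
Proof.
move=> g0 hp; rewrite /hankel -RintZ; last exact: integ_hankel.
by apply: eq_Rint => x; ring.
Qed.

(** Differentiation under the integral sign raises the index by one, because
    j_g' = - x j_(g+1) / (2g + 2). *)
Lemma is_derive_hankel g phi l : - (1 / 2) < g -> even_schwartz phi ->
  is_derive l 1 (hankel g phi) (l * (- (2 * g + 2)^-1 * hankel (g + 1) phi l)).
Proof.
move=> g0 hp; have g1 : - (1 / 2) < g + 1 by lra.
have mp := even_schwartz_measurable hp; have rp := even_schwartz_rapid hp.
pose c : R := (2 * g + 2)^-1.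
pose f' z x := - c * (z * (phi x * bessel (g + 1) (z * x) * weight (g + 1) x)).
have i1 := integ_weight g1 mp rp.
apply: deq.
  apply: (@is_derive_Rint _ _ f' _
    (fun x => c * (`|l| + 1) * `|phi x * weight (g + 1) x|)).
  - by move=> z; exact: integ_hankel.
  - move=> z x; have d1 : is_derive z 1 (fun z => z * x) x.
      by apply: deq (dM (did z) (dcst x z)) _; rewrite mul1r mulr0 addr0.
    apply: deq (dM (dZ (phi x) (dcompo d1 (is_derive_bessel (z * x) g0)))
      (dcst (weight g x) z)) _.
    by rewrite /f' weightS// /c; ring.
  - by apply: integZ; exact: integrable_norm.
  - move=> z x zl; rewrite /f' !normrM normrN.
    have c0 : 0 <= c by rewrite invr_ge0; lra.
    rewrite (ger0_norm c0) -!mulrA ler_wpM2l//; apply: ler_pM => //.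
      by have := ler_normD (z - l) l; rewrite subrK; lra.
    by rewrite ler_wpM2l// ler_piMl// bessel_le1.
rewrite /f' RintZ; last by apply: integZ; exact: integ_hankel.
by rewrite RintZ; [rewrite /hankel/c; ring|exact: integ_hankel].
Qed.

(** The integrand is the derivative of phi(x) j_d(l x) |x|^(2g+1) x, which decays
    at both ends and is differentiable at 0 as well. *)
Let hankel_by_parts g d phi phi' l : - (1 / 2) < g -> - (1 / 2) < d ->
  even_schwartz phi -> even_schwartz phi' ->
  (forall x, is_derive x 1 phi (x * phi' x)) ->
  \int[mu]_x (((2 * g + 2) * phi x + x ^+ 2 * phi' x) * bessel d (l * x) * weight g x
    - (2 * d + 2)^-1 * l ^+ 2 *
      (x ^+ 2 * phi x * bessel (d + 1) (l * x) * weight g x)) = 0.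
Proof.
move=> g0 d0 hp hp' dp; have d1 : - (1 / 2) < d + 1 by lra.
have s0 : 0 < 2 * g + 1 by lra.
have cp := tower_continuous hp; have cp' := tower_continuous hp'.
have h1 : even_schwartz (fun x => (2 * g + 2) * phi x + x ^+ 2 * phi' x).
  apply: eq_tower (even_schwartz_lin (2 * g + 2) 1 hp (even_schwartz_sqr hp')) => x.
  by rewrite mul1r.
have h2 := even_schwartz_sqr hp.
pose F x := phi x * bessel d (l * x) * (weight g x * x).
have rF : rapid F.
  apply: rapidM; last by apply: temperedM; [exact: tempered_weight|exact: tempered_id].
  apply: rapidM; first exact: even_schwartz_rapid.
  by apply: (@tempered_bounded _ _ 1) => x; exact: bessel_le1.
have [C hC] := rF 1%N.
apply: (@Rint_derive_eq0 _ F _ C) => //.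
- move=> x.
  have e1 : is_derive x 1 (fun x => l * x) l.
    by apply: deq (dZ l (did x)) _; rewrite mulr1.
  apply: deq (dM (dM (dp x) (dcompo e1 (is_derive_bessel (l * x) d0)))
    (is_derive_abs_powRx x s0)) _.
  by rewrite /weight; ring.
- move=> x; apply: cvgB; apply: cvgM.
  + apply: cvgM; first exact: (tower_continuous h1).
    exact: continuous_bes.
  + exact: continuous_weight.
  + exact: cvg_cst.
  + apply: cvgM; last exact: continuous_weight.
    apply: cvgM; first exact: (tower_continuous h2).
    exact: continuous_bes.
- apply: integB.
    apply: integ_bessel => //; first exact: even_schwartz_measurable.
    exact: even_schwartz_rapid.
  apply: integZ; apply: integ_bessel => //; first exact: even_schwartz_measurable.
  exact: even_schwartz_rapid.
Qed.

(** Dual to the derivative of the transform: the derivation phi' / x lowers the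
    index. *)
Lemma hankel_derive g phi phi' l : - (1 / 2) < g ->
  even_schwartz phi -> even_schwartz phi' ->
  (forall x, is_derive x 1 phi (x * phi' x)) ->
  hankel (g + 1) phi' l = - (2 * g + 2) * hankel g phi l.
Proof.
move=> g0 hp hp' dp; have g1 : - (1 / 2) < g + 1 by lra.
have := hankel_by_parts l g0 g1 hp hp' dp.
have -> : \int[mu]_x (((2 * g + 2) * phi x + x ^+ 2 * phi' x) * bessel (g + 1) (l * x) * weight g x
    - (2 * (g + 1) + 2)^-1 * l ^+ 2 *
      (x ^+ 2 * phi x * bessel (g + 1 + 1) (l * x) * weight g x)) =
  \int[mu]_x (phi' x * bessel (g + 1) (l * x) * weight (g + 1) x +
    (2 * g + 2) * (phi x * bessel g (l * x) * weight g x)).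
  apply: eq_Rint => x; rewrite weightS//.
  have := bessel_rec (l * x) g0.
  have -> : g + 1 + 1 = g + 2 by ring.
  move=> K; have -> : bessel g (l * x) = bessel (g + 1) (l * x) +
     - (l * x) ^+ 2 / ((2 * g + 2) * (2 * g + 4)) * bessel (g + 2) (l * x).
    by rewrite -K; ring.
  by field; rewrite !gt_eqF//; lra.
rewrite RintD; [|exact: integ_hankel|by apply: integZ; exact: integ_hankel].
rewrite RintZ; last exact: integ_hankel.
by move=> /eqP; rewrite addr_eq0 mulNr => /eqP.
Qed.

(** Multiplication of the transform by l^2 is the transform of the Bessel operator
    - (2g+2) D - x^2 D^2, with D the derivation phi' / x. *)
Lemma hankel_sqr_mul g phi phi' phi'' l : - (1 / 2) < g ->
  even_schwartz phi -> even_schwartz phi' -> even_schwartz phi'' ->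
  (forall x, is_derive x 1 phi (x * phi' x)) ->
  (forall x, is_derive x 1 phi' (x * phi'' x)) ->
  l ^+ 2 * hankel g phi l =
  hankel g (fun x => - (2 * g + 2) * phi' x + -1 * (x ^+ 2 * phi'' x)) l.
Proof.
move=> g0 hp hp' hp'' dp dp'; have g1 : - (1 / 2) < g + 1 by lra.
have h2 := even_schwartz_sqr hp''.
have := hankel_by_parts l g0 g0 hp' hp'' dp'.
have c0 : 2 * g + 2 != 0 by rewrite gt_eqF//; lra.
have i1 : integ (fun x => ((2 * g + 2) * phi' x + x ^+ 2 * phi'' x) *
    bessel g (l * x) * weight g x).
  have := integ_hankel l g0 (even_schwartz_lin (2 * g + 2) 1 hp' h2).
  by apply: eq_integ => x; rewrite mul1r.
have i2 : integ (fun x => x ^+ 2 * phi' x * bessel (g + 1) (l * x) * weight g x).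
  by apply: eq_integ (integ_hankel l g1 hp') => x; rewrite weightS//; ring.
rewrite RintB//; last exact: integZ.
rewrite RintZ//.
have -> : \int[mu]_x (x ^+ 2 * phi' x * bessel (g + 1) (l * x) * weight g x) =
    hankel (g + 1) phi' l.
  by apply: eq_Rint => x; rewrite weightS//; ring.
rewrite (hankel_derive l g0 hp hp' dp) => K.
rewrite hankel_lin//.
have : \int[mu]_x (((2 * g + 2) * phi' x + x ^+ 2 * phi'' x) * bessel g (l * x) * weight g x) =
  (2 * g + 2) * hankel g phi' l + 1 * hankel g (fun x => x ^+ 2 * phi'' x) l.
  rewrite -hankel_lin//; apply: eq_Rint => x; ring.
move=> E; rewrite E in K.
have K2 : (2 * g + 2)^-1 * l ^+ 2 * (- (2 * g + 2) * hankel g phi l) =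
    - (l ^+ 2 * hankel g phi l) by field.
by rewrite K2 in K; lra.
Qed.

Let hankel_rapid_pow g phi n : - (1 / 2) < g -> even_schwartz phi ->
  exists M : R, forall l, (l ^+ 2) ^+ n * `|hankel g phi l| <= M.
Proof.
move=> g0; elim: n phi => [|n ih] phi hp.
  have [M hM] := hankel_bounded g0 hp.
  by exists M => l; rewrite expr0 mul1r.
have [_ [phi' hp' dp]] := tower_unfold hp.
have [_ [phi'' hp'' dp']] := tower_unfold hp'.
have [M hM] := ih _ (even_schwartz_lin (- (2 * g + 2)) (-1) hp' (even_schwartz_sqr hp'')).
exists M => l; have := hM l.
rewrite -(hankel_sqr_mul l g0 hp hp' hp'' dp dp') normrM.
by rewrite (ger0_norm (sqr_ge0 l)) mulrA -exprSr.
Qed.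

(** Each factor l^2 is absorbed by the Bessel operator, and transforms are
    bounded. *)
Lemma hankel_rapid g phi : - (1 / 2) < g -> even_schwartz phi -> rapid (hankel g phi).
Proof.
move=> g0 hp n; have [M hM] := hankel_rapid_pow n g0 hp.
have [N hN] := hankel_bounded g0 hp.
exists (2 ^+ n * (N + M)) => l.
apply: (@le_trans _ _ (2 ^+ n * (1 + (l ^+ 2) ^+ n) * `|hankel g phi l|)); last first.
  by rewrite -mulrA ler_wpM2l ?exprn_ge0// mulrDl mul1r lerD.
rewrite ler_wpM2r//.
have l0 := normr_ge0 l; have l2 : l ^+ 2 = `|l| ^+ 2 by rewrite real_normK// num_real.
have [l1|l1] := leP `|l| 1.
  apply: (@le_trans _ _ (2 ^+ n)).
    by rewrite lerXn2r ?nnegrE ?addr_ge0//; lra.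
  by rewrite ler_peMr ?exprn_ge0// lerDl exprn_ge0// sqr_ge0.
apply: (@le_trans _ _ (2 ^+ n * (l ^+ 2) ^+ n)).
  rewrite -exprMn; apply: lerXn2r.
  - by rewrite nnegrE addr_ge0.
  - by rewrite nnegrE; apply: mulr_ge0 => //; exact: sqr_ge0.
  - by rewrite l2; nra.
by rewrite ler_wpM2l ?exprn_ge0// lerDr.
Qed.

Lemma even_schwartz_hankel g phi : - (1 / 2) < g -> even_schwartz phi ->
  even_schwartz (hankel g phi).
Proof.
move=> g0 hp; apply: (@tower_coind _ id _ (fun h => exists a g (phi : R -> R),
  [/\ - (1 / 2) < g, even_schwartz phi & h = fun l => a * hankel g phi l])); last first.
  by exists 1, g, phi; split => //; apply/funext => x; rewrite mul1r.
move=> _ {g g0 phi hp} [a [g [phi [g0 hp ->]]]]; split.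
  split; first by move=> x; rewrite hankel_even.
  by apply: rapidZ; exact: hankel_rapid.
exists (fun l => (- a * (2 * g + 2)^-1) * hankel (g + 1) phi l).
  exists (- a * (2 * g + 2)^-1), (g + 1), phi; split => //; lra.
move=> l; apply: deq (dZ a (is_derive_hankel l g0 hp)) _.
by rewrite /=; ring.
Qed.

(** The transform exchanges multiplication by x^2 with the Bessel operator. *)
Lemma hankel_hankel_sqr g phi x : - (1 / 2) < g -> even_schwartz phi ->
  hankel g (hankel g (fun x => x ^+ 2 * phi x)) x =
  x ^+ 2 * hankel g (hankel g phi) x.
Proof.
move=> g0 hp; have g1 : - (1 / 2) < g + 1 by lra.
have g2 : - (1 / 2) < g + 1 + 1 by lra.
pose c : R := - (2 * g + 2)^-1; pose c' : R := - (2 * (g + 1) + 2)^-1.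
have e0 := even_schwartz_hankel g0 hp.
have e1 := even_schwartzZ c (even_schwartz_hankel g1 hp).
have e2 := even_schwartzZ c (even_schwartzZ c' (even_schwartz_hankel g2 hp)).
have d0 l := is_derive_hankel l g0 hp.
have d1 (l : R) : is_derive l 1 (fun l => c * hankel (g + 1) phi l)
    (l * (c * (c' * hankel (g + 1 + 1) phi l))).
  by apply: deq (dZ c (is_derive_hankel l g1 hp)) _; rewrite /c'; ring.
rewrite (hankel_sqr_mul x g0 e0 e1 e2 d0 d1).
congr (hankel g _ x); apply/funext => l.
have -> : - (2 * g + 2) * (c * hankel (g + 1) phi l) +
    -1 * (l ^+ 2 * (c * (c' * hankel (g + 1 + 1) phi l))) =
    1 * hankel (g + 1) phi l + (- c * c' * l ^+ 2) * hankel (g + 1 + 1) phi l.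
  generalize (hankel (g + 1) phi l) (hankel (g + 1 + 1) phi l) => u v.
  by rewrite /c; field; rewrite gt_eqF//; lra.
rewrite /hankel -!RintZ; try exact: integ_hankel.
rewrite -RintD; try by apply: integZ; exact: integ_hankel.
apply: eq_Rint => y; rewrite !weightS//.
have := bessel_rec (l * y) g0.
have -> : g + 1 + 1 = g + 2 by ring.
move=> K; have -> : bessel g (l * y) = bessel (g + 1) (l * y) +
   - (l * y) ^+ 2 / ((2 * g + 2) * (2 * g + 4)) * bessel (g + 2) (l * y).
  by rewrite -K; ring.
by rewrite /c /c'; field; rewrite !gt_eqF//; lra.
Qed.

(** The derivative of the transform and the transform of the derivative together
    give the transform y of the Gaussian the equation y' = - l y, which the
    Gaussian satisfies. *)
Lemma hankel_gaussian g l : - (1 / 2) < g ->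
  hankel g (@gaussian R) l = gauss_mass g * gaussian l.
Proof.
move=> g0; have hG := @even_schwartz_gaussian R.
have hG' := even_schwartzZ (-1) hG.
have g1 : - (1 / 2) < g + 1 by lra.
have dG (x : R) : is_derive x 1 (@gaussian R) (x * (-1 * gaussian x)).
  by apply: deq (is_derive_gaussian x) _; rewrite mulN1r.
have E y : hankel (g + 1) (@gaussian R) y = (2 * g + 2) * hankel g (@gaussian R) y.
  have := hankel_derive y g0 hG hG' dG; rewrite (hankelZ _ _ g1 hG) => K.
  by apply: oppr_inj; rewrite -mulN1r K mulNr.
(* The quotient of the transform by the Gaussian is constant. *)
pose q y := hankel g (@gaussian R) y * expR (y ^+ 2 / 2).
have dq (y : R) : is_derive y 1 q 0.
  have e1 : is_derive y 1 (fun y => y ^+ 2 / 2) y.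
    apply: deq (dM (dX 2 (did y)) (dcst 2^-1 y)) _.
    by rewrite /= expr1; field.
  apply: deq (dM (is_derive_hankel y g0 hG)
    (dcompo e1 (is_derive_expR (y ^+ 2 / 2)))) _.
  by rewrite E; field; rewrite gt_eqF//; lra.
have := is_derive_0_is_cst l 0 dq.
rewrite /q expr0n/= mul0r expR0 mulr1.
have -> : hankel g (@gaussian R) 0 = gauss_mass g.
  have [_ <-] := integ_gauss g0; apply: eq_Rint => x.
  by rewrite mul0r bessel0 mulr1.
by move=> <-; rewrite /gaussian -mulrA -expRD subrr expR0 mulr1.
Qed.

Lemma continuous_eq_off0 f phi : continuous f -> continuous phi ->
  (forall x, x != 0 -> f x = phi x) -> f =1 phi.
Proof.
move=> cf cp E x; have [->|/E//] := eqVneq x 0.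
have D0 : f y - phi y @[y --> 0^'] --> (0 : R).
  apply: cvg_near_cst; near=> y.
  by rewrite E ?subrr//; near: y; exact: nbhs_dnbhs_neq.
have D1 : f y - phi y @[y --> 0^'] --> f 0 - phi 0.
  by apply: cvgB; apply: cvg_within_filter; [exact: cf|exact: cp].
have K : f 0 - phi 0 = 0 by apply: (cvg_unique _ D1 D0).
by apply/eqP; rewrite -subr_eq0; apply/eqP.
Unshelve. all: by end_near. Qed.

(** Hankel inversion.  The square of the transform commutes with multiplication
    by x^2, so it multiplies every function by a fixed function: by Hadamard's
    lemma a function vanishing at a is (x^2 - a^2) times another one, hence its
    image vanishes at a.  The Gaussian, an eigenfunction without zeros,
    identifies the multiplier. *)
Theorem hankelK g phi x : - (1 / 2) < g -> even_schwartz phi ->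
  hankel g (hankel g phi) x = gauss_mass g ^+ 2 * phi x.
Proof.
move=> g0 hp; have hG := @even_schwartz_gaussian R.
have off0 a : a != 0 -> hankel g (hankel g phi) a = gauss_mass g ^+ 2 * phi a.
  move=> a0; have Ga : gaussian a != 0 by rewrite gt_eqF// expR_gt0.
  (* phi + c gaussian vanishes at a. *)
  pose c := - (phi a / gaussian a).
  have h1 := even_schwartz_lin 1 c hp hG.
  have v1 : 1 * phi a + c * gaussian a = 0 by rewrite /c; field.
  have [q hq qE] := even_schwartz_div a0 h1 v1.
  have hq2 := even_schwartz_sqr hq.
  have L f k : even_schwartz f -> even_schwartz k -> forall s t y : R,
      hankel g (hankel g (fun x => s * f x + t * k x)) y =
      s * hankel g (hankel g f) y + t * hankel g (hankel g k) y.
    move=> hf hk s t y; rewrite -hankel_lin//; try exact: even_schwartz_hankel.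
    by congr (hankel g _ y); apply/funext => z; rewrite hankel_lin.
  have := L _ _ hq2 hq 1 (- a ^+ 2) a.
  have -> : (fun x => 1 * (x ^+ 2 * q x) + - a ^+ 2 * q x) =
      (fun x => 1 * phi x + c * gaussian x).
    by apply/funext => z; rewrite qE; ring.
  rewrite (L _ _ hp hG) (hankel_hankel_sqr a g0 hq).
  have -> : hankel g (hankel g (@gaussian R)) a = gauss_mass g ^+ 2 * gaussian a.
    have -> : hankel g (@gaussian R) = (fun y => gauss_mass g * gaussian y).
      by apply/funext => y; rewrite (hankel_gaussian y g0).
    by rewrite (hankelZ _ _ g0 hG) (hankel_gaussian a g0) mulrA -expr2.
  have cG : c * gaussian a = - phi a by rewrite /c mulNr divfK.
  rewrite mulrCA cG.
  generalize (hankel g (hankel g phi) a) (hankel g (hankel g q) a).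
  by move=> u v; lra.
apply: (@continuous_eq_off0 (hankel g (hankel g phi)) (fun y => gauss_mass g ^+ 2 * phi y)) => //.
  exact: (tower_continuous (even_schwartz_hankel g0 (even_schwartz_hankel g0 hp))).
by move=> y; apply: cvgM; [exact: cvg_cst|exact: (tower_continuous hp)].
Qed.

End hankel.

(** * Moments and flatness at the origin *)

Section lizorkin.
Variable R : realType.
Local Notation mu := (@lebesgue_measure R).
Local Notation integ f := (mu.-integrable setT (EFin \o f)).
Implicit Types (g x l a b : R) (f h phi psi : R -> R) (n k : nat).

(** The even half of the Lizorkin space.  The odd half consists of the products
    x phi with phi in the even half of index g + 1. *)
Definition even_lizorkin g phi := even_schwartz phi /\
  forall k, \int[mu]_x (phi x * (x ^+ 2) ^+ k * weight g x) = 0.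

Lemma even_lizorkinS g phi : - (1 / 2) < g ->
  even_lizorkin g phi -> even_lizorkin (g + 1) phi.
Proof.
move=> g0 [hp m]; split => // k; rewrite -[RHS](m k.+1).
by apply: eq_Rint => x; rewrite weightS// (exprSr (x ^+ 2) k); ring.
Qed.

Lemma hankel0 g phi : hankel g phi 0 = \int[mu]_x (phi x * weight g x).
Proof. by apply: eq_Rint => x; rewrite mul0r bessel0 mulr1. Qed.

Let hankel_vanish k g phi : - (1 / 2) < g -> even_lizorkin g phi ->
  exists M : R, forall l, `|hankel g phi l| <= M * (l ^+ 2) ^+ k.
Proof.
elim: k g phi => [|k ih] g phi g0 lp; have [hp m] := lp.
  have [M hM] := hankel_bounded g0 hp.
  by exists M => l; rewrite expr0 mulr1.
have g1 : - (1 / 2) < g + 1 by lra.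
have [M hM] := ih _ _ g1 (even_lizorkinS g0 lp).
have c0 : 0 < (2 * g + 2)^-1 by rewrite invr_gt0; lra.
have H0 : hankel g phi 0 = 0.
  by rewrite hankel0 -[RHS](m 0%N); apply: eq_Rint => x; rewrite expr0 mulr1.
have hd l := is_derive_hankel l g0 hp.
have ch := dcontT hd.
exists ((2 * g + 2)^-1 * `|M|) => l.
wlog l0 : l / 0 <= l.
  move=> W; have [/W//|ln] := leP 0 l.
  by rewrite -hankel_even -sqrrN; apply: W; rewrite oppr_ge0 ltW.
have [c] := @MVT_segment R (hankel g phi) _ 0 l l0 (fun x _ => hd x)
  (continuous_subspaceT ch).
rewrite in_itv/= => /andP[c1 c2]; rewrite H0 !subr0 => ->.
rewrite !normrM normrN (gtr0_norm c0) (ger0_norm l0) (ger0_norm c1).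
have K : `|hankel (g + 1) phi c| <= `|M| * (l ^+ 2) ^+ k.
  apply: le_trans (hM c) _; apply: le_trans (ler_wpM2r _ (ler_norm M)) _.
    by rewrite exprn_ge0// sqr_ge0.
  by rewrite ler_wpM2l// lerXn2r ?nnegrE ?sqr_ge0// lerXn2r ?nnegrE.
rewrite exprS; move: K c1 c2 c0; move: ((2 * g + 2)^-1) (`|hankel (g + 1) phi c|)
  ((l ^+ 2) ^+ k) (normr_ge0 (hankel (g + 1) phi c)) => u v w v0 K c1 c2 c0.
have -> : u * `|M| * (l ^+ 2 * w) = l * (u * (`|M| * w)) * l by ring.
rewrite ler_wpM2r//; apply: ler_pM => //; first by rewrite mulr_ge0// ltW.
by rewrite ler_wpM2l// ltW.
Qed.

Let flat_rapidI f : rapid f ->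
  (forall k, exists M : R, forall x, `|f x| <= M * (x ^+ 2) ^+ k) -> flat_rapid f.
Proof.
move=> rf vf k n; have [M hM] := rf n; have [N hN] := vf k.
exists (`|M| + 2 ^+ n * `|N|) => x.
have x0 := normr_ge0 x; have p0 : 0 <= (1 + `|x|) ^+ n by rewrite exprn_ge0// addr_ge0.
have [x1|x1] := leP 1 `|x|.
  apply: le_trans (hM x) _; apply: le_trans (ler_norm M) _.
  apply: (@le_trans _ _ (`|M| * `|x| ^+ k)).
    by rewrite ler_peMr// exprn_ege1.
  by rewrite ler_wpM2r ?exprn_ge0// lerDl mulr_ge0// exprn_ge0.
apply: (@le_trans _ _ (2 ^+ n * (`|N| * `|x| ^+ k))); last first.
  by rewrite mulrA ler_wpM2r ?exprn_ge0// lerDr.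
apply: ler_pM => //.
  by rewrite lerXn2r ?nnegrE ?addr_ge0//; lra.
apply: le_trans (hN x) _; apply: le_trans (ler_wpM2r _ (ler_norm N)) _.
  by rewrite exprn_ge0// sqr_ge0.
rewrite ler_wpM2l// -(real_normK (num_real x)) -exprM mulnC exprM expr2.
by rewrite ler_piMl ?exprn_ge0// exprn_ile1// ltW.
Qed.

(** The values at 0 of the derivatives of the transform are, up to constants, the
    moments: a transform vanishes at 0 with the integral of the function, and its
    derivative is l times a transform of index g + 1, of which the moments are
    also zero. *)
Lemma hankel_flat g phi : - (1 / 2) < g -> even_lizorkin g phi ->
  flat_schwartz (hankel g phi).
Proof.
move=> g0 hp; apply: (@tower_coind _ id _ (fun h => exists a g (phi : R -> R),
  [/\ - (1 / 2) < g, even_lizorkin g phi & h = fun l => a * hankel g phi l])); last first.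
  by exists 1, g, phi; split => //; apply/funext => x; rewrite mul1r.
move=> _ {g g0 phi hp} [a [g [phi [g0 lp ->]]]]; have [hp _] := lp.
split.
  split; first by move=> x; rewrite hankel_even.
  have := flat_rapidM (flat_rapidI (hankel_rapid g0 hp)
    (fun k => hankel_vanish k g0 lp)) (tempered_cst a).
  by rewrite (_ : (fun x => _) = (fun x => a * hankel g phi x))//; apply/funext => x; rewrite mulrC.
exists (fun l => (- a * (2 * g + 2)^-1) * hankel (g + 1) phi l).
  exists (- a * (2 * g + 2)^-1), (g + 1), phi; split => //; first by lra.
  exact: even_lizorkinS.
move=> l; apply: deq (dZ a (is_derive_hankel l g0 hp)) _.
by rewrite /=; ring.
Qed.

Let flat_hankelS g psi : - (1 / 2) < g -> even_schwartz psi ->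
  flat_schwartz (hankel g psi) -> flat_schwartz (hankel (g + 1) psi).
Proof.
move=> g0 hp fh; have g1 : - (1 / 2) < g + 1 by lra.
have c0 : 2 * g + 2 != 0 by rewrite gt_eqF//; lra.
have [_ [f' hf' df]] := tower_unfold fh.
apply: eq_tower (flat_schwartzZ (- (2 * g + 2)) hf').
apply: continuous_eq_off0.
- move=> x; apply: cvgM; first exact: cvg_cst.
  exact: (tower_continuous hf').
- exact: (tower_continuous (even_schwartz_hankel g1 hp)).
move=> x x0; have := duniq (df x) (is_derive_hankel x g0 hp) => /(mulfI x0) ->.
by rewrite mulrA mulrNN mulfV// mul1r.
Qed.

(** The moment of degree 2k + 2 at index g is the moment of degree 2k at index
    g + 1, and the derivation passes flatness on to the transform of index g + 1. *)
Lemma flat_moments g psi : - (1 / 2) < g -> even_schwartz psi ->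
  flat_schwartz (hankel g psi) -> even_lizorkin g psi.
Proof.
move=> g0 hp fh; split => // k.
elim: k g g0 fh => [|k ih] g g0 fh.
  rewrite -[RHS](flat_rapid0 (flat_schwartz_rapid fh)) hankel0.
  by apply: eq_Rint => x; rewrite expr0 mulr1.
have g1 : - (1 / 2) < g + 1 by lra.
rewrite -[RHS](ih _ g1 (flat_hankelS g0 hp fh)).
by apply: eq_Rint => x; rewrite weightS// (exprSr (x ^+ 2) k); ring.
Qed.

(** By inversion the transform of the transform is a multiple of h. *)
Lemma hankel_lizorkin g h : - (1 / 2) < g -> flat_schwartz h ->
  even_lizorkin g (hankel g h).
Proof.
move=> g0 fh; have hh := flat_even_schwartz fh.
apply: flat_moments => //; first exact: even_schwartz_hankel.
apply: eq_tower (flat_schwartzZ (gauss_mass g ^+ 2) fh) => x.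
exact/esym/hankelK.
Qed.

Lemma measurable_bessel_prod g (u v : R -> R) : - (1 / 2) < g ->
  measurable_fun setT u -> measurable_fun setT v ->
  measurable_fun setT (fun z : R * R => u z.1 * bessel g (z.1 * z.2) * v z.2).
Proof.
move=> g0 mu' mv; apply: measurable_funM; first apply: measurable_funM.
- exact: (measurableT_comp mu').
- apply: (measurableT_comp (continuous_measurable_fun (continuous_bessel g0))).
  exact: measurable_funM.
- exact: (measurableT_comp mv).
Qed.

(** The kernel is symmetric, so this is Fubini's theorem. *)
Lemma hankel_sym g phi psi : - (1 / 2) < g -> even_schwartz phi -> even_schwartz psi ->
  \int[mu]_y (psi y * weight g y * hankel g phi y) =
  \int[mu]_x (phi x * weight g x * hankel g psi x).
Proof.
move=> g0 hp hq.
have mp := even_schwartz_measurable hp; have mq := even_schwartz_measurable hq.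
have ip := integ_weight g0 mp (even_schwartz_rapid hp).
have iq := integ_weight g0 mq (even_schwartz_rapid hq).
pose f y x := (psi y * weight g y) * bessel g (y * x) * (phi x * weight g x).
have ix y : integ (f y).
  apply: eq_integ (integZ (psi y * weight g y) (integ_hankel y g0 hp)) => x.
  by rewrite /f; ring.
have iy x : integ (fun y => f y x).
  apply: eq_integ (integZ (phi x * weight g x) (integ_hankel x g0 hq)) => y.
  by rewrite /f (mulrC y); ring.
pose G y := \int[mu]_x `|phi x * weight g x| * `|psi y * weight g y|.
have iG : integ G by apply: integZ; exact: integrable_norm.
have fG y : \int[mu]_x `|f y x| <= G y.
  rewrite /G mulrC -RintZ; last exact: integrable_norm.
  apply: Rint_le.
  - exact: integrable_norm.
  - by apply: integZ; exact: integrable_norm.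
  - move=> x; rewrite /f normrM [`|_ * bessel _ _|]normrM ler_wpM2r//.
    by rewrite ler_piMr// bessel_le1.
have [_ E] := Rint_fubini (measurable_bessel_prod g0 (integ_measurable iq)
  (integ_measurable ip)) ix iy fG iG.
transitivity (\int[mu]_y \int[mu]_x f y x).
  apply: eq_Rint => y; rewrite /hankel -RintZ; last exact: integ_hankel.
  by apply: eq_Rint => x; rewrite /f; ring.
rewrite E; apply: eq_Rint => x; rewrite /hankel -RintZ; last exact: integ_hankel.
by apply: eq_Rint => y; rewrite /f (mulrC y); ring.
Qed.

(** Symmetry of the transform combined with inversion. *)
Lemma hankel_plancherel g phi : - (1 / 2) < g -> even_schwartz phi ->
  \int[mu]_x (hankel g phi x ^+ 2 * weight g x) =
  gauss_mass g ^+ 2 * \int[mu]_x (phi x ^+ 2 * weight g x).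
Proof.
move=> g0 hp; have hh := even_schwartz_hankel g0 hp.
have mp := even_schwartz_measurable hp; have rp := even_schwartz_rapid hp.
have [M hM] := rapid_bounded rp.
rewrite -RintZ; last first.
  apply: integ_weight => //.
    exact: (measurableT_comp (exprn_measurable 2) mp).
  by apply: rapidM => //; exact: tempered_bounded hM.
transitivity (\int[mu]_y (hankel g phi y * weight g y * hankel g phi y)).
  by apply: eq_Rint => x; ring.
rewrite hankel_sym//; apply: eq_Rint => x; rewrite hankelK//.
by ring.
Qed.

End lizorkin.

(** * The Sonine transform on even functions *)

Section sonine.
Variable R : realType.
Local Notation mu := (@lebesgue_measure R).
Local Notation integ f := (mu.-integrable setT (EFin \o f)).
Implicit Types (al be g x l t v y : R) (f h phi psi : R -> R) (k n : nat).

Lemma sonine_a_gt0 al be : - (1 / 2) < al -> al < be -> 0 < sonine_a al be.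
Proof.
move=> a0 ab; rewrite divr_gt0 ?mulr_gt0// Gamma_gt0//; lra.
Qed.

Definition sonine_kernel al be t : R :=
  sonine_a al be * (tpow (be - al - 1) (1 - t ^+ 2) * weight al t).

Lemma sonine_kernel_ge0 al be t : - (1 / 2) < al -> al < be ->
  0 <= sonine_kernel al be t.
Proof.
move=> a0 ab; rewrite mulr_ge0 ?(ltW (sonine_a_gt0 _ _))//.
by rewrite mulr_ge0 ?tpow_ge0 ?weight_ge0.
Qed.

Lemma measurable_tpow_sqr s : measurable_fun setT (fun t : R => tpow s (1 - t ^+ 2)).
Proof.
apply: (measurableT_comp (measurable_tpow s)).
by apply: measurable_funB => //; exact: exprn_measurable.
Qed.

Lemma measurable_sonine_kernel al be : measurable_fun setT (sonine_kernel al be).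
Proof.
apply: measurable_funM => //; apply: measurable_funM; last exact: measurable_weight.
exact: measurable_tpow_sqr.
Qed.

Lemma weightn g n x : - (1 / 2) < g -> weight (g + n%:R) x = (x ^+ 2) ^+ n * weight g x.
Proof.
move=> g0; elim: n => [|n ih]; first by rewrite addr0 expr0 mul1r.
rewrite -(addn1 n) natrD addrA weightS; last by have := ler0n R n; lra.
by rewrite ih addn1 (exprSr (x ^+ 2)); ring.
Qed.

(** Moments of the kernel; they are Beta integrals in the variable t^2. *)
Lemma integ_sonine_moment al be n : - (1 / 2) < al -> al < be ->
  integ (fun t => (t ^+ 2) ^+ n * sonine_kernel al be t) /\
  \int[mu]_t ((t ^+ 2) ^+ n * sonine_kernel al be t) =
  (Gamma (be + 1) * Gamma (n%:R + al + 1)) / (Gamma (al + 1) * Gamma (n%:R + be + 1)).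
Proof.
move=> a0 ab; have n0 := ler0n R n.
have p0 : 0 < n%:R + al + 1 by lra.
have b0 : 0 < be - al by lra.
have [iB EB] := integ_beta p0 b0.
have [] := @integ_square R (beta_weight (n%:R + al + 1) (be - al))
  (measurable_beta_weight _ _) iB.
  by move=> v v0; rewrite /beta_weight tpow_npos ?mul0r.
have E t : beta_weight (n%:R + al + 1) (be - al) (t ^+ 2) * `|t| =
    tpow (be - al - 1) (1 - t ^+ 2) * ((t ^+ 2) ^+ n * weight al t).
  have s0 : 0 < 2 * (n%:R + al) + 1 by lra.
  rewrite /beta_weight addrK mulrAC tpow_sqr// mulrC -weightn//.
  by rewrite /weight (addrC al).
move=> i1 E1; have i2 := eq_integ E i1.
have F t : sonine_a al be * (tpow (be - al - 1) (1 - t ^+ 2) * ((t ^+ 2) ^+ n * weight al t)) =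
  (t ^+ 2) ^+ n * sonine_kernel al be t by rewrite /sonine_kernel; ring.
split; first exact: eq_integ F (integZ _ i2).
rewrite -(eq_Rint F) RintZ// -(eq_Rint E) -E1.
have e : n%:R + al + 1 + (be - al) = n%:R + be + 1 by ring.
rewrite e in EB; have G1 : Gamma (n%:R + be + 1) != 0 by apply: Gamma_neq0; lra.
have G2 : Gamma (be - al) != 0 by apply: Gamma_neq0; lra.
have G3 : Gamma (al + 1) != 0 by apply: Gamma_neq0; lra.
rewrite /sonine_a; move: EB G1 G2 G3.
move: (\int[mu]_s _) (Gamma _) (Gamma _) (Gamma _) (Gamma _) (Gamma _) => I p q r s t.
move=> EB r0 q0 s0; rewrite (_ : I = t * s / r); last by rewrite EB; field.
by field; rewrite ?r0 ?q0 ?s0.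
Qed.

Lemma integ_sonine_kernel al be : - (1 / 2) < al -> al < be ->
  integ (sonine_kernel al be).
Proof.
move=> a0 ab; have [+ _] := integ_sonine_moment 0 a0 ab.
by apply: eq_integ => t; rewrite expr0 mul1r.
Qed.

Lemma integ_sonine al be h : - (1 / 2) < al -> al < be ->
  measurable_fun setT h -> (exists M : R, forall x, `|h x| <= M) ->
  integ (fun t => h t * sonine_kernel al be t).
Proof.
move=> a0 ab mh [M hM].
apply: (integ_le _ (integZ M (integ_sonine_kernel a0 ab))).
  by apply: measurable_funM => //; exact: measurable_sonine_kernel.
move=> t; rewrite normrM (ger0_norm (sonine_kernel_ge0 _ _ _))//.
by rewrite ler_wpM2r// sonine_kernel_ge0.
Qed.

Lemma sonine_kernel_out al be t : 1 <= `|t| -> sonine_kernel al be t = 0.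
Proof.
move=> t1; rewrite /sonine_kernel tpow_npos ?mul0r ?mulr0//.
by rewrite subr_le0 -(real_normK (num_real t)) exprn_ege1.
Qed.

(** Sonine's integral, by termwise integration of the power series. *)
Lemma sonine_bessel al be y : - (1 / 2) < al -> al < be ->
  \int[mu]_t (bessel al (y * t) * sonine_kernel al be t) = bessel be y.
Proof.
move=> a0 ab; have b0 : - (1 / 2) < be by lra.
pose u N t := pseries (bessel_coeff al) ((y * t) ^+ 2) N.
have mu_ N : measurable_fun setT (u N).
  rewrite /u /pseries /series/=; apply: measurable_sum => k.
  apply: measurable_funM => //; apply: measurable_funX; apply: measurable_funX.
  exact: measurable_funM.
have bnd N t : `|u N t * sonine_kernel al be t| <= expR (y ^+ 2) * sonine_kernel al be t.
  rewrite normrM (ger0_norm (sonine_kernel_ge0 _ _ _))//.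
  have [t1|t1] := leP 1 `|t|; first by rewrite sonine_kernel_out// !mulr0.
  rewrite ler_wpM2r ?sonine_kernel_ge0//; apply: le_trans (bessel_partial_le _ _ a0) _.
  rewrite ler_expR ger0_norm ?sqr_ge0// exprMn ler_piMr ?sqr_ge0//.
  by rewrite -(real_normK (num_real t)) exprn_ile1// ltW.
have K : \int[mu]_t (u N t * sonine_kernel al be t) @[N --> \oo] -->
    \int[mu]_t (bessel al (y * t) * sonine_kernel al be t).
  apply: (@Rint_dominated _ _ _ (fun t => expR (y ^+ 2) * sonine_kernel al be t)).
  - by move=> N; apply: measurable_funM => //; exact: measurable_sonine_kernel.
  - apply: measurable_funM; last exact: measurable_sonine_kernel.
    apply: (measurableT_comp (continuous_measurable_fun (continuous_bessel a0))).
    exact: measurable_funM.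
  - by move=> t; apply: cvgMl; exact: is_cvg_bessel.
  - by apply: integZ; exact: integ_sonine_kernel.
  - exact: bnd.
have E N : \int[mu]_t (u N t * sonine_kernel al be t) =
    pseries (bessel_coeff be) (y ^+ 2) N.
  rewrite /u /pseries /series/=.
  elim: N => [|N ih].
    rewrite big_geq// -[RHS](Rint_odd (f := fun=> 0))//; last 2 first.
    - by move=> x; rewrite oppr0.
    - exact: integrable0.
    by apply: eq_Rint => t; rewrite big_geq// mul0r.
  rewrite big_nat_recr//= -ih.
  have [iN EN] := integ_sonine_moment N a0 ab.
  have -> : bessel_coeff be N * (y ^+ 2) ^+ N =
      \int[mu]_t (bessel_coeff al N * (y ^+ 2) ^+ N * ((t ^+ 2) ^+ N * sonine_kernel al be t)).
    rewrite RintZ// EN !bessel_coeff_Gamma//.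
    have n0 := ler0n R N.
    have G1 : Gamma (N%:R + be + 1) != 0 by apply: Gamma_neq0; lra.
    have G2 : Gamma (N%:R + al + 1) != 0 by apply: Gamma_neq0; lra.
    have G3 : Gamma (al + 1) != 0 by apply: Gamma_neq0; lra.
    have G4 : N`!%:R != 0 :> R by rewrite pnatr_eq0 -lt0n fact_gt0.
    move: G1 G2 G3 G4; move: (Gamma _) (Gamma _) (Gamma _) (Gamma _) (N`!%:R) => p q r s t.
    move: ((- 4^-1) ^+ N) ((y ^+ 2) ^+ N) => c w p0 q0 r0 t0.
    by field; rewrite ?p0 ?q0 ?r0 ?t0.
  rewrite -RintD; last 2 first.
  - apply: (integ_le _ (integZ (expR (y ^+ 2)) (integ_sonine_kernel a0 ab))).
      by apply: measurable_funM; [exact: mu_|exact: measurable_sonine_kernel].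
    exact: bnd.
  - exact: integZ.
  apply: eq_Rint => t; rewrite big_nat_recr//= mulrDl !exprMn.
  by congr (_ + _); ring.
rewrite (funext E) in K; exact: (cvg_unique _ K (@is_cvg_bessel _ be (y ^+ 2) b0)).
Qed.

End sonine.

(** * The Abel integral of an even function *)

Section dual.
Variable R : realType.
Local Notation mu := (@lebesgue_measure R).
Local Notation integ f := (mu.-integrable setT (EFin \o f)).
Implicit Types (al be b g x l t v y : R) (f h phi psi : R -> R) (k n : nat).

(** Up to a constant, the kernel of the dual transform on even functions; tpow
    restricts y to |y| > |x|. *)
Definition abel_kernel b x y : R := tpow (b - 1) (y ^+ 2 - x ^+ 2) * `|y|.

Lemma abel_kernel_ge0 b x y : 0 <= abel_kernel b x y.
Proof. by rewrite mulr_ge0 ?tpow_ge0. Qed.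

Lemma measurable_abel_kernel d (T : measurableType d) b (p q : T -> R) :
  measurable_fun setT p -> measurable_fun setT q ->
  measurable_fun setT (fun z => abel_kernel b (p z) (q z)).
Proof.
move=> mp mq; apply: measurable_funM.
  apply: (measurableT_comp (measurable_tpow (b - 1))).
  by apply: measurable_funB; apply: measurable_funX.
exact: (measurableT_comp (@normr_measurable R setT) mq).
Qed.

Let tail b v : R := tpow (b - 1) v * (1 + v ^+ 2) `^ (- (b + 1)).

Let measurable_tail b : measurable_fun setT (tail b).
Proof.
apply: measurable_funM; first exact: measurable_tpow.
apply: (measurableT_comp (measurable_powR _)).
by apply: measurable_funD => //; exact: exprn_measurable.
Qed.

(** The singularity at 0 is that of v^(b-1), and the second factor gives the decay
    at infinity. *)
Let integ_tail b : 0 < b -> integ (tail b).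
Proof.
move=> b0.
apply: (integ_le (measurable_tail b) (integD (@integ_tpow01 R (b - 1) _) (integ_inv_oneDsqr R))).
  by lra.
move=> v; rewrite /tail.
have s0 : 0 < 1 + v ^+ 2 by rewrite ltr_pwDl// sqr_ge0.
have i0 : 0 <= (1 + v ^+ 2)^-1 by rewrite invr_ge0 ltW.
have s1 : 1 <= 1 + v ^+ 2 by rewrite lerDl sqr_ge0.
rewrite ger0_norm; last by rewrite mulr_ge0 ?tpow_ge0 ?powR_ge0.
have [v0|v0] := leP v 0; first by rewrite (tpow_npos _ v0) !mul0r add0r.
have [v1|v1] := ltP v 1.
  rewrite (@tpowE _ 0 (1 - v)) ?subr_gt0// powRr0 mulr1.
  apply: (@le_trans _ _ (tpow (b - 1) v)); last by rewrite lerDl.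
  rewrite ler_piMr ?tpow_ge0//.
  rewrite powRN invf_le1 ?powR_gt0//.
  by rewrite -[leLHS](powRr0 (1 + v ^+ 2)); apply: ler_powR => //; lra.
apply: (@le_trans _ _ (1 + v ^+ 2)^-1); last first.
  by rewrite lerDr mulr_ge0 ?tpow_ge0.
rewrite tpowE// -(powR_inv1 (ltW s0)).
have -> : (- (b + 1)) = -1 + - b by ring.
rewrite (@powRD _ (1 + v ^+ 2)); last by rewrite (gt_eqF s0) implybT.
rewrite mulrCA ler_piMr ?powR_ge0//.
rewrite powRN ler_pdivrMr ?powR_gt0// mul1r.
apply: (@le_trans _ _ (v `^ b)); first by apply: ler_powR => //; lra.
by apply: ge0_ler_powR; rewrite ?nnegrE//; nra.
Qed.

(** Rapid decay of phi, spread over x and v in phi (sqrt (v + x^2)). *)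
Let tail_bound b phi n : 0 < b -> rapid phi -> exists M : R, forall x v, 0 < v ->
  (1 + `|x|) ^+ n * `|tpow (b - 1) v * phi (Num.sqrt (v + x ^+ 2))| <= M * tail b v.
Proof.
move=> b0 rp; pose m := (Num.truncn (b + 1)).+1.
have bm : b + 1 <= m%:R by exact/ltW/truncnS_gt.
have [M hM] := rp (n + 4 * m)%N; exists M => x v v0.
pose r := Num.sqrt (v + x ^+ 2).
have r0 : 0 <= r by exact: sqrtr_ge0.
have rE : r ^+ 2 = v + x ^+ 2 by rewrite sqr_sqrtr// addr_ge0 ?sqr_ge0// ltW.
have xr : `|x| <= r by rewrite -sqrtr_sqr ler_wsqrtr// lerDr ltW.
have := hM r; rewrite (ger0_norm r0) exprD -/r => K.
have s0 : 0 < 1 + v ^+ 2 by rewrite ltr_pwDl// sqr_ge0.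
have s1 : 1 <= 1 + v ^+ 2 by rewrite lerDl sqr_ge0.
have q0 : 0 < (1 + v ^+ 2) `^ (b + 1) by rewrite powR_gt0.
(* Since r^2 >= v, the fourth power of 1 + r dominates 1 + v^2. *)
have V : (1 + v ^+ 2) `^ (b + 1) <= (1 + r) ^+ (4 * m).
  apply: le_trans (ler_powR s1 bm) _; rewrite powR_mulrn; last exact: ltW.
  rewrite exprM.
  rewrite lerXn2r ?nnegrE ?exprn_ge0 ?addr_ge0 ?sqr_ge0//.
  have -> : (1 + r) ^+ 4 = (1 + 2 * r + r ^+ 2) ^+ 2 by ring.
  rewrite rE; have := sqr_ge0 x; nra.
have X : (1 + `|x|) ^+ n <= (1 + r) ^+ n.
  by rewrite lerXn2r ?nnegrE ?addr_ge0// lerD2l.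
rewrite /tail normrM (ger0_norm (tpow_ge0 _ _)) powRN mulrCA [leRHS]mulrCA.
rewrite ler_wpM2l ?tpow_ge0// ler_pdivlMr//.
apply: le_trans K; rewrite mulrAC ler_wpM2r// ler_pM// ?exprn_ge0 ?addr_ge0//.
exact: ltW.
Qed.

Let shift_abel b phi x : even_fun phi -> forall y,
  (fun v => tpow (b - 1) (v + - x ^+ 2) * phi (Num.sqrt v)) (y ^+ 2) * `|y| =
  abel_kernel b x y * phi y.
Proof.
move=> ep y; rewrite /= sqrtr_sqr /abel_kernel mulrAC; congr (_ * _).
by have [y0|y0] := leP 0 y; [rewrite ger0_norm|rewrite ltr0_norm// ep].
Qed.

Let measurable_shift b phi x : continuous phi ->
  measurable_fun setT (fun v => tpow (b - 1) (v + - x ^+ 2) * phi (Num.sqrt v)).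
Proof.
move=> cp; apply: measurable_funM.
  by apply: (measurableT_comp (measurable_tpow (b - 1))); exact: measurable_funD.
apply: continuous_measurable_fun => v.
apply: (@continuous_comp _ _ _ (@Num.sqrt R) phi); last exact: cp.
exact: sqrt_continuous.
Qed.

Let integ_spread b phi x : 0 < b -> continuous phi -> rapid phi ->
  integ (fun v => tpow (b - 1) v * phi (Num.sqrt (v + x ^+ 2))).
Proof.
move=> b0 cp rp; have [M hM] := tail_bound 0 b0 rp.
apply: (integ_le _ (integZ M (integ_tail b0))).
  have := subst_measurable (@subst_shift R (x ^+ 2)) (measurable_shift b x cp).
  by congr measurable_fun; apply/funext => v; rewrite addrK mulr1.
move=> v; have [v0|v0] := leP v 0; last by have := hM x v v0; rewrite expr0 mul1r.
by rewrite /tail tpow_npos// !mul0r mulr0 normr0.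
Qed.

Definition abel b phi x := \int[mu]_y (abel_kernel b x y * phi y).

(** The substitution v = y^2 - x^2, which turns the moving endpoint into the
    argument of phi. *)
Let abel_spread b phi x : 0 < b -> continuous phi -> rapid phi -> even_fun phi ->
  integ (fun y => abel_kernel b x y * phi y) /\
  abel b phi x = \int[mu]_v (tpow (b - 1) v * phi (Num.sqrt (v + x ^+ 2))).
Proof.
move=> b0 cp rp ep; have mh := measurable_shift b x cp.
have S := @subst_shift R (x ^+ 2).
have E v : (tpow (b - 1) (v + x ^+ 2 + - x ^+ 2) * phi (Num.sqrt (v + x ^+ 2))) * 1 =
    tpow (b - 1) v * phi (Num.sqrt (v + x ^+ 2)) by rewrite addrK mulr1.
have ih : integ (fun v => tpow (b - 1) (v + - x ^+ 2) * phi (Num.sqrt v)).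
  apply/(subst_integrable S mh).
  by apply: eq_integ (integ_spread x b0 cp rp) => v; rewrite E.
have [] := integ_square mh ih.
  move=> v v0; rewrite tpow_npos ?mul0r// -oppr_ge0 opprD opprK.
  by rewrite addr_ge0 ?oppr_ge0 ?sqr_ge0.
move=> i1 E1; split; first exact: eq_integ (shift_abel b x ep) i1.
rewrite /abel -(eq_Rint (shift_abel b x ep)) -E1 (subst_Rint S mh).
exact: eq_Rint.
Qed.

Lemma integ_abel b phi x : 0 < b -> even_schwartz phi ->
  integ (fun y => abel_kernel b x y * phi y).
Proof.
move=> b0 hp; apply: (abel_spread x b0 (tower_continuous hp) _ _).1.
  exact: even_schwartz_rapid.
exact: even_schwartz_even.
Qed.

Lemma abel_even b phi x : abel b phi (- x) = abel b phi x.
Proof. by apply: eq_Rint => y; rewrite /abel_kernel sqrrN. Qed.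

Let abel_rapid b phi : 0 < b -> even_schwartz phi -> rapid (abel b phi).
Proof.
move=> b0 hp; have cp := tower_continuous hp.
have rp := even_schwartz_rapid hp; have ep := even_schwartz_even hp.
move=> n; have [M hM] := tail_bound n b0 rp.
exists (\int[mu]_v (M * tail b v)) => x.
have [_ ->] := abel_spread x b0 cp rp ep.
have i1 := integ_spread x b0 cp rp.
rewrite -(ger0_norm (_ : 0 <= (1 + `|x|) ^+ n)) ?exprn_ge0 ?addr_ge0//.
rewrite -normrM -RintZ//; apply: norm_Rint_le; first exact: integZ.
  by apply: integZ; exact: integ_tail.
move=> v; have [v0|v0] := leP v 0.
  by rewrite /tail tpow_npos// !mul0r !mulr0 normr0.
by rewrite normrM ger0_norm ?exprn_ge0 ?addr_ge0//; exact: hM.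
Qed.

(** After the substitution the endpoint is fixed and x only occurs in
    phi (sqrt (v + x^2)); the inner derivative cancels the square root. *)
Lemma is_derive_abel b phi phi' x : 0 < b -> even_schwartz phi -> even_schwartz phi' ->
  (forall x, is_derive x 1 phi (x * phi' x)) ->
  is_derive x 1 (abel b phi) (x * abel b phi' x).
Proof.
move=> b0 hp hp' dp.
have cp := tower_continuous hp; have cp' := tower_continuous hp'.
have rp := even_schwartz_rapid hp; have ep := even_schwartz_even hp.
have rp' := even_schwartz_rapid hp'; have ep' := even_schwartz_even hp'.
have -> : abel b phi = fun x => \int[mu]_v (tpow (b - 1) v * phi (Num.sqrt (v + x ^+ 2))).
  by apply/funext => z; have [_] := abel_spread z b0 cp rp ep.
have [_ ->] := abel_spread x b0 cp' rp' ep'.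
rewrite -RintZ; last exact: integ_spread.
have [M hM] := tail_bound 0 b0 rp'.
apply: (@is_derive_Rint _ _ (fun x v => x * (tpow (b - 1) v * phi' (Num.sqrt (v + x ^+ 2)))) _
  (fun v => (`|x| + 1) * (M * tail b v))).
- by move=> z; exact: integ_spread.
- move=> z v; have [v0|v0] := leP v 0.
    rewrite tpow_npos// mul0r mulr0.
    by under eq_fun do rewrite mul0r; exact: dcst.
  have p0 : 0 < v + z ^+ 2 by rewrite ltr_pwDl// sqr_ge0.
  have d1 : is_derive z 1 (fun z => v + z ^+ 2) (2 * z).
    by apply: deq (dD (dcst v z) (dX 2 (did z))) _; rewrite /=; ring.
  have d2 := dcompo d1 (is_derive1_sqrt p0).
  apply: deq (dZ (tpow (b - 1) v) (dcompo d2 (dp (Num.sqrt (v + z ^+ 2))))) _.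
  have : Num.sqrt (v + z ^+ 2) != 0 by rewrite gt_eqF// sqrtr_gt0.
  by move: (Num.sqrt _) (tpow _ _) => r c r0; field.
- by apply: integZ; apply: integZ; exact: integ_tail.
- move=> z v zl; rewrite normrM; apply: ler_pM => //.
    by have := ler_normD (z - x) x; rewrite subrK; lra.
  have [v0|v0] := leP v 0; first by rewrite /tail tpow_npos// !mul0r mulr0 normr0.
  by have := hM z v v0; rewrite expr0 mul1r.
Qed.

(** The Abel integral commutes with the derivation phi' / x. *)
Lemma even_schwartz_abel b phi : 0 < b -> even_schwartz phi ->
  even_schwartz (abel b phi).
Proof.
move=> b0 hp; apply: (@tower_coind _ id _ (fun h => exists2 phi : R -> R,
  even_schwartz phi & h = abel b phi)); last by exists phi.
move=> _ {phi hp} [phi hp ->]; have [_ [phi' hp' dp]] := tower_unfold hp.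
split; first by split; [exact: abel_even|exact: abel_rapid].
exists (abel b phi'); first by exists phi'.
by move=> x; exact: is_derive_abel.
Qed.

End dual.

(** * Intertwining and inversion on even functions *)

Section transmutation.
Variable R : realType.
Local Notation mu := (@lebesgue_measure R).
Local Notation integ f := (mu.-integrable setT (EFin \o f)).
Implicit Types (al be b g x l t v y : R) (f h u phi psi : R -> R) (k n : nat).

Definition even_sonine al be phi x := \int[mu]_t (phi (x * t) * sonine_kernel al be t).

Definition even_dual al be phi x := sonine_a al be * abel (be - al) phi x.

Lemma even_schwartz_dual al be phi : al < be -> even_schwartz phi ->
  even_schwartz (even_dual al be phi).
Proof.
by move=> ab hp; apply: even_schwartzZ; apply: even_schwartz_abel => //; lra.
Qed.

(** The scaling x = y t exchanges the kernels of the two transforms. *)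
Let abel_scale al be u y : - (1 / 2) < al -> al < be ->
  measurable_fun setT u -> (forall x, `|u x| <= 1) ->
  integ (fun x => sonine_a al be * (abel_kernel (be - al) x y * (u x * weight al x))) /\
  \int[mu]_x (sonine_a al be * (abel_kernel (be - al) x y * (u x * weight al x))) =
    weight be y * \int[mu]_t (u (y * t) * sonine_kernel al be t).
Proof.
move=> a0 ab mu' u1.
pose h x := sonine_a al be * (abel_kernel (be - al) x y * (u x * weight al x)).
have mh : measurable_fun setT h.
  apply: measurable_funM => //; apply: measurable_funM.
    exact: measurable_abel_kernel.
  by apply: measurable_funM => //; exact: measurable_weight.
have [y0|y0] := eqVneq y 0.
  have h0 x : h x = 0.
    by rewrite /h y0 /abel_kernel normr0 mulr0 mul0r mulr0.
  have i0 : integ (fun=> 0 : R) by exact: integrable0.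
  split; first by apply: eq_integ i0 => x; rewrite -/(h x) h0.
  have w0 : weight be y = 0 by rewrite /weight y0 normr0 powR0// gt_eqF//; lra.
  rewrite w0 mul0r -/h -[RHS](Rint_odd (f := fun=> 0))//.
    exact: eq_Rint.
  by move=> x; rewrite oppr0.
have iu : integ (fun t => u (y * t) * sonine_kernel al be t).
  apply: integ_sonine => //; first exact: (measurableT_comp mu' (mulrl_measurable y)).
  by exists 1 => x.
have S := subst_scale y0.
have n0 : 0 < `|y| by rewrite normr_gt0.
have W : (y ^+ 2) `^ (be - al - 1) * `|y| ^+ 2 * `|y| `^ (2 * al + 1) = weight be y.
  rewrite -(real_normK (num_real y)) -!powR_mulrn// -powRrM.
  rewrite -!powRD; try by rewrite (gt_eqF n0) implybT.
  by rewrite /weight; congr (_ `^ _); ring.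
have E t : h (y * t) * `|y| = weight be y * (u (y * t) * sonine_kernel al be t).
  have -> : h (y * t) = sonine_a al be * (tpow (be - al - 1) (y ^+ 2 * (1 - t ^+ 2)) * `|y|
      * (u (y * t) * (`|y| `^ (2 * al + 1) * weight al t))).
    rewrite /h /abel_kernel {1}/weight normrM powRM//.
    by rewrite exprMn mulrBr mulr1.
  rewrite tpowM; last by rewrite exprn_even_gt0.
  rewrite -W /sonine_kernel.
  move: (_ `^ _) (_ `^ _) => p q; move: (sonine_a _ _) (tpow _ _) (weight _ _) => c d e.
  by ring.
split.
  apply/(subst_integrable S mh).
  by apply: eq_integ (integZ (weight be y) iu) => t; rewrite E.
rewrite -/h (subst_Rint S mh) -RintZ//; exact: eq_Rint.
Qed.

(** Fubini's theorem and the exchange of the two kernels by scaling reduce this to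
    Sonine's integral. *)
Lemma hankel_dual al be phi l : - (1 / 2) < al -> al < be -> even_schwartz phi ->
  hankel al (even_dual al be phi) l = hankel be phi l.
Proof.
move=> a0 ab hp; have b0 : 0 < be - al by lra.
have be0 : - (1 / 2) < be by lra.
have mp := even_schwartz_measurable hp; have rp := even_schwartz_rapid hp.
have mb : measurable_fun setT (fun x => bessel al (l * x)).
  apply: (measurableT_comp (continuous_measurable_fun (continuous_bessel a0))).
  exact: mulrl_measurable.
pose A := sonine_a al be.
pose f y x := phi y * (A * (abel_kernel (be - al) x y * (bessel al (l * x) * weight al x))).
have mf : measurable_fun setT (fun z : R * R => f z.1 z.2).
  apply: measurable_funM; first exact: (measurableT_comp mp).
  apply: measurable_funM => //; apply: measurable_funM.
    exact: measurable_abel_kernel.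
  by apply: measurable_funM; [exact: (measurableT_comp mb)|
    exact: (measurableT_comp (measurable_weight al))].
have B y := abel_scale y a0 ab mb (fun x => bessel_le1 (l * x) a0).
have one1 (x : R) : `|1 : R| <= 1 by rewrite normr1.
have D y := abel_scale y a0 ab (@measurable_cst _ _ R R setT 1) one1.
have ix y : integ (f y) by apply: integZ; exact: (B y).1.
have iy x : integ (f^~ x).
  apply: eq_integ (integZ (A * (bessel al (l * x) * weight al x)) (integ_abel x b0 hp)) => y.
  by rewrite /f; ring.
have iG : integ (fun y => `|phi y * weight be y|).
  by apply: integrable_norm; exact: integ_weight.
have fG y : \int[mu]_x `|f y x| <= `|phi y * weight be y|.
  have [iD ED] := D y.
  have E1 : \int[mu]_t (cst 1 (y * t) * sonine_kernel al be t) = 1.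
    rewrite -[RHS](bessel0 be) -[RHS](sonine_bessel 0 a0 ab).
    by apply: eq_Rint => t; rewrite mul0r bessel0.
  rewrite normrM (ger0_norm (weight_ge0 _ _)) -[weight be y]mulr1 -E1 -ED -RintZ//.
  apply: Rint_le; first exact: integrable_norm.
    exact: integZ.
  move=> x; rewrite /f normrM ler_wpM2l// normrM ger0_norm; last exact/ltW/sonine_a_gt0.
  rewrite ler_wpM2l ?(ltW (sonine_a_gt0 _ _))// normrM.
  rewrite (ger0_norm (abel_kernel_ge0 _ _ _)) ler_wpM2l ?abel_kernel_ge0//.
  rewrite normrM (ger0_norm (weight_ge0 _ _)) ler_wpM2r ?weight_ge0//.
  exact: bessel_le1.
have [_ E] := Rint_fubini mf ix iy fG iG.
transitivity (\int[mu]_x \int[mu]_y f y x).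
  apply: eq_Rint => x; rewrite /even_dual /abel.
  transitivity (A * (bessel al (l * x) * weight al x) *
      \int[mu]_y (abel_kernel (be - al) x y * phi y)); first by rewrite -mulrA mulrAC.
  rewrite -RintZ; last exact: integ_abel.
  by apply: eq_Rint => y; rewrite /f; ring.
rewrite -E; apply: eq_Rint => y; rewrite /f RintZ; last exact: (B y).1.
rewrite (B y).2 (eq_Rint (g := fun t => bessel al (l * y * t) * sonine_kernel al be t)).
  by rewrite (sonine_bessel (l * y) a0 ab) mulrA mulrAC.
by move=> t; rewrite mulrA.
Qed.

(** Fubini's theorem and Sonine's integral.  The power of |l| is the ratio of the
    two weights; it is harmless because h is flat. *)
Lemma sonine_hankel al be h x : - (1 / 2) < al -> al < be -> flat_schwartz h ->
  even_sonine al be (hankel al h) x =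
  hankel be (fun l => `|l| `^ (- (2 * (be - al))) * h l) x.
Proof.
move=> a0 ab fh; have hh := flat_even_schwartz fh.
have mh := even_schwartz_measurable hh.
have iw := integ_weight a0 mh (even_schwartz_rapid hh).
have ik := integ_sonine_kernel a0 ab.
pose f t l := sonine_kernel al be t * (bessel al (l * x * t) * (h l * weight al l)).
have mf : measurable_fun setT (fun z : R * R => f z.1 z.2).
  apply: measurable_funM; first exact: (measurableT_comp (measurable_sonine_kernel al be)).
  apply: measurable_funM; last exact: (measurableT_comp (integ_measurable iw)).
  apply: (measurableT_comp (continuous_measurable_fun (continuous_bessel a0))).
  by apply: measurable_funM => //; apply: measurable_funM.
have ix t : integ (f t).
  apply: eq_integ (integZ (sonine_kernel al be t) (integ_hankel (x * t) a0 hh)) => l.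
  by rewrite /f -(mulrA l) (mulrC l) -[h l * _ * _]mulrA [h l * (_ * _)]mulrCA.
have ib l : integ (fun t => bessel al (l * x * t) * sonine_kernel al be t).
  apply: (integ_sonine a0 ab); last by exists 1 => t; exact: bessel_le1.
  apply: (measurableT_comp (continuous_measurable_fun (continuous_bessel a0))).
  exact: mulrl_measurable.
have iy l : integ (f^~ l).
  apply: eq_integ (integZ (h l * weight al l) (ib l)) => t.
  by rewrite /f mulrC (mulrC (bessel _ _)) -mulrA.
pose C := \int[mu]_l `|h l * weight al l|.
have fG t : \int[mu]_l `|f t l| <= C * sonine_kernel al be t.
  rewrite mulrC -RintZ; last exact: integrable_norm.
  apply: Rint_le; first exact: integrable_norm.
    by apply: integZ; exact: integrable_norm.
  move=> l; rewrite /f normrM (ger0_norm (sonine_kernel_ge0 _ _ _))//.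
  rewrite ler_wpM2l ?sonine_kernel_ge0// normrM ler_piMl//.
  exact: bessel_le1.
have [_ E] := Rint_fubini mf ix iy fG (integZ C ik).
transitivity (\int[mu]_t \int[mu]_l f t l).
  apply: eq_Rint => t; rewrite /hankel mulrC -RintZ; last exact: integ_hankel.
  apply: eq_Rint => l.
  by rewrite /f -(mulrA l) (mulrC l) -[h l * _ * _]mulrA [h l * (_ * _)]mulrCA.
rewrite E; apply: eq_Rint => l.
transitivity (h l * weight al l * \int[mu]_t (bessel al (l * x * t) * sonine_kernel al be t)).
  rewrite -(RintZ _ (ib l)).
  by apply: eq_Rint => t; rewrite [RHS]mulrC (mulrC (bessel _ _) (sonine_kernel _ _ _)) -mulrA.
rewrite (sonine_bessel (l * x) a0 ab) (mulrC l x).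
have [->|l0] := eqVneq l 0.
  by rewrite (flat_rapid0 (flat_schwartz_rapid fh)) [_ `^ _ * 0]mulr0 !mul0r.
have -> : weight al l = `|l| `^ (- (2 * (be - al))) * weight be l.
  rewrite /weight -powRD; last by rewrite normr_eq0 (negbTE l0) implybT.
  by congr (_ `^ _); ring.
by move: (weight be l) (bessel be (x * l)) (_ `^ _) (h l) => W B P H; ring.
Qed.

(** * Fractional powers and inversion at each parity *)

(** The power (- Delta_g)^(s/2) on even functions. *)
Definition even_power g s phi x :=
  dunkl_c g * hankel g (fun l => `|l| `^ s * hankel g phi l) x.

Lemma dunkl_cE g : dunkl_c g = (gauss_mass g ^+ 2)^-1 :> R.
Proof. by rewrite /dunkl_c /gauss_mass div1r. Qed.

Lemma dunkl_c_gt0 g : - (1 / 2) < g -> 0 < dunkl_c g :> R.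
Proof. by move=> g0; rewrite dunkl_cE invr_gt0 exprn_gt0// gauss_mass_gt0. Qed.

Let dunkl_cK g : - (1 / 2) < g -> dunkl_c g * gauss_mass g ^+ 2 = 1 :> R.
Proof. by move=> g0; rewrite dunkl_cE mulVf// expf_neq0// gt_eqF// gauss_mass_gt0. Qed.

Lemma dunkl_cS g : - (1 / 2) < g ->
  dunkl_c (g + 1) = dunkl_c g / (2 * g + 2) ^+ 2 :> R.
Proof. by move=> g0; rewrite !dunkl_cE gauss_massS// exprMn invfM mulrC. Qed.

Let hankel_inv g phi x : - (1 / 2) < g -> even_schwartz phi ->
  phi x = dunkl_c g * hankel g (hankel g phi) x.
Proof. by move=> g0 hp; rewrite hankelK// mulrA dunkl_cK// mul1r. Qed.

Lemma even_lizorkin_dual al be phi : - (1 / 2) < al -> al < be ->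
  even_lizorkin be phi -> even_lizorkin al (even_dual al be phi).
Proof.
move=> a0 ab lp; have [hp _] := lp; apply: flat_moments => //.
  exact: even_schwartz_dual.
have be0 : - (1 / 2) < be by lra.
by apply: eq_tower (hankel_flat be0 lp) => l; rewrite hankel_dual.
Qed.

Let sonine_lizorkinE al be phi x : - (1 / 2) < al -> al < be -> even_lizorkin al phi ->
  even_sonine al be phi x = dunkl_c al *
  hankel be (fun l => `|l| `^ (- (2 * (be - al))) * hankel al phi l) x.
Proof.
move=> a0 ab lp; have [hp _] := lp; have fh := hankel_flat a0 lp.
have be0 : - (1 / 2) < be by lra.
rewrite -sonine_hankel// /even_sonine -RintZ; last first.
  apply: integ_sonine => //.
    apply: (measurableT_comp (even_schwartz_measurable (even_schwartz_hankel a0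
      (even_schwartz_hankel a0 hp)))); exact: mulrl_measurable.
  have [M hM] := hankel_bounded a0 (even_schwartz_hankel a0 hp).
  by exists M => t; exact: hM.
by apply: eq_Rint => t; rewrite {1}(hankel_inv (x * t) a0 hp) mulrA.
Qed.

Lemma even_lizorkin_sonine al be phi : - (1 / 2) < al -> al < be ->
  even_lizorkin al phi -> even_lizorkin be (even_sonine al be phi).
Proof.
move=> a0 ab lp; have [hp _] := lp; have be0 : - (1 / 2) < be by lra.
have fh := flat_schwartz_powR (- (2 * (be - al))) (hankel_flat a0 lp).
have := hankel_lizorkin be0 (flat_schwartzZ (dunkl_c al) fh).
congr even_lizorkin; apply/funext => x.
by rewrite sonine_lizorkinE// hankelZ//; exact: flat_even_schwartz.
Qed.

Lemma even_lizorkin_power g s phi : - (1 / 2) < g -> even_lizorkin g phi ->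
  even_lizorkin g (even_power g s phi).
Proof.
move=> g0 lp; have fh := flat_schwartz_powR s (hankel_flat g0 lp).
have := hankel_lizorkin g0 (flat_schwartzZ (dunkl_c g) fh).
congr even_lizorkin; apply/funext => x; rewrite hankelZ//.
exact: flat_even_schwartz.
Qed.

(** On the spectral side the dual transform is the identity from index be to index
    al, and the Sonine transform multiplies by |l|^(-2(be-al)); the power in
    between compensates this factor. *)
Lemma sonine_power_dual al be phi x : - (1 / 2) < al -> al < be -> even_lizorkin be phi ->
  dunkl_c be / dunkl_c al *
  even_sonine al be (even_power al (2 * (be - al)) (even_dual al be phi)) x = phi x.
Proof.
move=> a0 ab lp; have [hp _] := lp; have be0 : - (1 / 2) < be by lra.
have lq := even_lizorkin_dual a0 ab lp; have [hq _] := lq.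
have fh := hankel_flat a0 lq.
have c0 := dunkl_c_gt0 a0.
pose h l := `|l| `^ (2 * (be - al)) * hankel al (even_dual al be phi) l.
have fq : flat_schwartz h by exact: flat_schwartz_powR.
have -> : even_power al (2 * (be - al)) (even_dual al be phi) = hankel al (fun l => dunkl_c al * h l).
  by apply/funext => z; rewrite hankelZ//; exact: flat_even_schwartz.
rewrite sonine_hankel//; last exact: flat_schwartzZ.
have -> : (fun l => `|l| `^ (- (2 * (be - al))) * (dunkl_c al * h l)) =
    (fun l => dunkl_c al * hankel be phi l).
  apply/funext => l; rewrite mulrCA /h hankel_dual//; congr (_ * _).
  have [->|l0] := eqVneq l 0.
    by rewrite (flat_rapid0 (flat_schwartz_rapid (hankel_flat be0 lp))) !mulr0.
  by rewrite powRN mulKf// powR_eq0 normr_eq0 (negbTE l0).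
rewrite hankelZ//; last exact: even_schwartz_hankel.
by rewrite mulrA divfK ?gt_eqF// -hankel_inv.
Qed.

(** The same cancellation as in sonine_power_dual, in the other order. *)
Lemma dual_power_sonine al be phi x : - (1 / 2) < al -> al < be -> even_lizorkin al phi ->
  dunkl_c be / dunkl_c al *
  even_dual al be (even_power be (2 * (be - al)) (even_sonine al be phi)) x = phi x.
Proof.
move=> a0 ab lp; have [hp _] := lp; have be0 : - (1 / 2) < be by lra.
have lq := even_lizorkin_sonine a0 ab lp; have [hq _] := lq.
have fa := hankel_flat a0 lp.
have ca := dunkl_c_gt0 a0; have cb := dunkl_c_gt0 be0.
have fp := flat_schwartz_powR (- (2 * (be - al))) fa.
have hfa := flat_even_schwartz fa.
have E : even_power be (2 * (be - al)) (even_sonine al be phi) =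
    (fun z => dunkl_c al * hankel be (hankel al phi) z).
  have hs := flat_even_schwartz (flat_schwartz_powR (2 * (be - al)) (hankel_flat be0 lq)).
  apply/funext => z; apply: etrans (esym (hankelZ (dunkl_c be) z be0 hs)) _.
  apply: etrans _ (hankelZ (dunkl_c al) z be0 hfa).
  congr (hankel be _ z); apply/funext => l.
  have hfp := flat_even_schwartz fp.
  rewrite (funext (fun y => sonine_lizorkinE y a0 ab lp)).
  rewrite (hankelZ _ _ be0 (even_schwartz_hankel be0 hfp)) (hankelK _ be0 hfp).
  have K := dunkl_cK be0.
  have [->|l0] := eqVneq l 0.
    by rewrite (flat_rapid0 (flat_schwartz_rapid fa)) !mulr0.
  have p0 : `|l| `^ (2 * (be - al)) != 0 by rewrite powR_eq0 normr_eq0 (negbTE l0).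
  rewrite powRN; move: p0 K.
  move: (_ `^ _) (hankel _ _ _) (dunkl_c be) (dunkl_c al) (gauss_mass be ^+ 2) => p H c d m p0 K.
  by rewrite -[RHS]mul1r -K; field.
rewrite E; have hE : even_schwartz (fun z => dunkl_c al * hankel be (hankel al phi) z).
  by apply: even_schwartzZ; exact: even_schwartz_hankel.
have hD := even_schwartz_dual ab hE.
rewrite (hankel_inv x a0 hD).
have -> : hankel al (even_dual al be (fun z => dunkl_c al * hankel be (hankel al phi) z)) =
    (fun l => (dunkl_c al * gauss_mass be ^+ 2) * hankel al phi l).
  apply/funext => l; rewrite (hankel_dual _ a0 ab hE).
  by rewrite (hankelZ _ _ be0 (even_schwartz_hankel be0 hfa)) (hankelK _ be0 hfa) mulrA.
rewrite (hankelZ _ _ a0 hfa).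
have K := dunkl_cK be0; rewrite [RHS](hankel_inv x a0 hp).
move: ca K; move: (hankel _ _ _) (dunkl_c be) (dunkl_c al) (gauss_mass be ^+ 2) => H c d m d0 K.
by rewrite -[RHS]mul1r -K; field; rewrite gt_eqF.
Qed.

Lemma integ_weight_sqr g psi : - (1 / 2) < g -> even_schwartz psi ->
  integ (fun x => psi x ^+ 2 * weight g x).
Proof.
move=> g0 hs; have rs := even_schwartz_rapid hs; have ms := even_schwartz_measurable hs.
have [M hM] := rapid_bounded rs; apply: integ_weight => //.
  exact: (measurableT_comp (exprn_measurable 2) ms).
by apply: rapidM => //; exact: tempered_bounded hM.
Qed.

(** On the spectral side, |l|^(2(be-al)) |H phi|^2 against the weight of index al is
    |H phi|^2 against the weight of index be. *)
Lemma plancherel_power_dual al be phi : - (1 / 2) < al -> al < be -> even_lizorkin be phi ->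
  dunkl_c be / dunkl_c al *
  \int[mu]_x (even_power al (be - al) (even_dual al be phi) x ^+ 2 * weight al x) =
  \int[mu]_x (phi x ^+ 2 * weight be x).
Proof.
move=> a0 ab lp; have [hp _] := lp; have be0 : - (1 / 2) < be by lra.
have fb := hankel_flat be0 lp.
have ca := dunkl_c_gt0 a0; have cb := dunkl_c_gt0 be0.
pose h l := `|l| `^ (be - al) * hankel be phi l.
have fh : flat_schwartz h by exact: flat_schwartz_powR.
have hh := flat_even_schwartz fh.
have E x : even_power al (be - al) (even_dual al be phi) x ^+ 2 * weight al x =
    dunkl_c al ^+ 2 * (hankel al h x ^+ 2 * weight al x).
  rewrite /even_power (_ : (fun l => _) = h); last first.
    by apply/funext => l; rewrite hankel_dual.
  by ring.
rewrite (eq_Rint E) RintZ; last first.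
  by apply: integ_weight_sqr => //; exact: even_schwartz_hankel.
rewrite hankel_plancherel//.
have F l : h l ^+ 2 * weight al l = hankel be phi l ^+ 2 * weight be l.
  have [->|l0] := eqVneq l 0.
    by rewrite /h (flat_rapid0 (flat_schwartz_rapid fb)) mulr0 expr0n/= !mul0r.
  have n0 : 0 < `|l| by rewrite normr_gt0.
  have -> : weight be l = (`|l| `^ (be - al)) ^+ 2 * weight al l.
    rewrite -powR_mulrn// -powRrM /weight -powRD; last by rewrite (gt_eqF n0) implybT.
    by congr (_ `^ _); ring.
  by rewrite /h; ring.
rewrite (eq_Rint F) hankel_plancherel//.
have Ka := dunkl_cK a0; have Kb := dunkl_cK be0.
move: ca Ka Kb; move: (\int[mu]_x _) (dunkl_c be) (dunkl_c al) (gauss_mass be ^+ 2)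
  (gauss_mass al ^+ 2) => I c d m n d0 Kd Kc.
transitivity ((c * m) * (d * n) * I); last by rewrite Kc Kd !mul1r.
by field; rewrite gt_eqF.
Qed.

End transmutation.

(** * Complex functions and their even components *)

Section complex_valued.
Variable R : realType.
Local Open Scope complex_scope.
Local Notation mu := (@lebesgue_measure R).
Local Notation integ f := (mu.-integrable setT (EFin \o f)).
Implicit Types (f : R -> R[i]) (z : R[i]) (g l x y s : R) (n k : nat).

Lemma cabs_sqr z : cabs z ^+ 2 = complex.Re z ^+ 2 + complex.Im z ^+ 2.
Proof.
by case: z => a b; rewrite /cabs normc_def /= sqr_sqrtr// addr_ge0 ?sqr_ge0.
Qed.

Lemma cabs_ge0 z : 0 <= cabs z.
Proof. by case: z => a b; rewrite /cabs normc_def /= sqrtr_ge0. Qed.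

Lemma Re_le_cabs z : `|complex.Re z| <= cabs z.
Proof.
rewrite -(@ler_sqr R) ?nnegrE ?cabs_ge0// cabs_sqr real_normK ?num_real//.
by rewrite lerDl sqr_ge0.
Qed.

Lemma Im_le_cabs z : `|complex.Im z| <= cabs z.
Proof.
rewrite -(@ler_sqr R) ?nnegrE ?cabs_ge0// cabs_sqr real_normK ?num_real//.
by rewrite lerDr sqr_ge0.
Qed.

Lemma cabs_le z : cabs z <= `|complex.Re z| + `|complex.Im z|.
Proof.
rewrite -(@ler_sqr R) ?nnegrE ?cabs_ge0 ?addr_ge0// cabs_sqr.
rewrite -(real_normK (num_real (complex.Re z))) -(real_normK (num_real (complex.Im z))).
have := normr_ge0 (complex.Re z); have := normr_ge0 (complex.Im z).
by move: (`|_|) (`|_|) => a b a0 b0; nra.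
Qed.

Lemma smoothR_derive1n (h : R -> R) : smoothR h ->
  forall n x, derivable (derive1n n h) x 1.
Proof.
move=> hh n; elim: n h hh => [|n ih] h hh x.
  by have [_ [h' _ dh]] := tower_unfold hh; case: (dh x).
have [_ [h' hh' dh]] := tower_unfold hh.
rewrite /derive1n iterSr (_ : derive1 h = h'); first exact: ih.
apply/funext => y; have := dh y; rewrite mul1r derive1E.
by case=> _ ->.
Qed.

Lemma schwartzR_derive1n (h : R -> R) n : schwartzR h -> schwartzR (derive1n n h).
Proof.
elim: n h => [//|n ih] h hh; have [_ [h' hh' dh]] := tower_unfold hh.
rewrite /derive1n iterSr (_ : derive1 h = h'); first exact: ih.
by apply/funext => y; have := dh y; rewrite mul1r derive1E; case=> _ ->.
Qed.

(** Bounds on |x|^m |f^(n)| for all m are bounds on (1 + |x|)^m |f^(n)|. *)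
Lemma schwartz_Re_Im f : schwartz f <->
  schwartzR (fun x => complex.Re (f x)) /\ schwartzR (fun x => complex.Im (f x)).
Proof.
split=> [[sf bf]|[hr hi]].
  have K (u : R -> R) : (forall n x, derivable (derive1n n u) x 1) ->
      (forall m n : nat, exists M : R, forall x, `|x| ^+ m * `|derive1n n u x| <= M) ->
      schwartzR u.
    move=> du bu; apply: (@tower_coind _ (fun=> 1) _ (fun h => exists n, h = derive1n n u)).
      move=> _ [n ->]; split.
        move=> m; have [M hM] := bu m n; have [N hN] := bu 0%N n.
        exists (2 ^+ m * (M + N)) => x.
        have p : (1 + `|x|) ^+ m <= 2 ^+ m * (1 + `|x| ^+ m).
          have x0 := normr_ge0 x.
          have [x1|x1] := leP `|x| 1.
            apply: (@le_trans _ _ (2 ^+ m)).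
              by rewrite lerXn2r ?nnegrE ?addr_ge0//; lra.
            by rewrite ler_peMr ?exprn_ge0// lerDl exprn_ge0.
          apply: (@le_trans _ _ ((2 * `|x|) ^+ m)).
            by rewrite lerXn2r ?nnegrE ?addr_ge0 ?mulr_ge0//; lra.
          by rewrite exprMn ler_wpM2l ?exprn_ge0// lerDr.
        apply: le_trans (ler_wpM2r (normr_ge0 _) p) _.
        rewrite -mulrA ler_wpM2l ?exprn_ge0// mulrDl mul1r addrC.
        by apply: lerD => //; have := hN x; rewrite expr0 mul1r.
      exists (derive1n n.+1 u); first by exists n.+1.
      move=> x; rewrite mul1r /= derive1E; split => //; exact: du.
    by exists 0%N.
  split; apply: K.
  - by move=> n x; case: (sf n x).
  - move=> m n; have [M hM] := bf m n; exists M => x.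
    apply: le_trans (hM x); rewrite ler_wpM2l ?exprn_ge0//.
    exact: (Re_le_cabs (cderive1n n f x)).
  - by move=> n x; case: (sf n x).
  - move=> m n; have [M hM] := bf m n; exists M => x.
    apply: le_trans (hM x); rewrite ler_wpM2l ?exprn_ge0//.
    exact: (Im_le_cabs (cderive1n n f x)).
split.
  by move=> n x; split; apply: smoothR_derive1n; exact: schwartzR_smooth.
move=> m n.
have [M hM] := schwartzR_rapid (schwartzR_derive1n n hr) m.
have [N hN] := schwartzR_rapid (schwartzR_derive1n n hi) m.
exists (M + N) => x; apply: le_trans (lerD (hM x) (hN x)).
rewrite -mulrDr; apply: ler_pM; rewrite ?exprn_ge0 ?cabs_ge0//.
  by rewrite lerXn2r ?nnegrE ?addr_ge0// lerDr.
exact: (cabs_le (cderive1n n f x)).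
Qed.

(** A complex Schwartz function is encoded by four even functions, two for each of
    its real and imaginary parts. *)
Definition cpx (e1 o1 e2 o2 : R -> R) x : R[i] :=
  (e1 x + x * o1 x) +i* (e2 x + x * o2 x).

Lemma schwartz_cpx e1 o1 e2 o2 : even_schwartz e1 -> even_schwartz o1 ->
  even_schwartz e2 -> even_schwartz o2 -> schwartz (cpx e1 o1 e2 o2).
Proof.
by move=> h1 h2 h3 h4; apply/schwartz_Re_Im; split; exact: schwartzR_even_odd.
Qed.

Lemma schwartz_decomp f : schwartz f -> exists e1 o1 e2 o2 : R -> R,
  [/\ even_schwartz e1, even_schwartz o1, even_schwartz e2, even_schwartz o2 &
      f = cpx e1 o1 e2 o2].
Proof.
case/schwartz_Re_Im => /schwartzR_decomp [e1 [ o1 [h1 k1 E1]]].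
move=> /schwartzR_decomp [e2 [ o2 [h2 k2 E2]]]; exists e1, o1, e2, o2; split => //.
apply/funext => x; apply/eqP; rewrite eq_complex /= -E1 -E2.
by rewrite !eqxx.
Qed.

(** With an even weight absorbed in p and q, only the even part of e + x o
    contributes to the integral. *)
Lemma Rint_even_odd (p q : R -> R) : even_fun p -> even_fun q ->
  integ (fun x => p x) -> integ (fun x => x * q x) ->
  integ (fun x => p x + x * q x) /\
  \int[mu]_x (p x + x * q x) = \int[mu]_x p x.
Proof.
move=> ep eq ip iq; split; first exact: integD.
rewrite RintD// [X in _ + X](@Rint_odd R (fun x => x * q x)) ?addr0//.
  exact: integ_measurable.
by move=> x; rewrite eq mulNr.
Qed.

Let integ_xweight g (o : R -> R) n : - (1 / 2) < g -> even_schwartz o ->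
  integ (fun x => x ^+ n * (o x * weight g x)).
Proof.
move=> g0 ho; have mo := even_schwartz_measurable ho.
have t : tempered (fun x : R => x ^+ n).
  elim: n => [|n ih].
    by apply: (@tempered_bounded _ _ 1) => x; rewrite expr0 normr1.
  by have := temperedM (tempered_id R) ih; under eq_fun do rewrite -exprS.
apply: eq_integ (integ_weight (phi := fun x => o x * x ^+ n) g0 _ _).
- by move=> x; rewrite mulrAC mulrC.
- by apply: measurable_funM => //; exact: exprn_measurable.
- by apply: rapidM => //; exact: even_schwartz_rapid.
Qed.

Lemma moment_even g (e o : R -> R) k : - (1 / 2) < g -> even_schwartz e -> even_schwartz o ->
  \int[mu]_x ((e x + x * o x) * x ^+ (2 * k) * weight g x) =
  \int[mu]_x (e x * (x ^+ 2) ^+ k * weight g x).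
Proof.
move=> g0 he ho; have ee := even_schwartz_even he; have eo := even_schwartz_even ho.
have [] := @Rint_even_odd (fun x => e x * (x ^+ 2) ^+ k * weight g x)
  (fun x => o x * (x ^+ 2) ^+ k * weight g x).
- by move=> x; rewrite ee sqrrN weight_even.
- by move=> x; rewrite eo sqrrN weight_even.
- apply: eq_integ (integ_xweight (2 * k) g0 he) => x.
  by rewrite exprM; ring.
- apply: eq_integ (integ_xweight (2 * k).+1 g0 ho) => x.
  by rewrite exprS exprM; ring.
move=> _ <-; apply: eq_Rint => x; rewrite exprM; ring.
Qed.

Lemma moment_odd g (e o : R -> R) k : - (1 / 2) < g -> even_schwartz e -> even_schwartz o ->
  \int[mu]_x ((e x + x * o x) * x ^+ (2 * k).+1 * weight g x) =
  \int[mu]_x (o x * (x ^+ 2) ^+ k * weight (g + 1) x).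
Proof.
move=> g0 he ho; have ee := even_schwartz_even he; have eo := even_schwartz_even ho.
have [] := @Rint_even_odd (fun x => o x * (x ^+ 2) ^+ k * weight (g + 1) x)
  (fun x => e x * (x ^+ 2) ^+ k * weight g x).
- by move=> x; rewrite eo sqrrN weight_even.
- by move=> x; rewrite ee sqrrN weight_even.
- apply: eq_integ (integ_xweight (2 * k).+2 g0 ho) => x.
  by rewrite weightS// (exprS x (2 * k).+1) (exprS x (2 * k)) exprM; ring.
- apply: eq_integ (integ_xweight (2 * k).+1 g0 he) => x.
  by rewrite exprS exprM; ring.
move=> _ <-; apply: eq_Rint => x; rewrite weightS// exprS exprM; ring.
Qed.

(** Moments of even order see the even part only, and those of odd order see the
    odd part x o, where x^2 |x|^(2g+1) is the weight of index g + 1. *)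
Lemma lizorkin_cpx g e1 o1 e2 o2 : - (1 / 2) < g ->
  even_schwartz e1 -> even_schwartz o1 -> even_schwartz e2 -> even_schwartz o2 ->
  lizorkin g (cpx e1 o1 e2 o2) <->
  [/\ even_lizorkin g e1, even_lizorkin (g + 1) o1,
      even_lizorkin g e2 & even_lizorkin (g + 1) o2].
Proof.
move=> g0 h1 k1 h2 k2.
have E k : cint setT (fun y => cpx e1 o1 e2 o2 y * (y ^+ k)%:C * (`|y| `^ (2 * g + 1))%:C) =
    (\int[mu]_x ((e1 x + x * o1 x) * x ^+ k * weight g x)) +i*
    (\int[mu]_x ((e2 x + x * o2 x) * x ^+ k * weight g x)).
  rewrite /cint; congr (_ +i* _); apply: eq_Rint => x;
    by rewrite /cpx /weight /= ?mulr0 ?mul0r ?subr0 ?addr0 ?add0r.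
split=> [[_ m]|[[_ m1] [_ n1] [_ m2] [_ n2]]]; last first.
  split; first exact: schwartz_cpx.
  move=> k; rewrite E -[k]odd_double_half -mul2n.
  by case: (odd k); rewrite ?add0n ?add1n ?moment_even ?moment_odd// ?m1 ?m2 ?n1 ?n2.
have m' k := etrans (esym (E k)) (m k).
split; split => // k.
- by rewrite -(moment_even _ g0 h1 k1); have [-> _] := m' (2 * k)%N.
- by rewrite -(moment_odd _ g0 h1 k1); have [-> _] := m' (2 * k).+1.
- by rewrite -(moment_even _ g0 h2 k2); have [_ ->] := m' (2 * k)%N.
- by rewrite -(moment_odd _ g0 h2 k2); have [_ ->] := m' (2 * k).+1.
Qed.

(** On the imaginary axis the series has real terms, and the modified function
    becomes the oscillating one. *)
Let bessel_frakI_im g y : - (1 / 2) < g -> bessel_frakI g (0 +i* y) = (bessel g y)%:C.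
Proof.
move=> g0; have G0 : 0 < Gamma (g + 1) by rewrite Gamma_gt0//; lra.
have E N : \sum_(0 <= n < N) ((0 +i* y) / 2) ^+ (2 * n) /
      (n`!%:R * (Gamma (n%:R + g + 1))%:C) =
    ((Gamma (g + 1))^-1 * pseries (bessel_coeff g) (y ^+ 2) N)%:C.
  rewrite /pseries /series /= mulr_sumr rmorph_sum; apply: eq_bigr => n _.
  have -> : ((0 +i* y) / 2) ^+ (2 * n) = ((- 4^-1 * y ^+ 2) ^+ n)%:C.
    rewrite exprM rmorphXn; congr (_ ^+ n).
    have -> : (0 +i* y) = 'i * y%:C by apply/eqP; rewrite eq_complex /=; apply/andP; split; apply/eqP; ring.
    rewrite !exprMn sqr_i rmorphM rmorphXn rmorphN fmorphV rmorphMn rmorph1.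
    by field.
  have -> : n`!%:R = (n`!%:R)%:C :> R[i] by rewrite (rmorph_nat (real_complex R)).
  rewrite -rmorphM -fmorphV -rmorphM; congr (_%:C).
  rewrite bessel_coeff_Gamma// exprMn.
  have n0 := ler0n R n.
  have p1 : Gamma (n%:R + g + 1) != 0 by apply: Gamma_neq0; lra.
  have p2 : n`!%:R != 0 :> R by rewrite pnatr_eq0 -lt0n fact_gt0.
  move: p1 p2 (lt0r_neq0 G0).
  move: (Gamma _) (n`!%:R) (Gamma _) ((- 4^-1) ^+ n) ((y ^+ 2) ^+ n) => a b c d e a0 b0 c0.
  by field; rewrite ?a0 ?b0 ?c0.
rewrite /bessel_frakI /clim.
under [X in limn X +i* _]eq_fun do rewrite E /=.
under [X in _ +i* limn X]eq_fun do rewrite E /=.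
rewrite lim_cst//.
have -> : limn (fun n => (Gamma (g + 1))^-1 * pseries (bessel_coeff g) (y ^+ 2) n) =
    (Gamma (g + 1))^-1 * bessel g y.
  by apply/cvg_lim => //; apply: cvgMr; exact: is_cvg_bessel.
by rewrite -rmorphM mulVKf// gt_eqF.
Qed.

Lemma dunkl_kernel_im g y : - (1 / 2) < g ->
  dunkl_kernel g (0 +i* y) = bessel g y +i* ((2 * g + 2)^-1 * y * bessel (g + 1) y).
Proof.
move=> g0; have g1 : - (1 / 2) < g + 1 by lra.
rewrite /dunkl_kernel !bessel_frakI_im//.
have -> : 2 * (g + 1) = 2 * g + 2 by ring.
rewrite -fmorphV; move: (_^-1) (bessel _ _) (bessel _ _) => c a b.
by apply/eqP; rewrite eq_complex /=; apply/andP; split; apply/eqP; ring.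
Qed.

End complex_valued.

(** * The transforms on the even components *)

Section componentwise.
Variable R : realType.
Local Open Scope complex_scope.
Local Notation mu := (@lebesgue_measure R).
Local Notation integ f := (mu.-integrable setT (EFin \o f)).
Implicit Types (al be b c g l x y s t : R) (e o f h : R -> R) (n k : nat).

(** The kernels with the conventional value of 0 to the power s differ from
    the truncated ones at most on the boundary of the domain, a null set. *)
Let Rint_off2 (D : set R) f h c : measurable D ->
  measurable_fun setT f -> measurable_fun setT h ->
  (forall y, y != c -> y != - c -> (f \_ D) y = h y) ->
  Rintegral mu D f = \int[mu]_y h y.
Proof.
move=> mD mf mh E; rewrite Rintegral_mkcond /Rintegral; congr fine.
apply: ae_eq_integral => //.
- apply/measurable_EFinP; apply/(measurable_restrictT f mD).
  exact: measurable_funTS.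
- exact/measurable_EFinP.
have N z : mu.-negligible [set z].
  by apply/negligibleP => //; exact: lebesgue_measure_set1.
apply: negligibleS (negligibleU (N c) (N (- c))) => y /=.
move=> H; apply/or_asboolP; rewrite -[_ || _]negbK negb_or; apply/negP => /andP[y1 y2].
apply: H => _; rewrite E//; [apply/eqP|apply/eqP].
  by move=> yc; move: y1; rewrite asboolT.
by move=> yc; move: y2; rewrite asboolT.
Qed.

Lemma cpxZ c e1 o1 e2 o2 x : c%:C * cpx e1 o1 e2 o2 x =
  cpx (fun x => c * e1 x) (fun x => c * o1 x) (fun x => c * e2 x) (fun x => c * o2 x) x.
Proof.
apply/eqP; rewrite eq_complex /=; apply/andP.
by split; apply/eqP; ring.
Qed.

(** The odd terms integrate to zero; the product of the two factors x carries
    the weight to index g + 1. *)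
Let Rint_dunkl g l s (e o e' o' : R -> R) : - (1 / 2) < g -> even_schwartz e ->
  even_schwartz o -> even_schwartz e' -> even_schwartz o' ->
  \int[mu]_x ((bessel g (l * x) * (e x + x * o x) +
    s * x * bessel (g + 1) (l * x) * (e' x + x * o' x)) * weight g x) =
  hankel g e l + s * hankel (g + 1) o' l.
Proof.
move=> g0 he ho he' ho'; have g1 : - (1 / 2) < g + 1 by lra.
have ie := integ_hankel l g0 he; have io' := integ_hankel l g1 ho'.
have X (o1 : R -> R) d : - (1 / 2) < d -> even_schwartz o1 ->
    integ (fun x => x * (o1 x * bessel d (l * x) * weight g x)).
  move=> d0 h1; have m1 := even_schwartz_measurable h1.
  apply: eq_integ (integ_bessel (phi := fun x => o1 x * x) l g0 d0 _ _) => [x| |].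
  - by move: (o1 x) (bessel _ _) (weight _ _) => u v w; ring.
  - exact: measurable_funM.
  - by apply: rapidM; [exact: even_schwartz_rapid|exact: tempered_id].
have [] := @Rint_even_odd R (fun x => e x * bessel g (l * x) * weight g x +
    s * (o' x * bessel (g + 1) (l * x) * weight (g + 1) x))
  (fun x => o x * bessel g (l * x) * weight g x +
    s * (e' x * bessel (g + 1) (l * x) * weight g x)).
- by move=> x; rewrite mulrN !bessel_even !weight_even !(even_schwartz_even _ x).
- by move=> x; rewrite mulrN !bessel_even !weight_even !(even_schwartz_even _ x).
- by apply: integD => //; exact: integZ.
- apply: eq_integ (integD (X _ _ g0 ho) (integZ s (X _ _ g1 he'))) => x.
  by move: (o x) (e' x) (bessel _ _) (bessel _ _) (weight _ _) => u v w z p; ring.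
move=> _ E; rewrite (RintD ie (integZ s io')) (RintZ s io') in E.
apply: etrans _ E; apply: eq_Rint => x; rewrite (weightS _ g0).
move: (o x) (e' x) (e x) (o' x) (bessel _ _) (bessel _ _) (weight _ _) => u v w z p q r.
by ring.
Qed.

Lemma dunkl_transform_cpx g e1 o1 e2 o2 l : - (1 / 2) < g -> even_schwartz e1 ->
  even_schwartz o1 -> even_schwartz e2 -> even_schwartz o2 ->
  dunkl_transform g (cpx e1 o1 e2 o2) l =
  cpx (hankel g e1) (fun l => (2 * g + 2)^-1 * hankel (g + 1) o2 l)
      (hankel g e2) (fun l => - (2 * g + 2)^-1 * hankel (g + 1) o1 l) l.
Proof.
move=> g0 h1 k1 h2 k2.
have K x : dunkl_kernel g (- 'i * (l * x)%:C) =
    bessel g (l * x) +i* (- (2 * g + 2)^-1 * l * x * bessel (g + 1) (l * x)).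
  have -> : - 'i * (l * x)%:C = 0 +i* (- (l * x)).
    by apply/eqP; rewrite eq_complex /=; apply/andP; split; apply/eqP; ring.
  by rewrite dunkl_kernel_im// !bessel_even; congr (_ +i* _); rewrite mulrN !mulNr mulrA.
have Re := Rint_dunkl l ((2 * g + 2)^-1 * l) g0 h1 k1 h2 k2.
have Im := Rint_dunkl l (- (2 * g + 2)^-1 * l) g0 h2 k2 h1 k1.
apply: (@etrans _ _ ((hankel g e1 l + (2 * g + 2)^-1 * l * hankel (g + 1) o2 l) +i*
  (hankel g e2 l + - (2 * g + 2)^-1 * l * hankel (g + 1) o1 l))); last first.
  rewrite /cpx; move: (hankel _ _ _) (hankel _ _ _) (hankel _ _ _) (hankel _ _ _) => a b c d.
  by congr (_ +i* _); ring.
rewrite -Re -Im /dunkl_transform /cint; congr (_ +i* _); apply: eq_Rint => x.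
  rewrite K /cpx -/(weight g x) /=.
  move: (bessel _ _) (bessel _ _) (weight _ _) (_^-1) (e1 x) (o1 x) (e2 x) (o2 x) => a b c d p q r s.
  by ring.
rewrite K /cpx -/(weight g x) /=.
move: (bessel _ _) (bessel _ _) (weight _ _) (_^-1) (e1 x) (o1 x) (e2 x) (o2 x) => a b c d p q r s.
by ring.
Qed.

Lemma dunkl_inverseE g (f : R -> R[i]) x :
  dunkl_inverse g f x = (dunkl_c g)%:C * dunkl_transform g f (- x).
Proof.
have E l : - 'i * (- x * l)%:C = 'i * (l * x)%:C :> R[i].
  by apply/eqP; rewrite eq_complex /=; apply/andP; split; apply/eqP; ring.
rewrite /dunkl_inverse /dunkl_transform; apply: (congr1 (fun u => _ * cint setT u)).
by apply/funext => l; rewrite E.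
Qed.

(** Conjugating |l|^s by the Dunkl transform acts on the even and odd parts
    separately; the factor (2g+2)^-2 of the odd part is the ratio of the
    normalising constants at g + 1 and at g. *)
Lemma dunkl_multiplier g s e1 o1 e2 o2 : - (1 / 2) < g ->
  even_lizorkin g e1 -> even_lizorkin (g + 1) o1 ->
  even_lizorkin g e2 -> even_lizorkin (g + 1) o2 ->
  dunkl_inverse g (fun l => (`|l| `^ s)%:C * dunkl_transform g (cpx e1 o1 e2 o2) l) =
  cpx (even_power g s e1) (even_power (g + 1) s o1)
      (even_power g s e2) (even_power (g + 1) s o2).
Proof.
move=> g0 l1 m1 l2 m2; have g1 : - (1 / 2) < g + 1 by lra.
have [[h1 _] [k1 _] [h2 _] [k2 _]] := And4 l1 m1 l2 m2.
pose T d (phi : R -> R) l := `|l| `^ s * hankel d phi l.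
have F d phi : - (1 / 2) < d -> even_lizorkin d phi -> even_schwartz (T d phi).
  move=> d0 lp; apply: flat_even_schwartz; apply: flat_schwartz_powR.
  exact: hankel_flat.
have F1 := F _ _ g0 l1; have F2 := F _ _ g0 l2.
have G1 := F _ _ g1 m1; have G2 := F _ _ g1 m2.
pose k : R := (2 * g + 2)^-1.
have -> : (fun l => (`|l| `^ s)%:C * dunkl_transform g (cpx e1 o1 e2 o2) l) =
    cpx (T g e1) (fun l => k * T (g + 1) o2 l) (T g e2) (fun l => - k * T (g + 1) o1 l).
  apply/funext => l; rewrite (dunkl_transform_cpx l g0 h1 k1 h2 k2) cpxZ /cpx /T -/k.
  move: (hankel _ _ _) (hankel _ _ _) (hankel _ _ _) (hankel _ _ _) (_ `^ _) => a b c d p.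
  by congr (_ +i* _); ring.
have C : dunkl_c (g + 1) = dunkl_c g * k ^+ 2 by rewrite (dunkl_cS g0) exprVn.
have P d phi x : even_power d s phi x = dunkl_c d * hankel d (T d phi) x by [].
apply/funext => x; rewrite dunkl_inverseE.
rewrite (dunkl_transform_cpx (- x) g0 F1 (even_schwartzZ k G2) F2 (even_schwartzZ (- k) G1)).
rewrite cpxZ /cpx (hankelZ _ _ g1 G1) (hankelZ _ _ g1 G2) !hankel_even -/k.
rewrite (P g) (P g) (P (g + 1)) (P (g + 1)) C.
move: (hankel g (T g e1) x) (hankel g (T g e2) x) (hankel (g + 1) (T (g + 1) o1) x)
  (hankel (g + 1) (T (g + 1) o2) x) (dunkl_c g) => a b c d p.
by congr (_ +i* _); ring.
Qed.

(** Shifting both indices changes the constant by the factor that accompanies the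
    odd parts below. *)
Lemma sonine_aS al be : - (1 / 2) < al -> al < be ->
  sonine_a al be = (al + 1) / (be + 1) * sonine_a (al + 1) (be + 1).
Proof.
move=> a0 ab; have be0 : - (1 / 2) < be by lra.
rewrite /sonine_a (GammaS a0) (GammaS be0).
have -> : be + 1 - (al + 1) = be - al by ring.
have p1 : be + 1 != 0 by rewrite gt_eqF//; lra.
have p2 : al + 1 != 0 by rewrite gt_eqF//; lra.
have p3 : Gamma (be - al) != 0 by apply: Gamma_neq0; lra.
have p4 : Gamma (al + 1) != 0 by apply: Gamma_neq0; lra.
move: p3 p4; move: (Gamma _) (Gamma _) (Gamma _) => u v w u0 v0.
by field; rewrite ?p1 ?p2 ?u0 ?v0.
Qed.

Let sonine_kernelS al be t : - (1 / 2) < al -> al < be ->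
  t ^+ 2 * sonine_kernel al be t = (al + 1) / (be + 1) * sonine_kernel (al + 1) (be + 1) t.
Proof.
move=> a0 ab; rewrite /sonine_kernel (weightS _ a0) (sonine_aS a0 ab).
have -> : be + 1 - (al + 1) = be - al by ring.
move: (sonine_a _ _) (tpow _ _) (weight _ _) (_ / _) => u v w r.
by ring.
Qed.

(** Of the factor 1 + t, the even parts keep 1 and the odd parts keep t, which with
    the t of x t o (x t) makes t^2 and shifts both indices by one. *)
Let Rint_sonine al be e o x : - (1 / 2) < al -> al < be ->
  even_schwartz e -> even_schwartz o ->
  sonine_a al be * \int[mu]_(t in `[-1, 1]) ((e (x * t) + x * t * o (x * t)) *
    ((1 - t ^+ 2) `^ (be - al - 1) * (1 + t) * weight al t)) =
  even_sonine al be e x + x * ((al + 1) / (be + 1) * even_sonine (al + 1) (be + 1) o x).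
Proof.
move=> a0 ab he ho; have A0 := sonine_a_gt0 a0 ab.
have a1 : - (1 / 2) < al + 1 by lra.
have ab1 : al + 1 < be + 1 by lra.
have I al' be' (phi : R -> R) : - (1 / 2) < al' -> al' < be' -> even_schwartz phi ->
    integ (fun t => phi (x * t) * sonine_kernel al' be' t).
  move=> a0' ab' hp; apply: (integ_sonine a0' ab').
    apply: (measurableT_comp (even_schwartz_measurable hp)); exact: mulrl_measurable.
  have [M hM] := rapid_bounded (even_schwartz_rapid hp).
  by exists M => t; exact: hM.
have X (phi : R -> R) : even_schwartz phi ->
    integ (fun t => t * (phi (x * t) * sonine_kernel al be t)).
  move=> hp; apply: (integ_le _ (integrable_norm (I _ _ _ a0 ab hp))).
    by apply: measurable_funM => //; exact: integ_measurable (I _ _ _ a0 ab hp).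
  move=> t /=; have [t1|t1] := leP 1 `|t|; first by rewrite sonine_kernel_out// !mulr0.
  by rewrite normrM ler_piMl// ltW.
pose r := (al + 1) / (be + 1).
pose p t := e (x * t) * sonine_kernel al be t +
  (x * r) * (o (x * t) * sonine_kernel (al + 1) (be + 1) t).
pose q t := e (x * t) * sonine_kernel al be t + x * (o (x * t) * sonine_kernel al be t).
have ke al' be' t : sonine_kernel al' be' (- t) = sonine_kernel al' be' t.
  by rewrite /sonine_kernel sqrrN weight_even.
have [] := @Rint_even_odd R p q.
- by move=> t; rewrite /p mulrN !ke !(even_schwartz_even _ (x * t)).
- by move=> t; rewrite /q mulrN !ke !(even_schwartz_even _ (x * t)).
- by apply: integD; [exact: I|apply: integZ; exact: I].
- apply: eq_integ (integD (X _ he) (integZ x (X _ ho))) => t; rewrite /q.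
  by move: (e _) (o _) (sonine_kernel _ _ _) => u v w; ring.
move=> ipq Epq.
pose h t := (e (x * t) + x * t * o (x * t)) *
  (tpow (be - al - 1) (1 - t ^+ 2) * (1 + t) * weight al t).
have Eh t : h t = (sonine_a al be)^-1 * (p t + t * q t).
  have := sonine_kernelS t a0 ab; rewrite -/r /p /q /h => K.
  have -> : x * r * (o (x * t) * sonine_kernel (al + 1) (be + 1) t) =
      x * o (x * t) * (r * sonine_kernel (al + 1) (be + 1) t).
    by move: (o _) (sonine_kernel _ _ _) => u v; ring.
  rewrite -K /sonine_kernel; move: (lt0r_neq0 A0).
  move: (e _) (o _) (tpow _ _) (weight _ _) (sonine_a _ _) => u v w z c c0.
  by field.
have m1 (phi : R -> R) : even_schwartz phi -> measurable_fun setT (fun t => phi (x * t)).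
  move=> hp; apply: (measurableT_comp (even_schwartz_measurable hp)).
  exact: mulrl_measurable.
have m2 : measurable_fun setT (fun t : R => e (x * t) + x * t * o (x * t)).
  apply: measurable_funD; first exact: m1.
  apply: measurable_funM; first exact: mulrl_measurable.
  exact: m1.
have m3 : measurable_fun setT (fun t : R => 1 + t) by exact: measurable_funD.
have mh : measurable_fun setT h.
  apply: measurable_funM => //; apply: measurable_funM; last exact: measurable_weight.
  by apply: measurable_funM => //; exact: measurable_tpow_sqr.
rewrite (@Rint_off2 _ _ h 1)//.
- rewrite (eq_Rint Eh) (RintZ _ ipq) Epq mulVKf ?gt_eqF//.
  rewrite /p (RintD (I _ _ _ a0 ab he) (integZ (x * r) (I _ _ _ a1 ab1 ho))).
  by rewrite (RintZ _ (I _ _ _ a1 ab1 ho)) -mulrA.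
- apply: measurable_funM => //; apply: measurable_funM; last exact: measurable_weight.
  apply: measurable_funM => //; apply: (measurableT_comp (measurable_powR _)).
  by apply: measurable_funB => //; exact: exprn_measurable.
move=> t t1 t2; rewrite patchE /h; case: ifPn.
  rewrite inE/= in_itv/= => /andP[t3 t4]; rewrite tpowE//.
  have : - 1 < t by rewrite lt_neqAle eq_sym t2.
  have : t < 1 by rewrite lt_neqAle t1.
  by nra.
move=> tD; rewrite tpow_npos ?mul0r ?mulr0// leNgt; apply: contra tD => tD.
by rewrite inE/= in_itv/=; apply/andP; split; nra.
Qed.

Lemma sonine_cpx al be e1 o1 e2 o2 : - (1 / 2) < al -> al < be ->
  even_schwartz e1 -> even_schwartz o1 -> even_schwartz e2 -> even_schwartz o2 ->
  sonine al be (cpx e1 o1 e2 o2) =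
  cpx (even_sonine al be e1) (fun x => (al + 1) / (be + 1) * even_sonine (al + 1) (be + 1) o1 x)
      (even_sonine al be e2) (fun x => (al + 1) / (be + 1) * even_sonine (al + 1) (be + 1) o2 x).
Proof.
move=> a0 ab h1 k1 h2 k2; apply/funext => x.
rewrite /cpx -(Rint_sonine x a0 ab h1 k1) -(Rint_sonine x a0 ab h2 k2).
rewrite /sonine /cint /cpx.
move: (sonine_a al be) => c.
apply: (@etrans _ _ (c * \int[mu]_(t in `[-1, 1]) complex.Re (((e1 (x * t) + x * t * o1 (x * t)) +i*
  (e2 (x * t) + x * t * o2 (x * t))) * ((1 - t ^+ 2) `^ (be - al - 1) * (1 + t) * weight al t)%:C) +i*
  (c * \int[mu]_(t in `[-1, 1]) complex.Im (((e1 (x * t) + x * t * o1 (x * t)) +i*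
  (e2 (x * t) + x * t * o2 (x * t))) * ((1 - t ^+ 2) `^ (be - al - 1) * (1 + t) * weight al t)%:C)))).
  rewrite /weight; move: (\int[mu]_(t in _) _) (\int[mu]_(t in _) _) => I J.
  by apply/eqP; rewrite eq_complex /=; apply/andP; split; apply/eqP; ring.
by congr (c * _ +i* (c * _)); apply: (congr1 (fun u => Rintegral mu _ u)); apply/funext => t /=;
  rewrite !mulr0 ?subr0 ?add0r.
Qed.

Let measurable_sg : measurable_fun setT (fun y : R => Num.sg y).
Proof.
have -> : (fun y : R => Num.sg y) = (fun y => if 0 < y then 1 else if y < 0 then -1 else 0).
  apply/funext => y; have [y0|y0|->] := ltgtP y 0; last by rewrite sgr0.
    by rewrite ltr0_sg.
  by rewrite gtr0_sg.
apply: measurable_fun_ifT => //.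
  by apply: measurable_fun_ltr => //; exact: measurable_id.
apply: measurable_fun_ifT => //.
by apply: measurable_fun_ltr => //; exact: measurable_id.
Qed.

(** The sign turns the factor y of x + y, or that of y o (y), into |y|; the two
    other products are odd. *)
Let Rint_dual al be e o x : - (1 / 2) < al -> al < be ->
  even_schwartz e -> even_schwartz o ->
  sonine_a al be * \int[mu]_(y in [set y : R | `|x| <= `|y|])
    (Num.sg y * (y ^+ 2 - x ^+ 2) `^ (be - al - 1) * (x + y) * (e y + y * o y)) =
  even_dual al be e x + x * ((al + 1) / (be + 1) * even_dual (al + 1) (be + 1) o x).
Proof.
move=> a0 ab he ho; have b0 : 0 < be - al by lra.
have me := even_schwartz_measurable he; have mo := even_schwartz_measurable ho.
have ie := integ_abel x b0 he; have io := integ_abel x b0 ho.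
have iy := integ_abel x b0 (even_schwartz_sqr ho).
pose k y := tpow (be - al - 1) (y ^+ 2 - x ^+ 2).
have mk : measurable_fun setT k.
  apply: (measurableT_comp (measurable_tpow _)).
  by apply: measurable_funB => //; exact: exprn_measurable.
pose h y := Num.sg y * k y * (x + y) * (e y + y * o y).
pose p y := abel_kernel (be - al) x y * e y + x * (abel_kernel (be - al) x y * o y).
pose q y := k y * Num.sg y * (x * e y + y ^+ 2 * o y).
have ip : integ p by apply: integD => //; exact: integZ.
have mq : measurable_fun setT q.
  apply: measurable_funM; first exact: measurable_funM.
  apply: measurable_funD; first exact: measurable_funM.
  by apply: measurable_funM => //; exact: exprn_measurable.
have iq : integ q.
  apply: (integ_le mq (integD (integrable_norm ie)
    (integD (integrable_norm io) (integrable_norm iy)))) => y /=.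
  rewrite /q /abel_kernel -/(k y) !normrM !normr_id (ger0_norm (tpow_ge0 _ _ : 0 <= k y)).
  have [xy|xy] := leP (y ^+ 2 - x ^+ 2) 0.
    by rewrite /k (tpow_npos _ xy) !mul0r !addr0.
  (* Where the kernel does not vanish |x| is at most |y|, which supplies the factor |y|. *)
  have xy' : `|x| <= `|y| by rewrite -ler_sqr ?nnegrE// !real_normK ?num_real//; lra.
  have s1 : `|Num.sg y| <= 1 by rewrite normr_sg; case: (_ == _).
  rewrite -!mulrA -!mulrDr; apply: ler_wpM2l; first exact: tpow_ge0.
  apply: le_trans (ler_wpM2r (normr_ge0 _) s1) _; rewrite mul1r.
  apply: le_trans (ler_normD _ _) _; rewrite !normrM mulrDr; apply: lerD.
    exact: ler_wpM2r.
  have := normr_ge0 (o y); have := normr_ge0 y.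
  move: (`|y|) (`|o y|) => u v u0 v0; rewrite ler_wpM2l//.
  have u1 : 0 <= u ^+ 2 - u + 1 by have := sqr_ge0 (u - 1); nra.
  by have := mulr_ge0 v0 u1; lra.
have Eh y : h y = p y + q y.
  have n : `|y| = Num.sg y * y by exact: normrEsg.
  rewrite /h /p /q /abel_kernel -/(k y) n.
  by move: (Num.sg y) (k y) (e y) (o y) => s u v w; ring.
have Iq : \int[mu]_y q y = 0.
  apply: Rint_odd => // y.
  by rewrite /q /k sgrN !(even_schwartz_even _ y)// sqrrN; ring.
have mh : measurable_fun setT h.
  apply: measurable_funM; first apply: measurable_funM.
  - exact: measurable_funM.
  - exact: measurable_funD.
  - by apply: measurable_funD => //; exact: measurable_funM.
have a1 : even_dual (al + 1) (be + 1) o x = sonine_a (al + 1) (be + 1) * abel (be - al) o x.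
  by rewrite /even_dual (_ : be + 1 - (al + 1) = be - al)//; ring.
have Ih : \int[mu]_y h y = abel (be - al) e x + x * abel (be - al) o x.
  by rewrite (eq_Rint Eh) (RintD ip iq) Iq addr0 (RintD ie (integZ x io)) (RintZ _ io).
have mD : measurable [set y : R | `|x| <= `|y|].
  have := @measurable_fun_ler _ _ R setT (fun=> `|x|) (fun y : R => `|y|)
    (@measurable_cst _ _ _ _ _ _) (@normr_measurable R setT).
  by move=> /(_ measurableT [set true] I); rewrite setTI.
apply: (@etrans _ _ (sonine_a al be * \int[mu]_y h y)); last first.
  rewrite Ih a1 /even_dual (sonine_aS a0 ab).
  move: (abel _ _ _) (abel _ _ _) (sonine_a _ _) (_ / _) => u v w r.
  by ring.
apply: (congr1 ( *%R _)); apply: (Rint_off2 (c := x) mD _ mh).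
  apply: measurable_funM; first apply: measurable_funM.
  - apply: measurable_funM; first exact: measurable_sg.
    apply: (measurableT_comp (measurable_powR _)).
    by apply: measurable_funB => //; exact: exprn_measurable.
  - exact: measurable_funD.
  - by apply: measurable_funD => //; exact: measurable_funM.
move=> y y1 y2; rewrite patchE /h /k.
have sq : (0 < y ^+ 2 - x ^+ 2) = (`|x| < `|y|).
  by rewrite subr_gt0 -(real_normK (num_real x)) -(real_normK (num_real y)) ltr_sqr ?nnegrE.
case: ifPn => [|/negP]; rewrite inE/= => xy.
  have xy' : `|x| < `|y|.
    rewrite lt_neqAle xy andbT; rewrite eqr_norm2 negb_or eq_sym y1/=.
    by rewrite -eqr_oppLR eq_sym.
  by rewrite tpowE// sq.
have xy' : y ^+ 2 - x ^+ 2 <= 0.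
  by rewrite leNgt sq; apply/negP => xy'; apply: xy; exact: ltW.
by rewrite (tpow_npos _ xy') mulr0 !mul0r.
Qed.

Lemma dual_sonine_cpx al be e1 o1 e2 o2 : - (1 / 2) < al -> al < be ->
  even_schwartz e1 -> even_schwartz o1 -> even_schwartz e2 -> even_schwartz o2 ->
  dual_sonine al be (cpx e1 o1 e2 o2) =
  cpx (even_dual al be e1) (fun x => (al + 1) / (be + 1) * even_dual (al + 1) (be + 1) o1 x)
      (even_dual al be e2) (fun x => (al + 1) / (be + 1) * even_dual (al + 1) (be + 1) o2 x).
Proof.
move=> a0 ab h1 k1 h2 k2; apply/funext => x.
rewrite /cpx -(Rint_dual x a0 ab h1 k1) -(Rint_dual x a0 ab h2 k2).
rewrite /dual_sonine /cint /cpx.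
move: (sonine_a al be) => c.
pose w y := Num.sg y * (y ^+ 2 - x ^+ 2) `^ (be - al - 1) * (x + y).
pose D := [set y : R | `|x| <= `|y|].
apply: (@etrans _ _ (c * \int[mu]_(y in D) complex.Re ((w y)%:C * ((e1 y + y * o1 y) +i*
  (e2 y + y * o2 y))) +i* (c * \int[mu]_(y in D) complex.Im ((w y)%:C *
  ((e1 y + y * o1 y) +i* (e2 y + y * o2 y)))))).
  rewrite /D /w; move: (\int[mu]_(t in _) _) (\int[mu]_(t in _) _) => I J.
  by apply/eqP; rewrite eq_complex /=; apply/andP; split; apply/eqP; ring.
by congr (c * _ +i* (c * _)); apply: (congr1 (fun u => Rintegral mu _ u)); apply/funext => t /=;
  rewrite !mul0r ?subr0 ?addr0.
Qed.

End componentwise.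

(** * Inversion and Plancherel formulas *)

Section assembly.
Variable R : realType.
Local Open Scope complex_scope.
Local Notation mu := (@lebesgue_measure R).
Local Notation integ f := (mu.-integrable setT (EFin \o f)).
Implicit Types (al be c g x s : R) (e o phi : R -> R).

Lemma even_powerZ g s c phi : - (1 / 2) < g -> even_lizorkin g phi ->
  even_power g s (fun x => c * phi x) = (fun x => c * even_power g s phi x).
Proof.
move=> g0 lp; have [hp _] := lp; apply/funext => x.
have hf := flat_even_schwartz (flat_schwartz_powR s (hankel_flat g0 lp)).
have E : (fun l => `|l| `^ s * hankel g (fun x => c * phi x) l) =
    (fun l => c * (`|l| `^ s * hankel g phi l)).
  by apply/funext => l; rewrite (hankelZ _ _ g0 hp) mulrCA.
have P psi : even_power g s psi x = dunkl_c g * hankel g (fun l => `|l| `^ s * hankel g psi l) x by [].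
by rewrite 2!P E (hankelZ _ _ g0 hf) mulrCA.
Qed.

Lemma even_sonineZ al be c phi : - (1 / 2) < al -> al < be -> even_schwartz phi ->
  even_sonine al be (fun x => c * phi x) = (fun x => c * even_sonine al be phi x).
Proof.
move=> a0 ab hp; apply/funext => x.
have [M hM] := rapid_bounded (even_schwartz_rapid hp).
have i : integ (fun t => phi (x * t) * sonine_kernel al be t).
  apply: (integ_sonine a0 ab); last by exists M => t; exact: hM.
  by apply: (measurableT_comp (even_schwartz_measurable hp)); exact: mulrl_measurable.
by apply: etrans _ (RintZ c i); apply: eq_Rint => t; rewrite mulrA.
Qed.

Lemma even_dualZ al be c phi : al < be -> even_schwartz phi ->
  even_dual al be (fun x => c * phi x) = (fun x => c * even_dual al be phi x).
Proof.
move=> ab hp; apply/funext => x; have b0 : 0 < be - al by lra.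
have E : abel (be - al) (fun x => c * phi x) x = c * abel (be - al) phi x.
  apply: etrans _ (RintZ c (integ_abel x b0 hp)).
  by apply: eq_Rint => t; rewrite mulrCA.
by rewrite /even_dual E mulrCA.
Qed.

Lemma even_lizorkinZ g c phi : - (1 / 2) < g -> even_lizorkin g phi ->
  even_lizorkin g (fun x => c * phi x).
Proof.
move=> g0 [hp m]; split; first exact: even_schwartzZ.
move=> k; have i : integ (fun x => phi x * (x ^+ 2) ^+ k * weight g x).
  have h : even_schwartz (fun x => phi x * (x ^+ 2) ^+ k).
    elim: k => [|k ih].
      by apply: eq_tower hp => x; rewrite expr0 mulr1.
    by apply: eq_tower (even_schwartz_sqr ih) => x; rewrite (exprS (x ^+ 2)) mulrCA.
  exact: integ_weight g0 (even_schwartz_measurable h) (even_schwartz_rapid h).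
rewrite -[RHS](mulr0 c) -[X in c * X](m k) -(RintZ _ i).
by apply: eq_Rint => x; rewrite !mulrA.
Qed.

Let ratio al be : R := (al + 1) / (be + 1).

(** The squared ratio accounts for the two factors that the Sonine transform and its
    dual produce on odd parts. *)
Let ratioE al be : - (1 / 2) < al -> al < be ->
  dunkl_c (be + 1) / dunkl_c (al + 1) =
  dunkl_c be / dunkl_c al * ratio al be ^+ 2 :> R.
Proof.
move=> a0 ab; have be0 : - (1 / 2) < be by lra.
rewrite (dunkl_cS a0) (dunkl_cS be0) /ratio.
have p1 : be + 1 != 0 by rewrite gt_eqF//; lra.
have p2 : al + 1 != 0 by rewrite gt_eqF//; lra.
have p3 : 2 * be + 2 != 0 by rewrite gt_eqF//; lra.
have p4 : 2 * al + 2 != 0 by rewrite gt_eqF//; lra.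
have := lt0r_neq0 (dunkl_c_gt0 a0).
move: (dunkl_c be) (dunkl_c al) => u v v0.
by field; rewrite ?p1 ?p2 ?p3 ?p4 ?v0.
Qed.

Let shiftE al be : be + 1 - (al + 1) = be - al :> R. Proof. by ring. Qed.

Let odd_sonine al be o x : - (1 / 2) < al -> al < be -> even_lizorkin (be + 1) o ->
  ratio al be * even_sonine (al + 1) (be + 1) (fun x => dunkl_c be / dunkl_c al *
    even_power (al + 1) (2 * (be - al))
      (fun x => ratio al be * even_dual (al + 1) (be + 1) o x) x) x = o x.
Proof.
move=> a0 ab lo; have a1 : - (1 / 2) < al + 1 by lra.
have ab1 : al + 1 < be + 1 by lra.
have ld := even_lizorkin_dual a1 ab1 lo.
have lp := even_lizorkin_power (2 * (be - al)) a1 ld; have [hp _] := lp.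
rewrite (even_powerZ _ _ a1 ld) (even_sonineZ _ a1 ab1 (even_schwartzZ _ hp)).
rewrite (even_sonineZ _ a1 ab1 hp).
have := sonine_power_dual x a1 ab1 lo; rewrite shiftE (ratioE a0 ab) => <-.
move: (even_sonine _ _ _ _) (ratio _ _) (_ / _) => u v w.
by ring.
Qed.

Let odd_dual al be o x : - (1 / 2) < al -> al < be -> even_lizorkin (al + 1) o ->
  ratio al be * even_dual (al + 1) (be + 1) (fun x => dunkl_c be / dunkl_c al *
    even_power (be + 1) (2 * (be - al))
      (fun x => ratio al be * even_sonine (al + 1) (be + 1) o x) x) x = o x.
Proof.
move=> a0 ab lo; have a1 : - (1 / 2) < al + 1 by lra.
have b1 : - (1 / 2) < be + 1 by lra.
have ab1 : al + 1 < be + 1 by lra.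
have ld := even_lizorkin_sonine a1 ab1 lo.
have lp := even_lizorkin_power (2 * (be - al)) b1 ld; have [hp _] := lp.
rewrite (even_powerZ _ _ b1 ld) (even_dualZ _ ab1 (even_schwartzZ _ hp)).
rewrite (even_dualZ _ ab1 hp).
have := dual_power_sonine x a1 ab1 lo; rewrite shiftE (ratioE a0 ab) => <-.
move: (even_dual _ _ _ _) (ratio _ _) (_ / _) => u v w.
by ring.
Qed.

Let even_inv al be e x : - (1 / 2) < al -> al < be -> even_lizorkin be e ->
  even_sonine al be (fun x => dunkl_c be / dunkl_c al *
    even_power al (2 * (be - al)) (even_dual al be e) x) x = e x.
Proof.
move=> a0 ab le.
have [hp _] := even_lizorkin_power (2 * (be - al)) a0 (even_lizorkin_dual a0 ab le).
by rewrite (even_sonineZ _ a0 ab hp) (sonine_power_dual x a0 ab le).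
Qed.

Let even_inv' al be e x : - (1 / 2) < al -> al < be -> even_lizorkin al e ->
  even_dual al be (fun x => dunkl_c be / dunkl_c al *
    even_power be (2 * (be - al)) (even_sonine al be e) x) x = e x.
Proof.
move=> a0 ab le; have be0 : - (1 / 2) < be by lra.
have [hp _] := even_lizorkin_power (2 * (be - al)) be0 (even_lizorkin_sonine a0 ab le).
by rewrite (even_dualZ _ ab hp) (dual_power_sonine x a0 ab le).
Qed.

(** The real and imaginary parts are e1 + x o1 and e2 + x o2; the quotients o1, o2
    carry the index g + 1 because x^2 |x|^(2g+1) is the weight of that index. *)
Let parts g e1 o1 e2 o2 := [/\ even_lizorkin g e1, even_lizorkin (g + 1) o1,
  even_lizorkin g e2 & even_lizorkin (g + 1) o2].

Let lizorkin_parts g (f : R -> R[i]) : - (1 / 2) < g -> lizorkin g f ->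
  exists e1 o1 e2 o2 : R -> R, parts g e1 o1 e2 o2 /\ f = cpx e1 o1 e2 o2.
Proof.
move=> g0 lf; have [sf _] := lf.
have [e1 [ o1 [e2 [ o2 [h1 k1 h2 k2 E]]]]] := schwartz_decomp sf.
exists e1, o1, e2, o2; split => //; rewrite E in lf.
exact/(lizorkin_cpx g0 h1 k1 h2 k2).
Qed.

Let parts_lizorkin g e1 o1 e2 o2 : - (1 / 2) < g -> parts g e1 o1 e2 o2 ->
  lizorkin g (cpx e1 o1 e2 o2).
Proof.
move=> g0 l; have [[h1 _] [k1 _] [h2 _] [k2 _]] := l.
exact/(lizorkin_cpx g0 h1 k1 h2 k2).
Qed.

Let dual_parts al be e1 o1 e2 o2 : - (1 / 2) < al -> al < be -> parts be e1 o1 e2 o2 ->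
  parts al (even_dual al be e1) (fun x => ratio al be * even_dual (al + 1) (be + 1) o1 x)
    (even_dual al be e2) (fun x => ratio al be * even_dual (al + 1) (be + 1) o2 x).
Proof.
move=> a0 ab [l1 m1 l2 m2]; have a1 : - (1 / 2) < al + 1 by lra.
have ab1 : al + 1 < be + 1 by lra.
by split; try apply: (even_lizorkinZ _ a1); apply: even_lizorkin_dual.
Qed.

Let sonine_parts al be e1 o1 e2 o2 : - (1 / 2) < al -> al < be -> parts al e1 o1 e2 o2 ->
  parts be (even_sonine al be e1) (fun x => ratio al be * even_sonine (al + 1) (be + 1) o1 x)
    (even_sonine al be e2) (fun x => ratio al be * even_sonine (al + 1) (be + 1) o2 x).
Proof.
move=> a0 ab [l1 m1 l2 m2]; have a1 : - (1 / 2) < al + 1 by lra.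
have b1 : - (1 / 2) < be + 1 by lra.
have ab1 : al + 1 < be + 1 by lra.
by split; try apply: (even_lizorkinZ _ b1); apply: even_lizorkin_sonine.
Qed.

Let multiplier_parts g s c e1 o1 e2 o2 : - (1 / 2) < g -> parts g e1 o1 e2 o2 ->
  parts g (fun x => c * even_power g s e1 x) (fun x => c * even_power (g + 1) s o1 x)
    (fun x => c * even_power g s e2 x) (fun x => c * even_power (g + 1) s o2 x) /\
  (fun x => c%:C * dunkl_inverse g (fun l => (`|l| `^ s)%:C *
    dunkl_transform g (cpx e1 o1 e2 o2) l) x) =
  cpx (fun x => c * even_power g s e1 x) (fun x => c * even_power (g + 1) s o1 x)
    (fun x => c * even_power g s e2 x) (fun x => c * even_power (g + 1) s o2 x).
Proof.
move=> g0 [l1 m1 l2 m2]; have g1 : - (1 / 2) < g + 1 by lra.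
split.
  split.
  - exact: (even_lizorkinZ c g0 (even_lizorkin_power s g0 l1)).
  - exact: (even_lizorkinZ c g1 (even_lizorkin_power s g1 m1)).
  - exact: (even_lizorkinZ c g0 (even_lizorkin_power s g0 l2)).
  - exact: (even_lizorkinZ c g1 (even_lizorkin_power s g1 m2)).
by apply/funext => x; rewrite (dunkl_multiplier s g0 l1 m1 l2 m2) cpxZ.
Qed.

Let cpx_congr (e1 o1 e2 o2 d1 p1 d2 p2 : R -> R) x :
  e1 x = d1 x -> o1 x = p1 x -> e2 x = d2 x -> o2 x = p2 x ->
  cpx e1 o1 e2 o2 x = cpx d1 p1 d2 p2 x.
Proof. by rewrite /cpx => -> -> -> ->. Qed.

Lemma sonine_inversion al be (f : R -> R[i]) : - (1 / 2) < al -> al < be ->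
  lizorkin be f ->
  [/\ lizorkin al (dual_sonine al be f), smooth (K1 al be (dual_sonine al be f)) &
      forall x, f x = sonine al be (K1 al be (dual_sonine al be f)) x].
Proof.
move=> a0 ab lf; have be0 : - (1 / 2) < be by lra.
have [e1 [ o1 [e2 [ o2 [P ->]]]]] := lizorkin_parts be0 lf.
have [[h1 _] [k1 _] [h2 _] [k2 _]] := P.
have D := dual_parts a0 ab P.
rewrite (dual_sonine_cpx a0 ab h1 k1 h2 k2) -/(ratio al be).
have [M ME] := multiplier_parts (2 * (be - al)) (dunkl_c be / dunkl_c al) a0 D.
have lD := parts_lizorkin a0 D; have lM := parts_lizorkin a0 M.
have -> : K1 al be (cpx (even_dual al be e1)
    (fun x => ratio al be * even_dual (al + 1) (be + 1) o1 x) (even_dual al be e2)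
    (fun x => ratio al be * even_dual (al + 1) (be + 1) o2 x)) = _ := ME.
split => //; first by case: lM => -[].
have [[u1 _] [v1 _] [u2 _] [v2 _]] := M; have [l1 m1 l2 m2] := P.
move=> x; rewrite (sonine_cpx a0 ab u1 v1 u2 v2) -/(ratio al be); apply: esym.
exact: (cpx_congr (even_inv x a0 ab l1) (odd_sonine x a0 ab m1)
  (even_inv x a0 ab l2) (odd_sonine x a0 ab m2)).
Qed.

Lemma dual_sonine_inversion al be (f : R -> R[i]) : - (1 / 2) < al -> al < be ->
  lizorkin al f ->
  [/\ lizorkin be (sonine al be f), schwartz (K2 al be (sonine al be f)) &
      forall x, f x = dual_sonine al be (K2 al be (sonine al be f)) x].
Proof.
move=> a0 ab lf; have be0 : - (1 / 2) < be by lra.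
have [e1 [ o1 [e2 [ o2 [P ->]]]]] := lizorkin_parts a0 lf.
have [[h1 _] [k1 _] [h2 _] [k2 _]] := P.
have D := sonine_parts a0 ab P.
rewrite (sonine_cpx a0 ab h1 k1 h2 k2) -/(ratio al be).
have [M ME] := multiplier_parts (2 * (be - al)) (dunkl_c be / dunkl_c al) be0 D.
have lD := parts_lizorkin be0 D; have lM := parts_lizorkin be0 M.
have -> : K2 al be (cpx (even_sonine al be e1)
    (fun x => ratio al be * even_sonine (al + 1) (be + 1) o1 x) (even_sonine al be e2)
    (fun x => ratio al be * even_sonine (al + 1) (be + 1) o2 x)) = _ := ME.
split => //; first by case: lM.
have [[u1 _] [v1 _] [u2 _] [v2 _]] := M; have [l1 m1 l2 m2] := P.
move=> x; rewrite (dual_sonine_cpx a0 ab u1 v1 u2 v2) -/(ratio al be); apply: esym.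
exact: (cpx_congr (even_inv' x a0 ab l1) (odd_dual x a0 ab m1)
  (even_inv' x a0 ab l2) (odd_dual x a0 ab m2)).
Qed.

Let norm2 g phi : R := \int[mu]_x (phi x ^+ 2 * weight g x).

Let norm2Z g c phi : - (1 / 2) < g -> even_schwartz phi ->
  norm2 g (fun x => c * phi x) = c ^+ 2 * norm2 g phi.
Proof.
move=> g0 hp; rewrite /norm2 -(RintZ _ (integ_weight_sqr g0 hp)).
by apply: eq_Rint => x; rewrite exprMn mulrA.
Qed.

(** The cross terms of |e + x o|^2 are odd. *)
Let norm2_cpx g e1 o1 e2 o2 : - (1 / 2) < g -> even_schwartz e1 -> even_schwartz o1 ->
  even_schwartz e2 -> even_schwartz o2 ->
  (\int[mu]_x ((cabs (cpx e1 o1 e2 o2 x)) ^+ 2 * `|x| `^ (2 * g + 1))%:E =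
  (norm2 g e1 + norm2 (g + 1) o1 + (norm2 g e2 + norm2 (g + 1) o2))%:E)%E.
Proof.
move=> g0 h1 k1 h2 k2; have g1 : - (1 / 2) < g + 1 by lra.
have K e o : even_schwartz e -> even_schwartz o ->
    integ (fun x => (e x + x * o x) ^+ 2 * weight g x) /\
    \int[mu]_x ((e x + x * o x) ^+ 2 * weight g x) = norm2 g e + norm2 (g + 1) o.
  move=> he ho; have ie := integ_weight_sqr g0 he; have io := integ_weight_sqr g1 ho.
  have me := even_schwartz_measurable he; have mo := even_schwartz_measurable ho.
  have [M hM] := rapid_bounded (even_schwartz_rapid ho).
  have iq : integ (fun x => x * (2 * e x * o x * weight g x)).
    apply: eq_integ (integ_weight (phi := fun x => 2 * e x * o x * x) g0 _ _) => [x| |].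
    - by move: (weight g x) (e x) (o x) => u v w; ring.
    - by apply: measurable_funM => //; do 2 apply: measurable_funM => //.
    - apply: rapidM; last exact: tempered_id.
      apply: rapidM; last exact: tempered_bounded hM.
      by apply: rapidZ; exact: even_schwartz_rapid.
  have [] := @Rint_even_odd R (fun x => e x ^+ 2 * weight g x + o x ^+ 2 * weight (g + 1) x)
    (fun x => 2 * e x * o x * weight g x).
  - by move=> x; rewrite (even_schwartz_even he) (even_schwartz_even ho) !weight_even.
  - by move=> x; rewrite (even_schwartz_even he) (even_schwartz_even ho) weight_even.
  - exact: integD.
  - exact: iq.
  have E x : e x ^+ 2 * weight g x + o x ^+ 2 * weight (g + 1) x +
      x * (2 * e x * o x * weight g x) = (e x + x * o x) ^+ 2 * weight g x.
    by rewrite (weightS _ g0); move: (weight g x) (e x) (o x) => u v w; ring.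
  move=> i1 E1; split; first exact: eq_integ E i1.
  by rewrite -(eq_Rint E) E1 (RintD ie io).
have [i1 E1] := K _ _ h1 k1; have [i2 E2] := K _ _ h2 k2.
rewrite -E1 -E2 -(RintD i1 i2) (Rint_fin (integD i1 i2)).
by apply: eq_integral => x _; rewrite cabs_sqr /= mulrDl.
Qed.

Lemma dual_sonine_plancherel al be (f : R -> R[i]) : - (1 / 2) < al -> al < be ->
  lizorkin be f ->
  (\int[mu]_x ((cabs (f x)) ^+ 2 * `|x| `^ (2 * be + 1))%:E =
   \int[mu]_x ((cabs (K3 al be (dual_sonine al be f) x)) ^+ 2 *
     `|x| `^ (2 * al + 1))%:E)%E.
Proof.
move=> a0 ab lf; have be0 : - (1 / 2) < be by lra.
have a1 : - (1 / 2) < al + 1 by lra.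
have ab1 : al + 1 < be + 1 by lra.
have [e1 [ o1 [e2 [ o2 [P ->]]]]] := lizorkin_parts be0 lf.
have [[h1 _] [k1 _] [h2 _] [k2 _]] := P; have [l1 m1 l2 m2] := P.
have D := dual_parts a0 ab P.
rewrite (dual_sonine_cpx a0 ab h1 k1 h2 k2) -/(ratio al be).
have [M ME] := multiplier_parts (be - al) (Num.sqrt (dunkl_c be / dunkl_c al)) a0 D.
have -> : K3 al be (cpx (even_dual al be e1)
    (fun x => ratio al be * even_dual (al + 1) (be + 1) o1 x) (even_dual al be e2)
    (fun x => ratio al be * even_dual (al + 1) (be + 1) o2 x)) = _ := ME.
have [[u1 _] [v1 _] [u2 _] [v2 _]] := M.
rewrite (norm2_cpx be0 h1 k1 h2 k2) (norm2_cpx a0 u1 v1 u2 v2).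
have C0 : 0 <= dunkl_c be / dunkl_c al :> R.
  by rewrite divr_ge0// ltW// dunkl_c_gt0.
have Pe e : even_lizorkin be e ->
    norm2 al (fun x => Num.sqrt (dunkl_c be / dunkl_c al) *
      even_power al (be - al) (even_dual al be e) x) = norm2 be e.
  move=> le; have [hp _] := even_lizorkin_power (be - al) a0 (even_lizorkin_dual a0 ab le).
  by rewrite (norm2Z _ a0 hp) sqr_sqrtr// (plancherel_power_dual a0 ab le).
have Po o : even_lizorkin (be + 1) o ->
    norm2 (al + 1) (fun x => Num.sqrt (dunkl_c be / dunkl_c al) *
      even_power (al + 1) (be - al) (fun x => ratio al be * even_dual (al + 1) (be + 1) o x) x) =
    norm2 (be + 1) o.
  move=> lo; have ld := even_lizorkin_dual a1 ab1 lo.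
  have [hp _] := even_lizorkin_power (be - al) a1 ld.
  rewrite (even_powerZ _ _ a1 ld) (norm2Z _ a1 (even_schwartzZ _ hp)) (norm2Z _ a1 hp).
  rewrite sqr_sqrtr// mulrA -(ratioE a0 ab).
  by have := plancherel_power_dual a1 ab1 lo; rewrite shiftE.
apply: (congr1 EFin); apply: esym.
exact: (f_equal2 +%R (f_equal2 +%R (Pe _ l1) (Po _ m1)) (f_equal2 +%R (Pe _ l2) (Po _ m2))).
Qed.

End assembly.

Theorem theorem3 (R : realType) (alpha beta : R)
    (halpha : - (1 / 2) < alpha) (hbeta : - (1 / 2) < beta)
    (hab : alpha < beta) :
  (forall f g : R -> R[i], lizorkin alpha f -> lizorkin beta g ->
    (* (i)(a), with each operator applied inside its domain *)
    (lizorkin alpha (dual_sonine alpha beta g) /\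
     smooth (K1 alpha beta (dual_sonine alpha beta g)) /\
     forall x : R,
       g x = sonine alpha beta (K1 alpha beta (dual_sonine alpha beta g)) x) /\
    (* (i)(b), with each operator applied inside its domain *)
    (lizorkin beta (sonine alpha beta f) /\
     schwartz (K2 alpha beta (sonine alpha beta f)) /\
     forall x : R,
       f x = dual_sonine alpha beta (K2 alpha beta (sonine alpha beta f)) x)) /\
  (* (ii) *)
  (forall f : R -> R[i], lizorkin beta f ->
    lizorkin alpha (dual_sonine alpha beta f) /\
    (\int[@lebesgue_measure R]_x
        ((cabs (f x)) ^+ 2 * `|x| `^ (2 * beta + 1))%:E =
     \int[@lebesgue_measure R]_x
        ((cabs (K3 alpha beta (dual_sonine alpha beta f) x)) ^+ 2 *
         `|x| `^ (2 * alpha + 1))%:E)%E).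
Proof.
split=> [f g lf lg|f lf].
  have [d1 s1 i1] := sonine_inversion halpha hab lg.
  have [d2 s2 i2] := dual_sonine_inversion halpha hab lf.
  by [].
have [d _ _] := sonine_inversion halpha hab lf.
by split => //; exact: dual_sonine_plancherel.
Qed.
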